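(* There exists a finitely generated group $G$ with Kazhdan's property (T) which is locally embeddable into finite groups (in particular $G$ is sofic, and hence hyperlinear) but which does not have Kirchberg's factorization property.
   Context: Property (T): a group $G$ has Kazhdan's property (T) (is a Kazhdan group) if for every unitary Hilbert space representation $\pi\colon G\to U(H)$ and every map $c\colon G\to H$ with $c(gh)=\pi(g)c(h)+c(g)$ for all $g,h\in G$, there is a constant $C\in\mathbb{R}$ with $\|c(g)\|\le C$ for all $g\in G$. Locally embeddable into finite groups (LEF): every finite piece of the multiplication table of $G$ can be found as a piece of the multiplication table of a finite group; i.e. for every finite subset $F\subset G$ there are a finite group $K$ and an injective map $\phi\colon F\cup F^2\to K$, where $F^2=\{f_1f_2\mid f_1,f_2\in F\}$, with $\phi(f_1f_2)=\phi(f_1)\phi(f_2)$ for all $f_1,f_2\in F$. Sofic: for any $0<\epsilon<1$ and any finite subset $F\subseteq G$ there exist $n\in\mathbb{N}$ and a map $\phi\colon G\to S_n$ (symmetric group) such that (i) $\phi(g)\phi(h)\phi(gh)^{-1}$ has at least $(1-\epsilon)n$ fixed points for all $g,h\in F$; (ii) $\phi(e)=e$; (iii) $\phi(g)$ has at most $\epsilon n$ fixed points for all $e\neq g\in F$. Hyperlinear: let $G$ be a finitely generated group with finite generating set $S$. Let $F_S$ be the free monoid on the symbols $\{s,s^*\mid s\in S\}$ and $w\colon F_S\to G$ the monoid surjection with $w(s)=s$, $w(s^* )=s^{-1}$. Given $n\in\mathbb{N}$ and $\varepsilon>0$, $(\varepsilon,n)$-microstates are complex $k\times k$-matrices $\{u_s\}_{s\in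 S}$ (for some $k$) such that, with $\overline w\colon F_S\to M_k\mathbb{C}$ the monoid homomorphism $\overline w(s)=u_s$, $\overline w(s^* )=u_s^*$, for all words $t\in F_S$ of length $\le n$ the number $\mathrm{tr}(\overline w(t))$ is $\varepsilon$-close to $0$ if $w(t)\ne e$ and $\varepsilon$-close to $1$ if $w(t)=e$; here $\mathrm{tr}$ is the normalized trace. $G$ is hyperlinear if it admits $(\varepsilon,n)$-microstates for all $n\in\mathbb{N}$ and $\varepsilon>0$. Factorization property: $G$ has the factorization property if it is hyperlinear and the approximation is induced by unital completely positive maps, i.e. there are unital completely positive linear maps $\phi_k\colon C^*G\to M_{n_k}\mathbb{C}$ such that (i) $\lim_{k\to\infty}\|\phi_k(a)\phi_k(b)-\phi_k(ab)\|_2=0$ for all $a,b\in C^*G$, and (ii) $\lim_{k\to\infty}|\tau(a)-\mathrm{tr}\circ\phi_k(a)|=0$ for all $a\in C^*G$. Here $C^*G$ is the maximal group $C^*$-algebra, $\tau\colon C^*G\to\mathbb{C}$ its canonical trace (with $\tau(g)=\delta_{g,e}$ for $g\in G$), $\mathrm{tr}$ the normalized trace and $\|x\|_2=\mathrm{tr}(x^*x)^{1/2}$. *)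

(* Defs.v *)
From HB Require Import structures.
From mathcomp Require Import all_boot all_order all_fingroup all_algebra.
From mathcomp Require Import complex.
From mathcomp Require Import all_classical all_reals all_analysis.

Set Implicit Arguments.
Unset Strict Implicit.
Unset Printing Implicit Defensive.

Import Order.TTheory GRing.Theory Num.Theory.
Import numFieldNormedType.Exports.

Local Open Scope classical_set_scope.
Local Open Scope complex_scope.
Local Open Scope ring_scope.

(* The letter (s, false) stands for the symbol s, (s, true) for s^*. *)
Definition word (G : Type) := seq (G * bool).

Definition word_on (G : groupType) (S : seq G) (t : word G) : bool :=
  all (fun l => l.1 \in S) t.

Definition word_eval (G : groupType) (t : word G) : G :=
  foldr (fun l g => ((if l.2 then l.1^-1 else l.1) * g)%g) 1%g t.

Definition generates (G : groupType) (S : seq G) : Prop :=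
  forall g : G, exists2 t : word G, word_on S t & word_eval t = g.

Definition finitely_generated (G : groupType) : Prop :=
  exists S : seq G, generates S.

Structure hilbertSpace (R : realType) := HilbertSpace {
  hilbert_sort :> completeNormedModType R[i];
  inner : {dot hilbert_sort for Num.conj};
  inner_norm : forall x : hilbert_sort, inner x x = `|x| ^+ 2 }.
Arguments inner {R} H : rename.

Structure unitaryRep (R : realType) (G : groupType) (H : hilbertSpace R) :=
  UnitaryRep {
  rep_fun :> G -> {linear H -> H};
  rep1 : forall x : H, rep_fun 1%g x = x;
  repM : forall (g h : G) (x : H), rep_fun (g * h)%g x = rep_fun g (rep_fun h x);
  rep_unitary : forall (g : G) (x y : H),
    inner H (rep_fun g x) (rep_fun g y) = inner H x y }.

Definition kazhdan (R : realType) (G : groupType) : Prop :=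
  forall (H : hilbertSpace R) (pi : unitaryRep G H) (c : G -> H),
    (forall g h : G, c (g * h)%g = pi g (c h) + c g) ->
    exists M : R, forall g : G, `|c g| <= M%:C.

Definition LEF (G : groupType) : Prop :=
  forall F : seq G,
  let F2 := [seq (f1 * f2)%g | f1 <- F, f2 <- F] in
  exists (K : finGroupType) (phi : G -> K),
    {in F ++ F2 &, injective phi} /\
    {in F &, forall f1 f2 : G, phi (f1 * f2)%g = (phi f1 * phi f2)%g}.

Definition fixpoints (n : nat) (p : 'S_n) : {set 'I_n} := [set i | p i == i]%SET.

(* The degree n is required to be positive: in degree 0 all three conditions
   hold for every group.  The product of [{perm _}] composes from left to
   right; replacing phi by its pointwise inverse gives the same notion for the
   other convention. *)
Definition sofic (R : realType) (G : groupType) : Prop :=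
  forall (eps : R) (F : seq G), 0 < eps < 1 ->
  exists (n : nat) (phi : G -> 'S_n), (0 < n)%N /\
    [/\ {in F &, forall g h : G, (1 - eps) * n%:R <=
           #|fixpoints (phi g * phi h * (phi (g * h))^-1)%g|%:R},
        phi 1%g = 1%g
      & {in F, forall g : G, g <> 1%g ->
           #|fixpoints (phi g)|%:R <= eps * n%:R}].

Definition adjmx (R : realType) m n (A : 'M[R[i]]_(m, n)) : 'M[R[i]]_(n, m) :=
  map_mx Num.conj A^T.

Definition ntr (R : realType) n (A : 'M[R[i]]_n) : R[i] := \tr A / n%:R.

Definition norm2 (R : realType) n (A : 'M[R[i]]_n) : R[i] :=
  sqrtC (ntr (adjmx A *m A)).

Definition word_evalmx (R : realType) (G : Type) n
    (u : G -> 'M[R[i]]_n) (t : word G) : 'M[R[i]]_n :=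
  foldr (fun l A => (if l.2 then adjmx (u l.1) else u l.1) *m A) 1%:M t.

(* Only the values of u on S matter. *)
Definition microstates (R : realType) (G : groupType) (S : seq G)
    (eps : R) (n k : nat) (u : G -> 'M[R[i]]_k) : Prop :=
  forall t : word G, word_on S t -> (size t <= n)%N ->
    `|ntr (word_evalmx u t) - (word_eval t == 1%g)%:R| <= eps%:C.

Definition hyperlinear (R : realType) (G : groupType) : Prop :=
  finitely_generated G /\
  forall S : seq G, generates S ->
  forall (n : nat) (eps : R), 0 < eps ->
  exists (k : nat) (u : G -> 'M[R[i]]_k), (0 < k)%N /\ microstates S eps n u.

Structure cstarAlgebra (R : realType) := CstarAlgebra {
  cstar_sort :> completeNormedModType R[i];
  cmul : {bilinear cstar_sort -> cstar_sort -> cstar_sort};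
  cone : cstar_sort;
  cstar : cstar_sort -> cstar_sort;
  cmulA : associative cmul;
  cmul1l : left_id cone cmul;
  cmul1r : right_id cone cmul;
  cstarK : involutive cstar;
  cstarP : forall (a : R[i]) (x y : cstar_sort),
    cstar (a *: x + y) = Num.conj a *: cstar x + cstar y;
  cstarM : forall x y : cstar_sort, cstar (cmul x y) = cmul (cstar y) (cstar x);
  cmul_norm : forall x y : cstar_sort, `|cmul x y| <= `|x| * `|y|;
  cstar_norm : forall x : cstar_sort, `|cmul (cstar x) x| = `|x| ^+ 2 }.
Arguments cmul {R} A : rename.
Arguments cone {R} A : rename.
Arguments cstar {R} A : rename.

Definition lincomb (R : realType) (G : Type) (V : lmodType R[i])
    (u : G -> V) (s : seq (R[i] * G)) : V :=
  \sum_(x <- s) x.1 *: u x.2.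

(* A is the completion of the group algebra C[G], embedded by u, for the
   C*-norm ||s|| = sup { ||pi(s)|| : pi unitary representation of G }. *)
Record max_group_cstar (R : realType) (G : groupType) (A : cstarAlgebra R)
    (u : G -> A) : Prop := MaxGroupCstar {
  max_cstar1 : u 1%g = cone A;
  max_cstarM : forall g h : G, u (g * h)%g = cmul A (u g) (u h);
  max_cstarV : forall g : G, u g^-1%g = cstar A (u g);
  max_cstar_dense : closure (range (lincomb u)) = [set: A];
  max_cstar_ub : forall (s : seq (R[i] * G)) (H : hilbertSpace R)
      (pi : unitaryRep G H) (x : H),
    `|lincomb (fun g => pi g x) s| <= `|lincomb u s| * `|x|;
  max_cstar_lub : forall (s : seq (R[i] * G)) (M : R),
    (forall (H : hilbertSpace R) (pi : unitaryRep G H) (x : H),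
       `|lincomb (fun g => pi g x) s| <= M%:C * `|x|) ->
    `|lincomb u s| <= M%:C }.

Record canonical_trace (R : realType) (G : groupType) (A : cstarAlgebra R)
    (u : G -> A) (tau : {scalar A}) : Prop := CanonicalTrace {
  can_trace_ge0 : forall a : A, 0 <= tau (cmul A (cstar A a) a);
  can_traceC : forall a b : A, tau (cmul A a b) = tau (cmul A b a);
  can_traceE : forall g : G, tau (u g) = (g == 1%g)%:R }.

Definition psdmx (R : realType) n (M : 'M[R[i]]_n) : Prop :=
  forall v : 'cV[R[i]]_n, 0 <= (adjmx v *m M *m v) 0 0.

(* The positive elements of M_m(A) are the matrices Y^* Y, and M_m(M_n(C)) is
   identified with M_mn(C) by blocks. *)
Definition completely_positive (R : realType) (A : cstarAlgebra R) n
    (phi : A -> 'M[R[i]]_n) : Prop :=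
  forall (m : nat) (Y : 'M[A]_m),
    psdmx (\mxblock_(i < m, j < m)
             phi (\sum_l cmul A (cstar A (Y l i)) (Y l j))).

(* C*G and its canonical trace exist and are unique up to isomorphism, so the
   quantification over A, u and tau only chooses a model of them. *)
Definition factorization_property (R : realType) (G : groupType) : Prop :=
  hyperlinear R G /\
  forall (A : cstarAlgebra R) (u : G -> A) (tau : {scalar A}),
    max_group_cstar u -> canonical_trace u tau ->
  exists (n : nat -> nat) (phi : forall k, {linear A -> 'M[R[i]]_(n k)}),
    [/\ forall k,
          [/\ (0 < n k)%N, phi k (cone A) = 1%:M & completely_positive (phi k)],
        forall a b : A,
          (fun k => norm2 (phi k a *m phi k b - phi k (cmul A a b))) @ \oo
            --> (0 : R[i]^o)
      & forall a : A,
          (fun k => `|tau a - ntr (phi k a)|) @ \oo --> (0 : R[i]^o)].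

(* Main.v *)
From HB Require Import structures.
From mathcomp Require Import finmap.
From mathcomp.multinomials Require Import -(notations) monalg.
From mathcomp Require Import generic_quotient.
From mathcomp Require Import all_boot all_order all_fingroup all_algebra.
From mathcomp Require Import complex ring lra spectral.
From mathcomp Require Import all_classical all_reals all_analysis.
Require Import Defs.
(** The group. For the field F with 17 elements, let K_m be the permutation group
    of the rows (F^{m+1})^3, and consider in it the five elementary shears e12(1),
    e23(1), e31(E), e31(T), e31(T^t), where E is the matrix unit E_00, T the shift
    and T^t its transpose. The group G consists of the words in five letters,
    two words being equal when their values in K_m agree for almost all m, with
    respect to a free ultrafilter. Since G sits in an ultraproduct of finite groups,
    every finite piece of its multiplication table is found in some K_m: G is LEF
    ([word_group_LEF]). The regular representations of the finite groups then
    provide the permutations and the matrices required for soficity and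
    hyperlinearity ([LEF_sofic], [LEF_hyperlinear]).

    Property (T). The generators have prime order p = 17, and any two of them have a
    commutator that is central in the group they generate. In a unitary
    representation let P_i be the projection to the vectors fixed by the i-th
    generator. Off the fixed vectors of the central commutator one has
    P_i P_j P_i = P_i / p, so that the fixed subspaces of two generators are at an
    angle of cosine 1 / sqrt p relative to their intersection; since p exceeds the
    square of the number of generators minus one, the angles are small enough.
    Applied to the affine isometric action of a cocycle: the energy of a point, the
    sum of its squared distances to the fixed affine subspaces of the generators,
    shrinks by a constant factor at each step of gradient descent, and the total
    distance travelled is bounded by a constant times the square root of the initial
    energy. This bounds the cocycle by a constant times its values on the generators
    ([cocycle_bound]). Every estimate concerns finitely many steps, so that the bound
    holds for positive semidefinite forms, complete or not. It gives property (T)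
    ([small_angle_kazhdan]), and by the GNS construction it gives that a normalized
    positive definite function that is close to 1 on the generators is uniformly
    close to 1 ([small_angle_spectral_gap]).

    No factorization property. For a unital completely positive map phi from C*G to
    matrices the function psi(g) = |phi(g)|_2^2 is positive definite. If phi
    is almost multiplicative, psi is close to 1 on the generators, hence uniformly
    close to 1 on G; so phi is almost multiplicative and tr phi(gh) is close to
    tr phi(hg), uniformly in g and h. Now G contains x_k = e12(E_0k), y_k = e23(E_k0)
    and z = e13(E_00), where [x_k, y_k] = z for all k and x_j commutes with y_k for
    j < k. As phi(G) lies in a bounded set of matrices, phi(x_j) is close to phi(x_k)
    for some j < k. Then tr phi(w) is close to 1 for w = x_j^-1 x_k, hence also for
    its conjugate by y_k, hence for the quotient z of the two ([rtr_commutator]). But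
    tr phi(z) should be close to 0, since z is not the unit ([not_factorization]).

    The factorization property quantifies over all models of C*G with its
    canonical trace; to use it one model is constructed, the completion of the group
    algebra for the largest C*-seminorm ([max_group_cstarP], [canonical_traceP]). Its
    trace is bounded by way of the regular representation on the completion
    of the group algebra for the form tr (w^* v). *)

Set Implicit Arguments.
Unset Strict Implicit.
Unset Printing Implicit Defensive.
Import Order.TTheory GRing.Theory Num.Theory.
Import numFieldNormedType.Exports.
Local Open Scope classical_set_scope.
Local Open Scope complex_scope.
Local Open Scope ring_scope.
Local Notation Re := complex.Re.
Local Notation Im := complex.Im.

(** * Completion of a seminormed complex vector space *)

Definition cabs (R : realType) (z : R[i]) : R := Re `|z|.

Section ComplexModulus.
Variable R : realType.
Implicit Types (z w : R[i]) (x : R).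

Lemma cabsE z : `|z| = (cabs z)%:C.
Proof. by rewrite /cabs RRe_real ?normr_real. Qed.

Lemma cabs_ge0 z : 0 <= cabs z.
Proof. by rewrite -lecR -cabsE normr_ge0. Qed.

Lemma cabsD z w : cabs (z + w) <= cabs z + cabs w.
Proof. by rewrite -lecR rmorphD /= -!cabsE ler_normD. Qed.

Lemma cabsM z w : cabs (z * w) = cabs z * cabs w.
Proof. by apply: complexI; rewrite rmorphM /= -!cabsE normrM. Qed.

Lemma cabs_real x : cabs x%:C = `|x|.
Proof. by rewrite /cabs normc_def /= expr0n /= addr0 sqrtr_sqr. Qed.

Lemma cabs0 : cabs (0 : R[i]) = 0.
Proof. by rewrite /cabs normr0. Qed.

Lemma cabs1 : cabs (1 : R[i]) = 1.
Proof. by rewrite /cabs normr1. Qed.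

Lemma cabsN z : cabs (- z) = cabs z.
Proof. by rewrite /cabs normrN. Qed.

Lemma cabs_conj z : cabs (Num.conj z) = cabs z.
Proof. by rewrite /cabs norm_conjC. Qed.

Lemma Re_le_cabs z : `|Re z| <= cabs z.
Proof. by rewrite -lecR -cabsE normc_ge_Re. Qed.

Lemma Im_le_cabs z : `|Im z| <= cabs z.
Proof.
have -> : Im z = Re (- (z * 'i%C)) by rewrite raddfN /= ReiNIm opprK.
apply: le_trans (Re_le_cabs _) _; rewrite cabsN cabsM.
suff -> : cabs ('i%C : R[i]) = 1 by rewrite mulr1.
by rewrite /cabs normc_def /= expr0n /= expr1n add0r sqrtr1.
Qed.

Lemma cabs_le_ReIm z : cabs z <= `|Re z| + `|Im z|.
Proof.
case: z => a b; have -> : a +i* b = a%:C + b%:C * 'i%C by simpc.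
apply: le_trans (cabsD _ _) _; rewrite cabsM !cabs_real /=.
have -> : cabs ('i%C : R[i]) = 1.
  by rewrite /cabs normc_def /= expr0n /= expr1n add0r sqrtr1.
by rewrite !(mulr0, mulr1, mul0r, subr0, addr0, add0r).
Qed.

End ComplexModulus.

Structure seminorm (R : realType) (V : lmodType R[i]) := Seminorm {
  sn_fun :> V -> R;
  snD : forall x y, sn_fun (x + y) <= sn_fun x + sn_fun y;
  snZ : forall (a : R[i]) x, sn_fun (a *: x) = cabs a * sn_fun x }.

Section SeminormTheory.
Variables (R : realType) (V : lmodType R[i]) (N : seminorm V).
Implicit Types x y z : V.

Lemma sn0 : N 0 = 0.
Proof. by rewrite -(scale0r (0 : V)) snZ cabs0 mul0r. Qed.

Lemma snN x : N (- x) = N x.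
Proof. by rewrite -scaleN1r snZ cabsN cabs1 mul1r. Qed.

Lemma snB x y : N (x - y) = N (y - x).
Proof. by rewrite -snN opprB. Qed.

Lemma sn_ge0 x : 0 <= N x.
Proof. by have := snD N x (- x); rewrite subrr sn0 snN; lra. Qed.

Lemma sn_triangle z x y : N (x - y) <= N (x - z) + N (z - y).
Proof. by have := snD N (x - z) (z - y); rewrite addrA subrK. Qed.

Lemma sn_dist x y : `|N x - N y| <= N (x - y).
Proof.
rewrite ler_norml; apply/andP; split.
  have := snD N (y - x) x; rewrite subrK (snB y) ; lra.
have := snD N (x - y) y; rewrite subrK; lra.
Qed.

End SeminormTheory.

Section CauchySequences.
Variables (R : realType) (V : lmodType R[i]) (N : seminorm V).
Implicit Types (s t : nat -> V).

Definition cauchyseq s := forall e : R, 0 < e ->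
  exists n, forall i j, (n <= i)%N -> (n <= j)%N -> N (s i - s j) <= e.

Definition seq_close s t := forall e : R, 0 < e ->
  exists n, forall i, (n <= i)%N -> N (s i - t i) <= e.

Lemma cauchyseq_cst x : cauchyseq (fun _ => x).
Proof. by move=> e e0; exists 0%N => i j _ _; rewrite subrr sn0 ltW. Qed.

Lemma cauchyseqD s t : cauchyseq s -> cauchyseq t -> cauchyseq (fun n => s n + t n).
Proof.
move=> hs ht e e0; have e2 : 0 < e / 2 by lra.
have [[m hm] [n hn]] := (hs _ e2, ht _ e2).
exists (maxn m n) => i j; rewrite !geq_max => /andP[im iN] /andP[jm jn].
have := snD N (s i - s j) (t i - t j); rewrite addrACA -opprD.
by have := hm _ _ im jm; have := hn _ _ iN jn; lra.
Qed.

Lemma cauchyseqZ a s : cauchyseq s -> cauchyseq (fun n => a *: s n).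
Proof.
move=> hs e e0; have a1 : 0 < cabs a + 1 by have := cabs_ge0 a; lra.
have [n hn] := hs _ (divr_gt0 e0 a1); exists n => i j iN jn.
rewrite -scalerBr snZ.
apply: le_trans (_ : _ <= (cabs a + 1) * N (s i - s j)) _.
  by apply: ler_wpM2r; [exact: sn_ge0 | lra].
by rewrite mulrC -ler_pdivlMr // hn.
Qed.

Lemma seq_close_refl s : seq_close s s.
Proof. by move=> e e0; exists 0%N => i _; rewrite subrr sn0 ltW. Qed.

Lemma seq_close_sym s t : seq_close s t -> seq_close t s.
Proof.
by move=> h e e0; have [n hn] := h e e0; exists n => i /hn; rewrite snB.
Qed.

Lemma seq_close_trans t s u : seq_close s t -> seq_close t u -> seq_close s u.
Proof.
move=> h1 h2 e e0; have e2 : 0 < e / 2 by lra.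
have [[m hm] [n hn]] := (h1 _ e2, h2 _ e2).
exists (maxn m n) => i; rewrite geq_max => /andP[im iN].
have := sn_triangle N (t i) (s i) (u i).
by have := hm _ im; have := hn _ iN; lra.
Qed.

Lemma seq_closeD s t s' t' : seq_close s s' -> seq_close t t' ->
  seq_close (fun n => s n + t n) (fun n => s' n + t' n).
Proof.
move=> h1 h2 e e0; have e2 : 0 < e / 2 by lra.
have [[m hm] [n hn]] := (h1 _ e2, h2 _ e2).
exists (maxn m n) => i; rewrite geq_max => /andP[im iN].
have := snD N (s i - s' i) (t i - t' i); rewrite addrACA -opprD.
by have := hm _ im; have := hn _ iN; lra.
Qed.

Lemma seq_closeZ a s s' : seq_close s s' ->
  seq_close (fun n => a *: s n) (fun n => a *: s' n).
Proof.
move=> hs e e0; have a1 : 0 < cabs a + 1 by have := cabs_ge0 a; lra.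
have [n hn] := hs _ (divr_gt0 e0 a1); exists n => i iN.
rewrite -scalerBr snZ.
apply: le_trans (_ : _ <= (cabs a + 1) * N (s i - s' i)) _.
  by apply: ler_wpM2r; [exact: sn_ge0 | lra].
by rewrite mulrC -ler_pdivlMr // hn.
Qed.

Definition cauchyT := {s : nat -> V | `[< cauchyseq s >]}.

Definition cauchy_eq (s t : cauchyT) : bool := `[< seq_close (val s) (val t) >].

Lemma cauchy_eq_equiv : equiv_class_of cauchy_eq.
Proof.
split=> [s|s t|t s u]; first exact/asboolP/seq_close_refl.
  by apply/asboolP/asboolP => /seq_close_sym.
move=> /asboolP h1 /asboolP h2; apply/asboolP; exact: seq_close_trans h1 h2.
Qed.

Canonical cauchy_equiv := EquivRelPack cauchy_eq_equiv.

Local Open Scope quotient_scope.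
(** Cauchy sequences modulo sequences whose seminorm tends to 0; vectors of
    seminorm 0 are identified with 0 at the same time. *)
Definition completion := {eq_quot cauchy_equiv}.
HB.instance Definition _ := Choice.on completion.

End CauchySequences.

Section CompletionModule.
Variables (R : realType) (V : lmodType R[i]) (N : seminorm V).
Local Notation W := (completion N).
Implicit Types (s t : nat -> V) (x y : W).

Lemma zero_cauchy : `[< cauchyseq N (fun _ => 0) >].
Proof. exact/asboolP/cauchyseq_cst. Qed.

(** Total in s: a sequence that is not Cauchy is sent to the class of 0. *)
Definition cls s : W := (\pi_W (insubd (exist _ (fun=> 0) zero_cauchy : cauchyT N) s))%qT.

Definition rep x : nat -> V := val (generic_quotient.repr x).

Lemma rep_cauchy x : cauchyseq N (rep x).
Proof. by apply/asboolP; exact: (valP (generic_quotient.repr x)). Qed.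

Lemma repK x : cls (rep x) = x.
Proof. by rewrite /cls /rep valKd reprK. Qed.

Lemma clsP s t : cauchyseq N s -> cauchyseq N t ->
  cls s = cls t <-> seq_close N s t.
Proof.
move=> hs ht; rewrite /cls; split.
  by move=> /eqmodP/asboolP; rewrite !insubdK //; exact/asboolP.
move=> h; apply/eqmodP/asboolP; rewrite !insubdK //; exact/asboolP.
Qed.

Lemma rep_cls s : cauchyseq N s -> seq_close N (rep (cls s)) s.
Proof. by move=> hs; apply/clsP; rewrite ?repK //; exact: rep_cauchy. Qed.

Lemma cls_ind (P : W -> Prop) :
  (forall s, cauchyseq N s -> P (cls s)) -> forall x, P x.
Proof. by move=> h x; rewrite -(repK x); apply/h/rep_cauchy. Qed.

Lemma cls_eq s t : cauchyseq N s -> s =1 t -> cls s = cls t.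
Proof. by move=> hs /funext ->. Qed.

Definition cadd x y : W := cls (fun n => rep x n + rep y n).
Definition cscale (a : R[i]) x : W := cls (fun n => a *: rep x n).
Definition cemb (v : V) : W := cls (fun _ => v).

Lemma caddE s t : cauchyseq N s -> cauchyseq N t ->
  cadd (cls s) (cls t) = cls (fun n => s n + t n).
Proof.
move=> hs ht; apply/clsP.
- by apply: cauchyseqD; exact: rep_cauchy.
- exact: cauchyseqD.
- by apply: seq_closeD; exact: rep_cls.
Qed.

Lemma cscaleE a s : cauchyseq N s -> cscale a (cls s) = cls (fun n => a *: s n).
Proof.
move=> hs; apply/clsP.
- by apply: cauchyseqZ; exact: rep_cauchy.
- exact: cauchyseqZ.
- by apply: seq_closeZ; exact: rep_cls.
Qed.

Local Hint Resolve cauchyseqD cauchyseqZ cauchyseq_cst : core.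

Lemma caddA : associative cadd.
Proof.
elim/cls_ind=> s hs; elim/cls_ind=> t ht; elim/cls_ind=> u hu.
rewrite !caddE //; try exact: cauchyseqD.
apply: cls_eq => [|n]; last by rewrite addrA.
by apply: (@cauchyseqD _ _ _ s) => //; exact: cauchyseqD.
Qed.

Lemma caddC : commutative cadd.
Proof.
elim/cls_ind=> s hs; elim/cls_ind=> t ht.
rewrite !caddE //; apply: cls_eq => [|n]; last by rewrite addrC.
exact: cauchyseqD.
Qed.

Lemma cadd0 : left_id (cemb 0) cadd.
Proof.
elim/cls_ind=> s hs; rewrite /cemb caddE //.
by apply/esym/cls_eq => // n; rewrite add0r.
Qed.

Lemma caddN : left_inverse (cemb 0) (cscale (-1)) cadd.
Proof.
elim/cls_ind=> s hs; rewrite /cemb cscaleE // caddE //; last exact: cauchyseqZ.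
by apply/esym/cls_eq => // n; rewrite scaleN1r addNr.
Qed.

HB.instance Definition _ :=
  GRing.isZmodule.Build W caddA caddC cadd0 caddN.

Lemma cscaleA a b x : cscale a (cscale b x) = cscale (a * b) x.
Proof.
elim/cls_ind: x => s hs; rewrite !cscaleE //; last exact: cauchyseqZ.
by apply/esym/cls_eq => [|n]; [exact: cauchyseqZ|rewrite scalerA].
Qed.

Lemma cscale1 : left_id 1 cscale.
Proof.
by elim/cls_ind=> s hs; rewrite cscaleE //; apply/esym/cls_eq => // n; rewrite scale1r.
Qed.

Lemma cscaleDr : right_distributive cscale +%R.
Proof.
move=> a; elim/cls_ind=> s hs; elim/cls_ind=> t ht.
rewrite /GRing.add /= caddE // !cscaleE ?caddE //; try exact: cauchyseqZ; last exact: cauchyseqD.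
apply: cls_eq => [|n]; last by rewrite scalerDr.
exact/(@cauchyseqZ _ _ _ a)/cauchyseqD.
Qed.

Lemma cscaleDl x : {morph cscale^~ x : a b / a + b}.
Proof.
move=> a b; elim/cls_ind: x => s hs.
rewrite /GRing.add /= !cscaleE // caddE //; try exact: cauchyseqZ.
by apply: cls_eq => [|n]; [exact: cauchyseqZ | rewrite scalerDl].
Qed.

HB.instance Definition _ :=
  GRing.Zmodule_isLmodule.Build R[i] W cscaleA cscale1 cscaleDr cscaleDl.

Lemma clsD s t : cauchyseq N s -> cauchyseq N t ->
  cls s + cls t = cls (fun n => s n + t n).
Proof. exact: caddE. Qed.

Lemma clsZ a s : cauchyseq N s -> a *: cls s = cls (fun n => a *: s n).
Proof. exact: cscaleE. Qed.

Lemma clsB s t : cauchyseq N s -> cauchyseq N t ->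
  cls s - cls t = cls (fun n => s n - t n).
Proof.
move=> hs ht; rewrite -scaleN1r clsZ // clsD //; last exact: cauchyseqZ.
apply: cls_eq => [|n]; last by rewrite scaleN1r.
by apply: cauchyseqD => //; exact: cauchyseqZ.
Qed.

Lemma cemb_linear : linear cemb.
Proof.
move=> a u v; rewrite /cemb clsZ // clsD //.
Qed.
HB.instance Definition _ := GRing.isLinear.Build R[i] V W _ cemb cemb_linear.

End CompletionModule.

(** * The norm of the completion *)

Section CompletionNorm.
Variables (R : realType) (V : lmodType R[i]) (N : seminorm V).
Local Notation W := (completion N).
Implicit Types (s t : nat -> V) (x y : W).

Lemma cauchy_real_cvg (u : nat -> R) :
  (forall e, 0 < e -> exists n, forall i j, (n <= i)%N -> (n <= j)%N ->
     `|u i - u j| <= e) -> cvgn u.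
Proof.
move=> hu; apply/cauchy_cvgP/cauchy_exP => e e0.
have [n hn] := hu (e / 2) ltac:(lra).
exists (u n); exists n => // i /= ni; rewrite /ball /=.
by have := hn n i (leqnn _) ni; lra.
Qed.

Lemma cvgn_dist_le (K : numFieldType) (E : normedModType K) (u : nat -> E) (l : E) :
  (forall e, 0 < e -> exists n, forall i, (n <= i)%N -> `|l - u i| <= e) <->
  u @ \oo --> l.
Proof.
split=> [h | /cvgrPdist_le h e e0].
  by apply/cvgrPdist_le => e /h[n hn]; exists n.
by have [n _ hn] := h e e0; exists n.
Qed.

Lemma cvgn_uniq (K : numFieldType) (E : normedModType K) (u : nat -> E) (l l' : E) :
  u @ \oo --> l -> u @ \oo --> l' -> l = l'.
Proof.
by move=> h1 h2; rewrite -(cvg_lim (@norm_hausdorff _ E) h1) (cvg_lim (@norm_hausdorff _ E) h2).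
Qed.

Lemma cvgn_le (u v : nat -> R) (l l' : R) (m : nat) :
  u @ \oo --> l -> v @ \oo --> l' -> (forall n, (m <= n)%N -> u n <= v n) ->
  l <= l'.
Proof. by move=> hu hv h; apply: (ler_cvg_to hu hv); exists m. Qed.

Lemma seminorm_cvg s : cauchyseq N s -> cvgn (N \o s).
Proof.
move=> hs; apply: cauchy_real_cvg => e /hs[n hn]; exists n => i j iN jn.
exact: le_trans (sn_dist _ _ _) (hn _ _ iN jn).
Qed.

Definition cnorm x : R := limn (N \o rep x).

Lemma seq_close_cvg s t (l : R) : seq_close N s t ->
  N \o s @ \oo --> l -> N \o t @ \oo --> l.
Proof.
move=> h hl; have -> : l = l - 0 by rewrite subr0.
have -> : N \o t = (N \o s) \- (fun n => N (s n) - N (t n)).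
  by apply/funext => n /=; rewrite subKr.
apply: cvgB => //; apply/cvgn_dist_le => e /h[n hn]; exists n => i /hn.
by rewrite sub0r normrN; apply: le_trans; exact: sn_dist.
Qed.

Lemma cnorm_cls s : cauchyseq N s -> N \o s @ \oo --> cnorm (cls N s).
Proof.
move=> hs; apply: (@seq_close_cvg (rep (cls N s))); first exact: rep_cls.
exact/seminorm_cvg/rep_cauchy.
Qed.

Lemma cnorm_emb v : cnorm (cemb N v) = N v.
Proof.
apply: (@cvgn_uniq _ _ (N \o (fun=> v))); last exact: cvg_cst.
exact/cnorm_cls/cauchyseq_cst.
Qed.

Lemma cnorm_ge0 x : 0 <= cnorm x.
Proof.
by apply: limr_ge; [exact/seminorm_cvg/rep_cauchy | near=> n; exact: sn_ge0].
Unshelve. all: by end_near. Qed.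

Lemma cnormD x y : cnorm (x + y) <= cnorm x + cnorm y.
Proof.
elim/cls_ind: x => s hs; elim/cls_ind: y => t ht; rewrite clsD //.
have hl := cnorm_cls (cauchyseqD hs ht).
by apply: (cvgn_le (m := 0) hl (cvgD (cnorm_cls hs) (cnorm_cls ht))) => n _; exact: snD.
Qed.

Lemma cnormZ a x : cnorm (a *: x) = cabs a * cnorm x.
Proof.
elim/cls_ind: x => s hs; rewrite clsZ //.
apply: (@cvgn_uniq _ _ (N \o (fun n => a *: s n))).
  exact/cnorm_cls/cauchyseqZ.
have -> : N \o (fun n => a *: s n) = (fun n => cabs a * (N \o s) n).
  by apply/funext => n /=; rewrite snZ.
by apply: cvgMr; exact: cnorm_cls.
Qed.

Lemma cnorm_eq0 x : cnorm x = 0 -> x = 0.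
Proof.
elim/cls_ind: x => s hs h0; apply/clsP => //; first exact: cauchyseq_cst.
move=> e e0; have := cnorm_cls hs; rewrite h0 => /cvgn_dist_le/(_ _ e0)[n hn].
exists n => i /hn; rewrite subr0 sub0r normrN; exact/le_trans/ler_norm.
Qed.

Definition cnorm_seminorm : seminorm W := Seminorm cnormD cnormZ.

Lemma cnormB x y : cnorm (x - y) = cnorm (y - x).
Proof. exact: (snB cnorm_seminorm). Qed.

Lemma cnorm_triangle z x y : cnorm (x - y) <= cnorm (x - z) + cnorm (z - y).
Proof. exact: (sn_triangle cnorm_seminorm). Qed.

Lemma cnormcD x y : (cnorm (x + y))%:C <= (cnorm x)%:C + (cnorm y)%:C.
Proof. by rewrite -rmorphD lecR cnormD. Qed.

Lemma cnormcZ (a : R[i]) x : (cnorm (a *: x))%:C = `|a| * (cnorm x)%:C.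
Proof. by rewrite cnormZ rmorphM /= -cabsE. Qed.

Lemma cnormc_eq0 x : (cnorm x)%:C = 0 -> x = 0.
Proof. by move=> /complexI; exact: cnorm_eq0. Qed.

HB.instance Definition _ :=
  Lmodule_isNormed.Build R[i] W cnormcD cnormcZ cnormc_eq0.

Lemma completion_normE x : `|x| = (cnorm x)%:C.
Proof. by []. Qed.

(** The limit j -> oo in the Cauchy condition. *)
Lemma cls_emb_close s (e : R) n : cauchyseq N s ->
  (forall i j, (n <= i)%N -> (n <= j)%N -> N (s i - s j) <= e) ->
  forall i, (n <= i)%N -> cnorm (cls N s - cemb N (s i)) <= e.
Proof.
move=> hs hn i ni; have hc : cauchyseq N (fun=> s i) by exact: cauchyseq_cst.
rewrite /cemb clsB //.
have hl := cnorm_cls (cauchyseqD hs (cauchyseqZ (-1) hc)).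
have -> : (fun k => s k - s i) = (fun k => s k + (-1) *: s i).
  by apply/funext => k; rewrite scaleN1r.
apply: (cvgn_le (m := n) hl (cvg_cst e)) => k nk /=.
by rewrite scaleN1r; exact: hn.
Qed.

Lemma emb_dense x (e : R) : 0 < e -> exists v, cnorm (x - cemb N v) <= e.
Proof.
elim/cls_ind: x => s hs e0; have [n hn] := hs e e0.
by exists (s n); exact: (cls_emb_close hs hn).
Qed.

Lemma cls_cvg s : cauchyseq N s -> (fun n => cemb N (s n)) @ \oo --> cls N s.
Proof.
move=> hs; apply/cvgn_dist_le => e e0.
have e1 : 0 < Re e by move: e0; rewrite ltcE => /andP[].
have [n hn] := hs _ e1; exists n => i ni; rewrite completion_normE.
have -> : e = (Re e)%:C by rewrite RRe_real // gtr0_real.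
by rewrite lecR (cls_emb_close hs hn).
Qed.

(** A Cauchy filter contains a ball of radius r n around some x n, where r tends
    to 0. Vectors v n of V within r n of x n form a Cauchy sequence, and the filter
    converges to its class. *)
Lemma completion_complete (F : set_system W) :
  ProperFilter F -> cauchy F -> cvg F.
Proof.
move=> FF /cauchyP Fc.
have [r [r0 small]] : exists r : nat -> R, (forall n, 0 < r n) /\
    forall e, 0 < e -> exists n, forall i, (n <= i)%N -> r i <= e.
  exists (fun n => n.+1%:R^-1); split=> [n|e e0]; first by rewrite invr_gt0.
  exists (Num.truncn e^-1) => i hi.
  rewrite -[leRHS]invrK lef_pV2 ?posrE ?invr_gt0 //.
  apply/ltW/(lt_le_trans (truncnS_gt _)).
  by rewrite ler_nat ltnS.
have [d [dE dC dT]] : exists d : W -> W -> R,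
    [/\ forall x y, d x y = cnorm (x - y), forall x y, d x y = d y x
      & forall y x z, d x z <= d x y + d y z].
  exists (fun x y => cnorm (x - y)); split=> // *; first exact: cnormB.
  exact: cnorm_triangle.
have dball x y e : ball x e%:C y -> d x y < e.
  by rewrite -ball_normE /ball_ /= completion_normE ltcR -dE.
have /choice[x hx] n : exists x : W, F (ball x (r n)%:C).
  by apply: Fc; rewrite ltcR.
have /choice[v hv] n : exists v, d (x n) (cemb N v) <= r n.
  by have [v hv] := emb_dense (x n) (r0 n); exists v; rewrite dE.
have dvE i j : N (v i - v j) = d (cemb N (v i)) (cemb N (v j)).
  by rewrite dE -raddfB cnorm_emb.
pose c n := cemb N (v n); rewrite -/(c _) in hv dvE.
have hd m n : d (x m) (x n) <= r m + r n.
  have [y [/dball hm /dball hn]] := @filter_ex _ F FF _ (@filterI _ F _ _ _ (hx m) (hx n)).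
  by have := dT y (x m) (x n); rewrite (dC y (x n)); lra.
have hs : cauchyseq N v.
  move=> e e0; have [n hn] := small (e / 4) ltac:(lra).
  exists n => i j iN jn; rewrite dvE -/(c _) -/(c _).
  have := dT (x i) (c i) (c j); have := dT (x j) (x i) (c j); rewrite (dC (c i) (x i)).
  have := hv i; have := hv j; have := hd i j; have := hn i iN; have := hn j jn.
  rewrite -/(c _) -/(c _); lra.
apply/cvg_ex; exists (cls N v); apply/cvgrPdist_le => e e0.
have e1 : 0 < Re e by move: e0; rewrite ltcE => /andP[].
have Ee : e = (Re e)%:C by rewrite RRe_real // gtr0_real.
have [n hn] := small (Re e / 4) ltac:(lra).
have [m hm] := hs (Re e / 4) ltac:(lra).
pose k := maxn m n; apply: filterS (hx k) => y /dball hy.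
rewrite completion_normE Ee lecR -dE.
have h1 : d (cls N v) (c k) <= Re e / 4.
  by rewrite dE; exact: (cls_emb_close hs hm (leq_maxl m n)).
have h2 := hn k (leq_maxr _ _); have h3 := hv k; rewrite -/(c k) in h3.
have := dT (c k) (cls N v) y; have := dT (x k) (c k) y; rewrite (dC (c k) (x k)).
move: (cls N v) (c k) (x k) h1 h2 h3 hy => a0 a1 a2 h1 h2 h3 hy; lra.
Qed.

HB.instance Definition _ := Uniform_isComplete.Build W completion_complete.

End CompletionNorm.

(** * Positive semidefinite Hermitian forms *)

Structure hform (R : realType) (V : lmodType R[i]) := HForm {
  hf :> V -> V -> R[i];
  hfPl : forall a x y z, hf (a *: x + y) z = a * hf x z + hf y z;
  hfC : forall x y, hf x y = conjc (hf y x);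
  hf_ge0 : forall x, 0 <= hf x x }.

Lemma conjCE (R : realType) (z : R[i]) : Num.conj z = conjc z.
Proof. by []. Qed.

Lemma cabs_sqr (R : realType) (z : R[i]) : (cabs z ^+ 2)%:C = z * conjc z.
Proof. by rewrite rmorphXn /= -cabsE sqr_normc. Qed.

Lemma cabs_ReIm (R : realType) (z : R[i]) : cabs z ^+ 2 = Re z ^+ 2 + Im z ^+ 2.
Proof. by apply: complexI; rewrite cabs_sqr; case: z => a b; simpc; congr Complex; ring. Qed.

Section HFormTheory.
Variables (R : realType) (V : lmodType R[i]) (B : hform V).
Implicit Types x y z : V.

(** The underlying real inner product; the estimates of Hilbert space geometry
    below take place in R. *)
Definition rform x y : R := Re (B x y).
Definition hnorm x : R := Num.sqrt (rform x x).

Lemma hf0l x : B 0 x = 0.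
Proof. by have := hfPl B (-1) 0 0 x; rewrite scaler0 addr0 mulN1r addNr. Qed.
Lemma hfDl x y z : B (x + y) z = B x z + B y z.
Proof. by have := hfPl B 1 x y z; rewrite scale1r mul1r. Qed.
Lemma hfZl a x z : B (a *: x) z = a * B x z.
Proof. by have := hfPl B a x 0 z; rewrite hf0l !addr0. Qed.
Lemma hfDr x y z : B z (x + y) = B z x + B z y.
Proof. by rewrite hfC hfDl rmorphD /= -!hfC. Qed.
Lemma hfZr a x z : B z (a *: x) = conjc a * B z x.
Proof. by rewrite hfC hfZl rmorphM /= -!hfC. Qed.
Lemma hf0r x : B x 0 = 0.
Proof. by rewrite hfC hf0l conjc0. Qed.

Lemma hf_real x : B x x = (rform x x)%:C.
Proof. by rewrite /rform RRe_real // ger0_real // hf_ge0. Qed.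

Lemma rform_ge0 x : 0 <= rform x x.
Proof. by rewrite -lecR -hf_real hf_ge0. Qed.
Lemma rformC x y : rform x y = rform y x.
Proof. by rewrite /rform hfC; case: (B y x). Qed.
Lemma rformDl x y z : rform (x + y) z = rform x z + rform y z.
Proof. by rewrite /rform hfDl raddfD. Qed.
Lemma rformDr x y z : rform z (x + y) = rform z x + rform z y.
Proof. by rewrite !(rformC z) rformDl. Qed.
Lemma rformZl (r : R) x z : rform (r%:C *: x) z = r * rform x z.
Proof. by rewrite /rform hfZl; case: (B x z) => a b /=; rewrite mul0r subr0. Qed.
Lemma rformZr (r : R) x z : rform z (r%:C *: x) = r * rform z x.
Proof. by rewrite !(rformC z) rformZl. Qed.
Lemma rformNl x z : rform (- x) z = - rform x z.
Proof. by rewrite -scaleN1r -(rmorphN1 (real_complex R)) rformZl mulN1r. Qed.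
Lemma rformNr x z : rform z (- x) = - rform z x.
Proof. by rewrite !(rformC z) rformNl. Qed.
Lemma rform0l x : rform 0 x = 0.
Proof. by rewrite /rform hf0l. Qed.
Lemma rform0r x : rform x 0 = 0.
Proof. by rewrite /rform hf0r. Qed.

Lemma hnorm_sqr x : hnorm x ^+ 2 = rform x x.
Proof. by rewrite sqr_sqrtr // rform_ge0. Qed.

Lemma hnorm_ge0 x : 0 <= hnorm x.
Proof. exact: sqrtr_ge0. Qed.

(** Positivity of B on x - t c y, where c = B x y, for a real t: the minimizer
    1 / B y y, or a large t when B y y = 0. *)
Lemma hf_cauchy_schwarz x y : cabs (B x y) <= hnorm x * hnorm y.
Proof.
set c := B x y; have c0 := cabs_ge0 c.
have key (t : R) : 0 <= rform x x - 2 * t * cabs c ^+ 2 + t ^+ 2 * cabs c ^+ 2 * rform y y.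
  set v := x - (t%:C * c) *: y.
  suff E : B v v = (rform x x - 2 * t * cabs c ^+ 2 +
      t ^+ 2 * cabs c ^+ 2 * rform y y)%:C by rewrite -lecR -E hf_ge0.
  rewrite /v -scaleNr !(hfDl, hfDr, hfZl, hfZr) (hfC B y x) -/c !hf_real.
  have -> : conjc (- (t%:C * c)) = - (t%:C * conjc c).
    by rewrite rmorphN rmorphM; congr (- (_ * _)); exact: conjc_real.
  rewrite cabs_ReIm; case: (c) => p q; rewrite /real_complex_def.
  by apply/eqP; rewrite eq_complex /=; apply/andP; split; apply/eqP; ring.
have [->|cN0] := eqVneq (cabs c) 0; first by rewrite mulr_ge0 // hnorm_ge0.
rewrite -(ler_pXn2r (n := 2)) ?nnegrE ?mulr_ge0 ?hnorm_ge0 // exprMn !hnorm_sqr.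
have c2 : 0 < cabs c ^+ 2 by rewrite exprn_gt0 // lt_neqAle eq_sym cN0.
have := rform_ge0 x; have := rform_ge0 y; rewrite le_eqVlt => /orP[/eqP y0 | y0] x0.
  have := key ((rform x x + 1) / (2 * cabs c ^+ 2)); rewrite -y0 mulr0 addr0.
  have -> : 2 * ((rform x x + 1) / (2 * cabs c ^+ 2)) * cabs c ^+ 2 = rform x x + 1.
    by field; rewrite cN0.
  lra.
have := key (rform y y)^-1.
have -> : rform x x - 2 * (rform y y)^-1 * cabs c ^+ 2 +
     (rform y y)^-1 ^+ 2 * cabs c ^+ 2 * rform y y
   = (rform x x * rform y y - cabs c ^+ 2) / rform y y.
  by field; rewrite gt_eqF.
by rewrite pmulr_lge0 ?invr_gt0 // subr_ge0.
Qed.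

Lemma rform_le x y : rform x y <= hnorm x * hnorm y.
Proof.
exact: le_trans (ler_norm _) (le_trans (Re_le_cabs _) (hf_cauchy_schwarz _ _)).
Qed.

Lemma hnormD x y : hnorm (x + y) <= hnorm x + hnorm y.
Proof.
rewrite -(ler_pXn2r (n := 2)) ?nnegrE ?addr_ge0 ?hnorm_ge0 // sqrrD !hnorm_sqr.
rewrite rformDl !rformDr (rformC y x).
have := rform_le x y; lra.
Qed.

Lemma hnormZ a x : hnorm (a *: x) = cabs a * hnorm x.
Proof.
rewrite /hnorm {1}/rform hfZl hfZr mulrA -cabs_sqr hf_real -rmorphM /=.
by rewrite sqrtrM ?sqr_ge0 // sqrtr_sqr ger0_norm // cabs_ge0.
Qed.

Definition hseminorm : seminorm V := Seminorm hnormD hnormZ.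

Lemma hnorm0 : hnorm 0 = 0.
Proof. exact: (sn0 hseminorm). Qed.

End HFormTheory.

(** * The group algebra *)

Definition malg_delta (K : comNzRingType) (G : choiceType) (g : G) : malg G K :=
  mkmalgU g 1.

(** Semilinearity is for theta: the identity or complex conjugation. So linear maps,
    the involution and sesquilinear forms all come from one universal property. *)
Definition malg_ext (K : comNzRingType) (G : choiceType)
    (theta : {rmorphism K -> K}) (U : lmodType K) (u : G -> U) (v : malg G K) : U :=
  \sum_(k <- msupp v) theta (mcoeff k v) *: u k.

Section FreeModule.
Variables (K : comNzRingType) (G : choiceType).
Local Notation A := (malg G K).
Local Notation gdelta := (malg_delta K).

Lemma mcoeff_delta (g h : G) : mcoeff h (gdelta g) = (g == h)%:R.
Proof. by rewrite /malg_delta mcoeffU. Qed.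

Section SemilinearExtension.
Variables (theta : {rmorphism K -> K}) (U : lmodType K) (u : G -> U).
Local Notation gext := (malg_ext theta u).

Lemma mgextEw (D : {fset G}) v : (msupp v `<=` D)%fset ->
  gext v = \sum_(k <- D) theta (mcoeff k v) *: u k.
Proof.
move=> sD; rewrite /malg_ext; apply: big_fset_incl => // k _ kv.
by rewrite (mcoeff_outdom kv) rmorph0 scale0r.
Qed.

Lemma mgextP a v w : gext (a *: v + w) = theta a *: gext v + gext w.
Proof.
pose D := (msupp (a *: v + w) `|` msupp v `|` msupp w)%fset.
rewrite !(@mgextEw D) ?scaler_sumr -?big_split /=.
- apply: eq_bigr => k _; rewrite mcoeffD mcoeffZ rmorphD rmorphM.
  by rewrite scalerDl scalerA.
- exact: fsubsetUr.
- by rewrite /D -fsetUA fsetUCA fsubsetUl.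
- by rewrite /D -fsetUA fsubsetUl.
Qed.

Lemma mgext_delta g : gext (gdelta g) = u g.
Proof.
rewrite (@mgextEw [fset g]%fset); last by rewrite /malg_delta msuppU_le.
by rewrite big_seq_fset1 mcoeff_delta eqxx rmorph1 scale1r.
Qed.

End SemilinearExtension.

Lemma malg_ind (P : A -> Prop) : P 0 ->
  (forall a g v, P v -> P (a *: gdelta g + v)) -> forall v, P v.
Proof.
move=> P0 PS v; rewrite (monalgEw (fsubset_refl (msupp v))).
elim/big_rec: _ => // k w _ Pw.
have -> : mkmalgU k (mcoeff k v) = mcoeff k v *: gdelta k.
  by apply/malgP => h; rewrite mcoeffZ mcoeffU mcoeff_delta mulr_natr.
exact: PS.
Qed.

Lemma malg_coef (v : A) : exists D : seq G,
  v = \sum_(k <- D) malg_ext idfun (fun h => (h == k)%:R : K^o) v *: gdelta k.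
Proof.
have coefE k : malg_ext idfun (fun h => (h == k)%:R : K^o) v = mcoeff k v.
  elim/malg_ind: v => [|a g v IH]; first by rewrite /malg_ext msupp0 big_seq_fset0 mcoeff0.
  by rewrite mgextP mgext_delta IH mcoeffD mcoeffZ mcoeff_delta.
exists (msupp v : seq G); under eq_bigr do rewrite coefE.
rewrite {1}[v]monalgE; apply: eq_bigr => k _.
by apply/malgP => h; rewrite mcoeffZ mcoeffU mcoeff_delta mulr_natr.
Qed.

End FreeModule.

(** The free module on a set, packed with its universal property: the identities of
    the group algebra are checked on basis vectors and the carrier stays abstract. *)
Record freeModule (K : comNzRingType) (G : choiceType) := FreeModule {
  free_sort :> lmodType K;
  fdelta : G -> free_sort;
  fext : forall (theta : {rmorphism K -> K}) (U : lmodType K), (G -> U) -> free_sort -> U;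
  fextP : forall theta (U : lmodType K) (u : G -> U) a v w,
    fext theta u (a *: v + w) = theta a *: fext theta u v + fext theta u w;
  fext_delta : forall theta (U : lmodType K) (u : G -> U) g, fext theta u (fdelta g) = u g;
  fext_ind : forall P : free_sort -> Prop, P 0 ->
    (forall a g v, P v -> P (a *: fdelta g + v)) -> forall v, P v;
  fext_coef : forall v, exists D : seq G,
    v = \sum_(k <- D) fext idfun (fun h => (h == k)%:R : K^o) v *: fdelta k }.

Definition free_module (K : comNzRingType) (G : choiceType) : freeModule K G.
Proof.
exact: (@FreeModule K G (malg G K) (@malg_delta K G) (@malg_ext K G)
  (@mgextP K G) (@mgext_delta K G) (@malg_ind K G) (@malg_coef K G)).
Qed.

Section FreeModuleTheory.
Variables (K : comNzRingType) (G : choiceType).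
Local Notation A := (free_module K G).

Definition gdelta (g : G) : A := fdelta A g.
Definition gext (theta : {rmorphism K -> K}) (U : lmodType K) (u : G -> U) (v : A) : U :=
  fext theta u v.

Lemma gextP theta (U : lmodType K) (u : G -> U) a v w :
  gext theta u (a *: v + w) = theta a *: gext theta u v + gext theta u w.
Proof. exact: fextP. Qed.

Lemma gext_delta theta (U : lmodType K) (u : G -> U) g : gext theta u (gdelta g) = u g.
Proof. exact: fext_delta. Qed.

Lemma free_ind (P : A -> Prop) : P 0 ->
  (forall a g v, P v -> P (a *: gdelta g + v)) -> forall v, P v.
Proof. exact: fext_ind. Qed.

Definition gcoef g (v : A) : K := gext idfun (fun h => (h == g)%:R : K^o) v.

Lemma gcoefE (v : A) : exists D : seq G, v = \sum_(k <- D) gcoef k v *: gdelta k.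
Proof. exact: fext_coef. Qed.

Lemma gext0 theta (U : lmodType K) (u : G -> U) : gext theta u 0 = 0.
Proof.
have := gextP theta u (-1) 0 0.
by rewrite scaler0 addr0 rmorphN1 scaleN1r addNr.
Qed.

End FreeModuleTheory.
Arguments gdelta K {G} g.

(** * Extension of bounded maps to completions *)

Lemma ReB (R : realType) (z w : R[i]) : Re (z - w) = Re z - Re w.
Proof. by case: z w => a b [c d]. Qed.

Lemma ImB (R : realType) (z w : R[i]) : Im (z - w) = Im z - Im w.
Proof. by case: z w => a b [c d]. Qed.

Definition cabs_seminorm (R : realType) : seminorm R[i]^o :=
  @Seminorm R R[i]^o (@cabs R) (@cabsD R) (@cabsM R).

Section ComplexLimits.
Variable R : realType.
Implicit Types (u v : nat -> R[i]^o) (l : R[i]).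
Local Notation csn := (cabs_seminorm R).

Definition ctends u l := seq_close csn u (fun=> l).

Lemma complex_cauchy_tends u : cauchyseq csn u -> exists l, ctends u l.
Proof.
move=> hu.
have part (p : R[i] -> R) : (forall z w, p (z - w) = p z - p w) ->
    (forall z, `|p z| <= cabs z) -> exists l : R, forall e, 0 < e ->
    exists n, forall i, (n <= i)%N -> `|l - p (u i)| <= e.
  move=> pB ple; exists (limn (p \o u)); apply/cvgn_dist_le.
  apply: cauchy_real_cvg => e /hu[n hn]; exists n => i j iN jn /=.
  by rewrite -pB; exact: le_trans (ple _) (hn _ _ iN jn).
have [a ha] := part (@Re R) (@ReB R) (@Re_le_cabs R).
have [b hb] := part (@Im R) (@ImB R) (@Im_le_cabs R).
exists (a +i* b) => e e0.
have [[m hm] [n hn]] := (ha (e / 2) ltac:(lra), hb (e / 2) ltac:(lra)).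
exists (maxn m n) => i; rewrite geq_max => /andP[/hm h1 /hn h2] /=.
rewrite -cabsN opprB; apply: le_trans (cabs_le_ReIm _) _.
by move: h1 h2; case: (u i) => c d /=; lra.
Qed.

Lemma ctends_uniq u l l' : ctends u l -> ctends u l' -> l = l'.
Proof.
move=> /seq_close_sym h /(seq_close_trans h) hl.
apply/eqP; rewrite -subr_eq0 -normr_eq0 cabsE.
have /eqP -> : cabs (l - l') == 0; last by rewrite eqxx.
rewrite eq_le cabs_ge0 andbT; apply/ler_addgt0Pl => e /hl[n /(_ _ (leqnn _))] /=.
by rewrite addr0.
Qed.

Lemma ctends_close u v l : seq_close csn u v -> ctends v l -> ctends u l.
Proof. exact: seq_close_trans. Qed.

Lemma ctendsP a u v l l' : ctends u l -> ctends v l' ->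
  ctends (fun n => a * u n + v n) (a * l + l').
Proof. by move=> /(seq_closeZ a) hu hv; exact: (seq_closeD hu hv). Qed.

Lemma ctends_conj u l : ctends u l -> ctends (fun n => conjc (u n)) (conjc l).
Proof.
move=> h e /h[n hn]; exists n => i /hn /=.
by rewrite -rmorphB /= (_ : cabs (conjc _) = cabs (u i - l)) // -[LHS]cabs_conj conjCE conjcK.
Qed.

Lemma ctends_ge0 u l : (forall n, 0 <= u n) -> ctends u l -> 0 <= l.
Proof.
move=> u0 h; rewrite lecE /=.
have im0 : Im l = 0.
  apply/eqP; rewrite -normr_eq0 eq_le normr_ge0 andbT.
  apply/ler_addgt0Pl => e /h[n /(_ _ (leqnn _))] /=; rewrite addr0; apply: le_trans.
  have -> : `|Im l| = `|Im (u n - l)|.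
    by rewrite ImB /= (ger0_Im (u0 n)) sub0r normrN.
  exact: Im_le_cabs.
rewrite im0 eqxx /= -oppr_le0; apply/ler_addgt0Pl => e /h[n /(_ _ (leqnn _))] /=.
rewrite addr0; apply: le_trans; apply: le_trans (Re_le_cabs _).
apply: le_trans (ler_norm _); rewrite ReB /=.
by have := u0 n; rewrite lecE /= => /andP[_]; lra.
Qed.

Definition clim u : R[i] := xget 0 [set l | ctends u l].

Lemma clim_tends u : cauchyseq csn u -> ctends u (clim u).
Proof. by move=> /complex_cauchy_tends[l hl]; exact: (xgetPex 0 (ex_intro _ l hl)). Qed.

End ComplexLimits.

Section BoundedBiadditive.
Variables (R : realType) (V U : lmodType R[i]) (N : seminorm V) (NU : seminorm U).
Variable m : V -> V -> U.
Hypothesis mBl : forall x y z, m (x - y) z = m x z - m y z.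
Hypothesis mBr : forall x y z, m z (x - y) = m z x - m z y.
Hypothesis mN : forall x y, NU (m x y) <= N x * N y.

Lemma cauchyseq_bounded s : cauchyseq N s ->
  exists2 M, 0 < M & exists n, forall i, (n <= i)%N -> N (s i) <= M.
Proof.
move=> /(_ 1 ltr01)[n hn]; exists (N (s n) + 1).
  by have := sn_ge0 N (s n); lra.
exists n => i ni; have := hn i n ni (leqnn _); have := snD N (s i - s n) (s n).
rewrite subrK; lra.
Qed.

Lemma biadditive_le x y x' y' :
  NU (m x y - m x' y') <= N (x - x') * N y + N x' * N (y - y').
Proof.
apply: le_trans (sn_triangle _ (m x' y) _ _) _.
by rewrite -mBl -mBr; apply: lerD; exact: mN.
Qed.

(** Inner products and products of algebras extend to completions by this lemma
    and the next. *)
Lemma biadditive_cauchy s t : cauchyseq N s -> cauchyseq N t ->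
  cauchyseq NU (fun n => m (s n) (t n)).
Proof.
move=> hs ht e e0.
have [[A A0 [a ha]] [B B0 [b hb]]] := (cauchyseq_bounded hs, cauchyseq_bounded ht).
have [[c hc] [d hd]] := (hs (e / 2 / B) ltac:(by rewrite !divr_gt0), ht (e / 2 / A) ltac:(by rewrite !divr_gt0)).
exists (maxn (maxn a b) (maxn c d)) => i j; rewrite !geq_max.
move=> /andP[/andP[ai bi] /andP[ci di]] /andP[/andP[aj bj] /andP[cj dj]].
apply: le_trans (biadditive_le _ _ _ _) _.
have -> : e = e / 2 / B * B + A * (e / 2 / A) by field; rewrite !gt_eqF.
by apply: lerD; apply: ler_pM; rewrite ?sn_ge0 ?hc ?hd ?ha ?hb.
Qed.

Lemma biadditive_close s t s' t' : cauchyseq N s' -> cauchyseq N t ->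
  seq_close N s s' -> seq_close N t t' ->
  seq_close NU (fun n => m (s n) (t n)) (fun n => m (s' n) (t' n)).
Proof.
move=> hs ht hss htt e e0.
have [[A A0 [a ha]] [B B0 [b hb]]] := (cauchyseq_bounded hs, cauchyseq_bounded ht).
have [[c hc] [d hd]] := (hss (e / 2 / B) ltac:(by rewrite !divr_gt0), htt (e / 2 / A) ltac:(by rewrite !divr_gt0)).
exists (maxn (maxn a b) (maxn c d)) => i; rewrite !geq_max.
move=> /andP[/andP[ai bi] /andP[ci di]].
apply: le_trans (biadditive_le _ _ _ _) _.
have -> : e = e / 2 / B * B + A * (e / 2 / A) by field; rewrite !gt_eqF.
by apply: lerD; apply: ler_pM; rewrite ?sn_ge0 ?hc ?hd ?ha ?hb.
Qed.

End BoundedBiadditive.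

Section BoundedAdditive.
Variables (R : realType) (V U : lmodType R[i]) (N : seminorm V) (NU : seminorm U).
Variable f : V -> U.
Hypothesis fB : forall x y, f (x - y) = f x - f y.
Hypothesis fN : forall x, NU (f x) <= N x.

Lemma additive_cauchy s : cauchyseq N s -> cauchyseq NU (f \o s).
Proof.
move=> hs e /hs[n hn]; exists n => i j iN jn /=; rewrite -fB.
exact: le_trans (fN _) (hn _ _ iN jn).
Qed.

Lemma additive_close s t : seq_close N s t -> seq_close NU (f \o s) (f \o t).
Proof.
move=> h e /h[n hn]; exists n => i iN /=; rewrite -fB.
exact: le_trans (fN _) (hn _ iN).
Qed.

End BoundedAdditive.

(** * Completion of a Hermitian form to a Hilbert space *)

Section HilbertCompletion.
Variables (R : realType) (V : lmodType R[i]) (B : hform V).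
Local Notation N := (hseminorm B).
Local Notation W := (completion N).
Implicit Types (s t : nat -> V) (x y : W).

Lemma hfBl (x y z : V) : B (x - y) z = B x z - B y z.
Proof. by rewrite -scaleN1r hfDl hfZl mulN1r. Qed.
Lemma hfBr (x y z : V) : B z (x - y) = B z x - B z y.
Proof. by rewrite !(hfC _ z) hfBl rmorphB. Qed.

Lemma hf_cauchy s t : cauchyseq N s -> cauchyseq N t ->
  cauchyseq (cabs_seminorm R) (fun n => B (s n) (t n)).
Proof.
refine (@biadditive_cauchy R V R[i]^o N (cabs_seminorm R) B hfBl hfBr (hf_cauchy_schwarz B) s t).
Qed.

Definition cinner x y : R[i] := clim (fun n => B (rep x n) (rep y n)).

Lemma cinner_cls s t : cauchyseq N s -> cauchyseq N t ->
  ctends (fun n => B (s n) (t n)) (cinner (cls N s) (cls N t)).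
Proof.
move=> hs ht; have rc := @rep_cauchy _ _ N.
apply: (@ctends_close _ _ (fun n => B (rep (cls N s) n) (rep (cls N t) n))).
  refine (@biadditive_close R V R[i]^o N (cabs_seminorm R) B hfBl hfBr
    (hf_cauchy_schwarz B) s t _ _ (rc _) ht _ _).
    exact/seq_close_sym/rep_cls.
  exact/seq_close_sym/rep_cls.
exact/clim_tends/hf_cauchy.
Qed.

Lemma cinnerP a x y z : cinner (a *: x + y) z = a * cinner x z + cinner y z.
Proof.
elim/cls_ind: x => s hs; elim/cls_ind: y => t ht; elim/cls_ind: z => u hu.
have has := cauchyseqZ a hs; rewrite clsZ // clsD //.
apply: ctends_uniq (cinner_cls (cauchyseqD has ht) hu) _.
have := ctendsP a (cinner_cls hs hu) (cinner_cls ht hu).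
by congr ctends; apply/funext => n; rewrite hfDl hfZl.
Qed.

Lemma cinnerC x y : cinner x y = conjc (cinner y x).
Proof.
elim/cls_ind: x => s hs; elim/cls_ind: y => t ht.
apply: ctends_uniq (cinner_cls hs ht) _; have := ctends_conj (cinner_cls ht hs).
by congr ctends; apply/funext => n; rewrite -hfC.
Qed.

Lemma cinner_sqr x : cinner x x = (cnorm x ^+ 2)%:C.
Proof.
elim/cls_ind: x => s hs; apply: ctends_uniq (cinner_cls hs hs) _.
have hc := cnorm_cls hs.
have hm : (fun n => N (s n) * N (s n)) @ \oo --> cnorm (cls N s) * cnorm (cls N s).
  exact: (cvgM hc hc).
move=> e e0; have [n hn] := (cvgn_dist_le _ _).2 hm e e0.
exists n => i /hn /=; rewrite hf_real -hnorm_sqr -rmorphB cabs_real /=.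
by rewrite distrC !expr2.
Qed.

Fact cinner_zmodl y : zmod_morphism (cinner ^~ y).
Proof. by move=> a b; rewrite -scaleN1r addrC cinnerP mulN1r addrC. Qed.
Fact cinner_zmodr y : zmod_morphism (cinner y).
Proof. by move=> a b; rewrite !(cinnerC y) cinner_zmodl rmorphB. Qed.
Fact cinner_scalel y : scalable_for *%R (cinner ^~ y).
Proof.
have z : cinner 0 y = 0 by have := cinner_zmodl y 0 0; rewrite !subrr.
by move=> a x; have := cinnerP a x 0 y; rewrite z !addr0.
Qed.
Fact cinner_scaler y : scalable_for (Num.conj \; *%R) (cinner y).
Proof. by move=> a x; rewrite !(cinnerC y) cinner_scalel rmorphM. Qed.
Fact cinner_herm x y : cinner x y = (-1) ^+ false * Num.conj (cinner y x).
Proof. by rewrite expr0 mul1r cinnerC. Qed.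
Fact cinner_gt0 x : x != 0 -> 0 < cinner x x.
Proof.
move=> x0; rewrite cinner_sqr ltcR exprn_gt0 // lt_neqAle cnorm_ge0 andbT eq_sym.
by apply: contra x0 => /eqP/cnorm_eq0 ->.
Qed.

HB.instance Definition _ := isBilinear.Build R[i] W W R[i] *%R (Num.conj \; *%R)
  cinner cinner_zmodl cinner_zmodr cinner_scalel cinner_scaler.
HB.instance Definition _ :=
  isHermitianSesquilinear.Build R[i] W false Num.conj cinner cinner_herm.
HB.instance Definition _ := isDotProduct.Build R[i] W cinner cinner_gt0.

Lemma cinner_norm x : cinner x x = `|x| ^+ 2.
Proof. by rewrite cinner_sqr completion_normE rmorphXn. Qed.

Definition hilbert_completion : hilbertSpace R :=
  @HilbertSpace R W cinner cinner_norm.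

End HilbertCompletion.

(** * Convolution and involution on the group algebra *)

(** The step of the inductions on the first argument that prove linearity in the
    second. *)
Lemma scale_add_exchange (K : comNzRingType) (U : lmodType K) (a b : K) (x y z t : U) :
  b *: (a *: x + y) + (a *: z + t) = a *: (b *: x + z) + (b *: y + t).
Proof. by rewrite !scalerDr !scalerA (mulrC b) addrACA. Qed.

Definition gmul (R : realType) (G : groupType) (v w : free_module R[i] G) :
    free_module R[i] G :=
  gext idfun (fun g => gext idfun (fun h => gdelta R[i] (g * h)%g) w) v.

Definition gstar (R : realType) (G : groupType) (v : free_module R[i] G) :
    free_module R[i] G :=
  gext (@conjc R) (fun g => gdelta R[i] g^-1%g) v.

Section GroupAlgebra.
Variables (R : realType) (G : groupType).
Local Notation C := R[i].
Local Notation A := (free_module C G).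
Local Notation ext := (gext (K := C) (G := G) idfun).
Local Notation gmul := (@gmul R G).
Local Notation gstar := (@gstar R G).
Implicit Types (v w : A) (g h : G).

Lemma extP (U : lmodType C) (u : G -> U) a v w :
  ext u (a *: v + w) = a *: ext u v + ext u w.
Proof. exact: gextP. Qed.

Lemma gmulPl a v w z : gmul (a *: v + w) z = a *: gmul v z + gmul w z.
Proof. exact: extP. Qed.

Lemma gmul0l v : gmul 0 v = 0.
Proof. exact: gext0. Qed.

Lemma gmul_deltal g v : gmul (gdelta C g) v = ext (fun h => gdelta C (g * h)%g) v.
Proof. exact: gext_delta. Qed.

Lemma gmulPr a v w z : gmul z (a *: v + w) = a *: gmul z v + gmul z w.
Proof.
elim/free_ind: z => [|b g z IH]; first by rewrite !gmul0l scaler0 addr0.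
rewrite !gmulPl IH !gmul_deltal extP.
exact: scale_add_exchange.
Qed.

Lemma gmul_delta g h : gmul (gdelta C g) (gdelta C h) = gdelta C (g * h)%g.
Proof. by rewrite gmul_deltal gext_delta. Qed.

Lemma gmul0r v : gmul v 0 = 0.
Proof. by have := gmulPr (-1) 0 0 v; rewrite scaler0 addr0 scaleN1r addNr. Qed.

Lemma gmulA : associative gmul.
Proof.
move=> x y z; elim/free_ind: x => [|a g x IHx]; first by rewrite !gmul0l.
rewrite !gmulPl IHx; congr (_ *: _ + _); clear x IHx.
elim/free_ind: y => [|b h y IHy]; first by rewrite ?(gmul0l, gmul0r).
rewrite !(gmulPl, gmulPr) IHy; congr (_ *: _ + _); clear y IHy.
elim/free_ind: z => [|c k z IHz]; first by rewrite ?(gmul0l, gmul0r).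
by rewrite !gmulPr IHz !gmul_delta mulgA.
Qed.

Lemma gmul1l : left_id (gdelta C 1%g) gmul.
Proof.
elim/free_ind=> [|a g v IH]; first by rewrite gmul0r.
by rewrite gmulPr IH gmul_delta mul1g.
Qed.

Lemma gmul1r : right_id (gdelta C 1%g) gmul.
Proof.
elim/free_ind=> [|a g v IH]; first by rewrite gmul0l.
by rewrite gmulPl IH gmul_delta mulg1.
Qed.

Lemma gstarP a v w : gstar (a *: v + w) = conjc a *: gstar v + gstar w.
Proof. exact: gextP. Qed.

Lemma gstar0 : gstar 0 = 0. Proof. exact: gext0. Qed.

Lemma gstar_delta g : gstar (gdelta C g) = gdelta C g^-1%g.
Proof. exact: gext_delta. Qed.

Lemma gstarK : involutive gstar.
Proof.
elim/free_ind=> [|a g v IH]; first by rewrite !gstar0.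
by rewrite !gstarP IH !gstar_delta invgK conjcK.
Qed.

Lemma gstarM v w : gstar (gmul v w) = gmul (gstar w) (gstar v).
Proof.
elim/free_ind: v => [|a g v IHv]; first by rewrite gmul0l !gstar0 gmul0r.
rewrite gmulPl !gstarP gmulPr IHv; congr (_ *: _ + _); clear v IHv.
elim/free_ind: w => [|b h w IHw]; first by rewrite gmul0r !gstar0 gmul0l.
by rewrite gmulPr !gstarP gmulPl IHw gmul_delta !gstar_delta gmul_delta invgM.
Qed.

Lemma lincomb_delta (U : lmodType C) (u : G -> U) s :
  lincomb u s = ext u (lincomb (@gdelta C G) s).
Proof.
rewrite /lincomb; elim: s => [|x s IH]; first by rewrite !big_nil gext0.
by rewrite !big_cons extP gext_delta IH.
Qed.

Lemma lincomb_onto v : exists s, v = lincomb (@gdelta C G) s.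
Proof.
elim/free_ind: v => [|a g v [s ->]]; first by exists [::]; rewrite /lincomb big_nil.
by exists ((a, g) :: s); rewrite /lincomb big_cons.
Qed.

(** The canonical trace. *)
Definition gtr v : C := gcoef 1%g v.

Lemma gtrP a v w : gtr (a *: v + w) = a * gtr v + gtr w.
Proof. exact: gextP. Qed.

Lemma gtr0 : gtr 0 = 0. Proof. exact: gext0. Qed.

Lemma gtr_delta g : gtr (gdelta C g) = (g == 1%g)%:R.
Proof. exact: gext_delta. Qed.

Lemma gtrC v w : gtr (gmul v w) = gtr (gmul w v).
Proof.
elim/free_ind: v => [|a g v IHv]; first by rewrite gmul0l gmul0r.
rewrite gmulPl gmulPr !gtrP IHv; congr (_ * _ + _); clear v IHv.
elim/free_ind: w => [|b h w IHw]; first by rewrite gmul0l gmul0r.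
rewrite gmulPl gmulPr !gtrP IHw; congr (_ * _ + _).
by rewrite !gmul_delta !gtr_delta !mulg_eq1 eq_sym eqg_invLR.
Qed.

Lemma gtr_star v : gtr (gstar v) = conjc (gtr v).
Proof.
elim/free_ind: v => [|a g v IHv]; first by rewrite gstar0 gtr0 conjc0.
rewrite gstarP !gtrP IHv rmorphD rmorphM gstar_delta !gtr_delta.
by rewrite invg_eq1 /= rmorph_nat.
Qed.

Lemma gtr_mul_delta v g : gtr (gmul (gdelta C g^-1%g) v) = gcoef g v.
Proof.
elim/free_ind: v => [|a h v IHv]; first by rewrite gmul0r gtr0 /gcoef gext0.
rewrite gmulPr gtrP IHv gmul_delta gtr_delta /gcoef extP gext_delta.
by rewrite -(inj_eq (mulgI g)) mulVKg mulg1.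
Qed.

(** tr (v^* v) is the sum of the |v_g|^2. *)
Lemma gtr_starmul_ge0 v : 0 <= gtr (gmul (gstar v) v).
Proof.
have E w : gtr (gmul (gstar w) v) = gext (@conjc R) (fun g => gcoef g v : C^o) w.
  elim/free_ind: w => [|a g w IH]; first by rewrite gstar0 gmul0l gext0 gtr0.
  by rewrite gstarP gmulPl gtrP IH gextP gext_delta gstar_delta gtr_mul_delta.
have [D vE] := gcoefE v; rewrite E {2}vE {vE}.
elim: D => [|g D IH]; first by rewrite big_nil gext0.
rewrite big_cons gextP gext_delta addr_ge0 //.
by rewrite /GRing.scale /= mulrC -conjCE mul_conjC_ge0.
Qed.

(** The inner product of l^2(G). *)
Definition gform v w : C := gtr (gmul (gstar w) v).

Fact gformP a x y z : gform (a *: x + y) z = a * gform x z + gform y z.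
Proof. by rewrite /gform gmulPr gtrP. Qed.
Fact gformC x y : gform x y = conjc (gform y x).
Proof. by rewrite /gform -gtr_star gstarM gstarK. Qed.

Definition ghform : hform A := HForm gformP gformC gtr_starmul_ge0.

End GroupAlgebra.

(** * The maximal C*-norm *)

Section HilbertForm.
Variables (R : realType) (H : hilbertSpace R).

Fact inner_linl (a : R[i]) (x y z : H) :
  inner H (a *: x + y) z = a * inner H x z + inner H y z.
Proof. by rewrite linearDl linearZl. Qed.
Fact inner_conj (x y : H) : inner H x y = conjc (inner H y x).
Proof. by rewrite hermitian_subproof expr0 mul1r. Qed.
Fact inner_ge0 (x : H) : 0 <= inner H x x.
Proof. by rewrite inner_norm exprn_ge0. Qed.

Definition hilbert_hform : hform H := HForm inner_linl inner_conj inner_ge0.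

Lemma hilbert_normE (x : H) : `|x| = (hnorm hilbert_hform x)%:C.
Proof.
apply/eqP; rewrite -(eqrXn2 (n := 2)) // ?lecR ?hnorm_ge0 //.
by rewrite -rmorphXn /= hnorm_sqr -hf_real /= inner_norm.
Qed.

End HilbertForm.

Section RepresentationOfGroupAlgebra.
Variables (R : realType) (G : groupType) (H : hilbertSpace R).
Variable pi : unitaryRep G H.
Local Notation A := (free_module R[i] G).
Local Notation B := (hilbert_hform H).
Implicit Types (v w : A) (x y : H).

Definition ev v x : H := gext idfun (fun g => pi g x) v.

Lemma evP a v w x : ev (a *: v + w) x = a *: ev v x + ev w x.
Proof. exact: gextP. Qed.
Lemma ev_delta g x : ev (gdelta R[i] g) x = pi g x.
Proof. exact: gext_delta. Qed.
Lemma ev0 x : ev 0 x = 0.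
Proof. exact: gext0. Qed.

Lemma evD v w x : ev (v + w) x = ev v x + ev w x.
Proof. by rewrite -[v in LHS]scale1r evP scale1r. Qed.

Lemma ev_linear v a x y : ev v (a *: x + y) = a *: ev v x + ev v y.
Proof.
elim/free_ind: v => [|b g v IH]; first by rewrite !ev0 scaler0 addr0.
rewrite !evP IH !ev_delta linearP; exact: scale_add_exchange.
Qed.

Lemma evr0 v : ev v 0 = 0.
Proof. by have := ev_linear v (-1) 0 0; rewrite scaler0 addr0 scaleN1r addNr. Qed.

Lemma ev_mul v w x : ev (gmul v w) x = ev v (ev w x).
Proof.
elim/free_ind: v => [|a g v IH]; first by rewrite gmul0l !ev0.
rewrite gmulPl !evP IH; congr (_ *: _ + _); clear v IH.
elim/free_ind: w => [|b h w IH]; first by rewrite gmul0r !ev0 evr0.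
by rewrite gmulPr !evP ev_linear IH gmul_delta !ev_delta repM.
Qed.

Lemma rep_adjoint g x y : inner H (pi g x) y = inner H x (pi g^-1%g y).
Proof. by rewrite -[y in LHS](rep1 pi) -(mulgV g) repM rep_unitary. Qed.

Lemma ev_star v x y : inner H (ev v x) y = inner H x (ev (gstar v) y).
Proof.
change (B (ev v x) y = B x (ev (gstar v) y)).
elim/free_ind: v => [|a g v IH].
  by rewrite gstar0 !ev0 (hf0l B) (hf0r B).
rewrite gstarP !evP (hfPl B) IH (hfDr B) (hfZr B) conjcK gstar_delta !ev_delta.
by rewrite /= rep_adjoint.
Qed.

Lemma rep_norm g x : hnorm B (pi g x) = hnorm B x.
Proof. by rewrite /hnorm /rform /= rep_unitary. Qed.

End RepresentationOfGroupAlgebra.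

Section MaximalNorm.
Variables (R : realType) (G : groupType).
Local Notation A := (free_module R[i] G).
Implicit Types (v w : A) (M : R).

Definition bounded_by v M := forall (H : hilbertSpace R) (pi : unitaryRep G H) (x : H),
  hnorm (hilbert_hform H) (ev pi v x) <= M * hnorm (hilbert_hform H) x.

(** The l^1-norm is a bound. *)
Lemma bounded_ex v : exists2 M, 0 <= M & bounded_by v M.
Proof.
elim/free_ind: v => [|a g v [M M0 hM]].
  by exists 0 => // H pi x; rewrite ev0 mul0r hnorm0.
exists (cabs a + M) => [|H pi x]; first by rewrite addr_ge0 // cabs_ge0.
rewrite evP ev_delta mulrDl; apply: le_trans (hnormD _ _ _) _.
by rewrite hnormZ rep_norm lerD2l hM.
Qed.

(** The supremum of the norms of pi(v) over all unitary representations pi, taken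
    as the infimum of the common bounds, which form a set of reals while the
    representations form a proper class. *)
Definition gnorm v : R := inf [set M | 0 <= M /\ bounded_by v M].

Lemma gnorm_has_inf v : has_inf [set M | 0 <= M /\ bounded_by v M].
Proof.
split; first by have [M M0 hM] := bounded_ex v; exists M.
by exists 0 => M [].
Qed.

Lemma gnorm_ge0 v : 0 <= gnorm v.
Proof. by apply: lb_le_inf => [|M []//]; have [] := gnorm_has_inf v. Qed.

Lemma gnorm_bound v : bounded_by v (gnorm v).
Proof.
move=> H pi x; have := hnorm_ge0 (hilbert_hform H) x.
rewrite le_eqVlt => /orP[/eqP x0 | x0].
  by have [M _ /(_ H pi x)] := bounded_ex v; rewrite -x0 !mulr0.
rewrite -ler_pdivrMr //; apply: lb_le_inf; first by have [] := gnorm_has_inf v.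
by move=> M [_ /(_ H pi x)]; rewrite ler_pdivrMr.
Qed.

Lemma gnorm_le v M : 0 <= M -> bounded_by v M -> gnorm v <= M.
Proof. by move=> M0 hM; apply: ge_inf; [case: (gnorm_has_inf v) | split]. Qed.

Lemma gnormD v w : gnorm (v + w) <= gnorm v + gnorm w.
Proof.
apply: gnorm_le => [|H pi x]; first by rewrite addr_ge0 ?gnorm_ge0.
rewrite evD mulrDl; apply: le_trans (hnormD _ _ _) _.
by apply: lerD; exact: gnorm_bound.
Qed.

Lemma gnormZ_le a v : gnorm (a *: v) <= cabs a * gnorm v.
Proof.
apply: gnorm_le => [|H pi x]; first by rewrite mulr_ge0 ?gnorm_ge0 ?cabs_ge0.
rewrite -[a *: v]addr0 evP ev0 addr0 hnormZ -mulrA.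
by apply: ler_wpM2l; [exact: cabs_ge0 | exact: gnorm_bound].
Qed.

Lemma gnormZ a v : gnorm (a *: v) = cabs a * gnorm v.
Proof.
apply/le_anti; rewrite gnormZ_le /=.
have [->|a0] := eqVneq a 0; first by rewrite cabs0 mul0r gnorm_ge0.
have ca : 0 < cabs a by rewrite -ltcR -cabsE normr_gt0.
have := gnormZ_le a^-1 (a *: v); rewrite scalerA mulVf // scale1r => h.
have cE : cabs a * cabs a^-1 = 1 by rewrite -cabsM divff // cabs1.
by have := ler_wpM2l (ltW ca) h; rewrite mulrA cE mul1r.
Qed.

Definition gseminorm : seminorm A := Seminorm gnormD gnormZ.

Lemma gnorm_mul v w : gnorm (gmul v w) <= gnorm v * gnorm w.
Proof.
apply: gnorm_le => [|H pi x]; first by rewrite mulr_ge0 ?gnorm_ge0.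
rewrite ev_mul -mulrA; apply: le_trans (gnorm_bound _ _ _) _.
by apply: ler_wpM2l; [exact: gnorm_ge0 | exact: gnorm_bound].
Qed.

(** |y|^2 = <x, pi(v) y> for y = pi(v^* ) x. *)
Lemma gnorm_star_le v : gnorm (gstar v) <= gnorm v.
Proof.
apply: gnorm_le => [|H pi x]; first exact: gnorm_ge0.
set B := hilbert_hform H; set y := ev pi (gstar v) x.
have : hnorm B y ^+ 2 <= hnorm B x * (gnorm v * hnorm B y).
  have -> : hnorm B y ^+ 2 = rform B x (ev pi v y).
    by rewrite hnorm_sqr rformC /rform /= [in RHS]ev_star.
  apply: le_trans (rform_le _ _ _) _.
  by apply: ler_wpM2l; [exact: hnorm_ge0 | exact: gnorm_bound].
have := hnorm_ge0 B y; rewrite le_eqVlt => /orP[/eqP <- _ | y0].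
  by rewrite mulr_ge0 ?gnorm_ge0 ?hnorm_ge0.
by rewrite mulrA expr2 ler_pM2r // mulrC.
Qed.

Lemma gnorm_star v : gnorm (gstar v) = gnorm v.
Proof.
by apply/le_anti; rewrite gnorm_star_le /= -{1}[v]gstarK gnorm_star_le.
Qed.

(** |pi(v) x|^2 = <x, pi(v^* v) x>. *)
Lemma gnorm_cstar v : gnorm (gmul (gstar v) v) = gnorm v ^+ 2.
Proof.
apply/le_anti/andP; split.
  by apply: le_trans (gnorm_mul _ _) _; rewrite gnorm_star expr2.
set M := gnorm (gmul _ _); have M0 : 0 <= M by exact: gnorm_ge0.
rewrite -[leRHS]sqr_sqrtr // ler_pXn2r ?nnegrE ?sqrtr_ge0 ?gnorm_ge0 //.
apply: gnorm_le => [|H pi x]; first exact: sqrtr_ge0.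
set B := hilbert_hform H.
rewrite -(ler_pXn2r (n := 2)) ?nnegrE ?mulr_ge0 ?sqrtr_ge0 ?hnorm_ge0 //.
rewrite exprMn [leLHS]hnorm_sqr (sqr_sqrtr M0) /rform /= ev_star -ev_mul.
apply: le_trans (rform_le B _ _) _; rewrite mulrC expr2 mulrA.
by apply: ler_wpM2r; [exact: hnorm_ge0 | exact: gnorm_bound].
Qed.

End MaximalNorm.

(** * The regular representation *)

Section RegularRepresentation.
Variables (R : realType) (G : groupType).
Local Notation A := (free_module R[i] G).
Local Notation B2 := (@ghform R G).
Local Notation N2 := (hseminorm B2).
Local Notation H2 := (hilbert_completion B2).
Local Notation W2 := (completion N2).
Implicit Types (v w : A) (g h : G).

Definition gshift g v : A := gmul (gdelta R[i] g) v.

Fact gshift_linear g : linear (gshift g).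
Proof. by move=> a v w; exact: gmulPr. Qed.

Lemma gshiftB g v w : gshift g (v - w) = gshift g v - gshift g w.
Proof. by rewrite -scaleN1r addrC gshift_linear scaleN1r addrC. Qed.

Lemma ghform_shift g v w : B2 (gshift g v) (gshift g w) = B2 v w.
Proof.
by rewrite /= /gform /gshift gstarM gstar_delta -gmulA (gmulA (gdelta _ g^-1%g))
  gmul_delta mulVg gmul1l.
Qed.

Lemma hnorm_shift g v : N2 (gshift g v) = N2 v.
Proof. by rewrite /= /hnorm /rform ghform_shift. Qed.

Lemma gshift_cauchy g s : cauchyseq N2 s -> cauchyseq N2 (gshift g \o s).
Proof.
by apply: (@additive_cauchy R A A N2 N2) => [v w|v]; rewrite ?gshiftB ?hnorm_shift.
Qed.

Definition lreg g (x : H2) : H2 := cls N2 (gshift g \o rep (x : W2)).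

Lemma lreg_cls g s : cauchyseq N2 s -> lreg g (cls N2 s) = cls N2 (gshift g \o s).
Proof.
move=> hs; apply/clsP; [exact/gshift_cauchy/rep_cauchy | exact: gshift_cauchy |].
apply: (@additive_close R A A N2 N2); last exact: rep_cls.
  by move=> v w; rewrite gshiftB.
by move=> v; rewrite hnorm_shift.
Qed.

Fact lreg_linear g : linear (lreg g).
Proof.
move=> a; elim/cls_ind=> s hs; elim/cls_ind=> t ht.
rewrite [X in lreg g (X + _)]clsZ // [X in lreg g X]clsD //; last exact: cauchyseqZ.
rewrite !lreg_cls //; last by apply: cauchyseqD => //; exact: cauchyseqZ.
rewrite [X in _ = X + _]clsZ; last exact: gshift_cauchy.
rewrite [RHS]clsD; [|exact/cauchyseqZ/gshift_cauchy|exact: gshift_cauchy].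
by congr (cls N2 _); apply/funext => n /=; rewrite gshift_linear.
Qed.
HB.instance Definition _ g := GRing.isLinear.Build R[i] H2 H2 _ (lreg g) (lreg_linear g).

Fact lreg1 (x : H2) : lreg 1%g x = x.
Proof.
elim/cls_ind: x => s hs; rewrite lreg_cls //; congr (cls N2 _).
by apply/funext => n /=; rewrite /gshift gmul1l.
Qed.

Fact lregM g h (x : H2) : lreg (g * h)%g x = lreg g (lreg h x).
Proof.
elim/cls_ind: x => s hs; rewrite !lreg_cls //; last exact: gshift_cauchy.
by congr (cls N2 _); apply/funext => n /=; rewrite /gshift -gmul_delta gmulA.
Qed.

Fact lreg_unitary g (x y : H2) : inner H2 (lreg g x) (lreg g y) = inner H2 x y.
Proof.
elim/cls_ind: x => s hs; elim/cls_ind: y => t ht; rewrite !lreg_cls //.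
have := cinner_cls (gshift_cauchy g hs) (gshift_cauchy g ht).
move/ctends_uniq; apply; have := cinner_cls hs ht; congr ctends.
by apply/funext => n; rewrite [RHS]ghform_shift.
Qed.

Definition regular_rep : unitaryRep G H2 :=
  UnitaryRep (rep_fun := fun g => lreg g : {linear H2 -> H2}) lreg1 lregM lreg_unitary.

Definition delta1 : H2 := cemb N2 (gdelta R[i] 1%g).

Lemma ev_regular v : ev regular_rep v delta1 = cemb N2 v.
Proof.
elim/free_ind: v => [|a g v IH]; first by rewrite ev0 [RHS]linear0.
rewrite evP ev_delta IH.
suff -> : regular_rep g delta1 = cemb N2 (gdelta R[i] g) by rewrite [RHS]linearP.
apply: etrans (lreg_cls g (cauchyseq_cst _ _)) _.
by congr (cls N2 _); apply/funext => n; rewrite /= /gshift gmul1r.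
Qed.

Lemma hnorm_emb v : hnorm (hilbert_hform H2) (cemb N2 v : H2) = hnorm B2 v.
Proof.
by apply: complexI; rewrite -hilbert_normE [LHS]completion_normE cnorm_emb.
Qed.

Lemma hnorm_delta1 : hnorm B2 (gdelta R[i] 1%g) = 1.
Proof.
rewrite /hnorm /rform /= /gform gstar_delta gmul_delta mulVg gtr_delta eqxx.
by rewrite /= sqrtr1.
Qed.

(** The l^2-norm of v is the norm of lambda(v) delta_1. *)
Lemma hnorm_le_gnorm v : hnorm B2 v <= gnorm v.
Proof.
have := gnorm_bound v regular_rep delta1.
by rewrite ev_regular !hnorm_emb hnorm_delta1 mulr1.
Qed.

(** tr v = <lambda(v) delta_1, delta_1>; so the trace extends to the completion. *)
Lemma gtr_le_gnorm v : cabs (gtr v) <= gnorm v.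
Proof.
apply: le_trans (hnorm_le_gnorm v).
have := hf_cauchy_schwarz B2 v (gdelta R[i] 1%g).
by rewrite hnorm_delta1 mulr1 /= /gform gstar_delta invg1 gmul1l.
Qed.

End RegularRepresentation.

Lemma lincomb_linear (R : realType) (G : groupType) (U U' : lmodType R[i])
    (f : {linear U -> U'}) (u : G -> U) (s : seq (R[i] * G)) :
  f (lincomb u s) = lincomb (f \o u) s.
Proof. by rewrite /lincomb linear_sum; apply: eq_bigr => x _; rewrite linearZ. Qed.

(** * The maximal group C*-algebra and its canonical trace *)

Section MaximalGroupCstar.
Variables (R : realType) (G : groupType).
Local Notation A := (free_module R[i] G).
Local Notation N := (@gseminorm R G).
Local Notation W := (completion N).
Implicit Types (s t : nat -> A) (x y : W).

Lemma gmulBl (x y z : A) : gmul (x - y) z = gmul x z - gmul y z.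
Proof. by rewrite -scaleN1r addrC gmulPl scaleN1r addrC. Qed.
Lemma gmulBr (x y z : A) : gmul z (x - y) = gmul z x - gmul z y.
Proof. by rewrite -scaleN1r addrC gmulPr scaleN1r addrC. Qed.
Lemma gstarB (x y : A) : gstar (x - y) = gstar x - gstar y.
Proof. by rewrite -scaleN1r addrC gstarP rmorphN1 scaleN1r addrC. Qed.

Lemma gmul_cauchy s t : cauchyseq N s -> cauchyseq N t ->
  cauchyseq N (fun n => gmul (s n) (t n)).
Proof. exact: (@biadditive_cauchy R A A N N _ gmulBl gmulBr (@gnorm_mul R G)). Qed.

Lemma gstar_cauchy s : cauchyseq N s -> cauchyseq N (@gstar R G \o s).
Proof. exact: (@additive_cauchy R A A N N _ gstarB (@gnorm_star_le R G)). Qed.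

Definition wmul x y : W := cls N (fun n => gmul (rep x n) (rep y n)).
Definition wstar x : W := cls N (@gstar R G \o rep x).
Definition wemb (g : G) : W := cemb N (gdelta R[i] g).

Lemma wmul_cls s t : cauchyseq N s -> cauchyseq N t ->
  wmul (cls N s) (cls N t) = cls N (fun n => gmul (s n) (t n)).
Proof.
move=> hs ht; apply/clsP.
- by apply: gmul_cauchy; exact: rep_cauchy.
- exact: gmul_cauchy.
- refine (@biadditive_close R A A N N _ gmulBl gmulBr (@gnorm_mul R G) _ _ _ _
    hs (rep_cauchy _) _ _); exact: rep_cls.
Qed.

Lemma wstar_cls s : cauchyseq N s -> wstar (cls N s) = cls N (@gstar R G \o s).
Proof.
move=> hs; apply/clsP; [exact/gstar_cauchy/rep_cauchy | exact: gstar_cauchy |].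
apply: (@additive_close R A A N N _ gstarB (@gnorm_star_le R G)).
exact: rep_cls.
Qed.

Lemma wmulPl a x y z : wmul (a *: x + y) z = a *: wmul x z + wmul y z.
Proof.
elim/cls_ind: x => s hs; elim/cls_ind: y => t ht; elim/cls_ind: z => u hu.
have has := cauchyseqZ a hs; have hst := cauchyseqD has ht.
rewrite (clsZ a hs) (clsD has ht) (wmul_cls hst hu) (wmul_cls hs hu) (wmul_cls ht hu).
rewrite (clsZ a (gmul_cauchy hs hu)) (clsD (cauchyseqZ a (gmul_cauchy hs hu)) (gmul_cauchy ht hu)).
by congr (cls N _); apply/funext => n; rewrite gmulPl.
Qed.

Lemma wmulPr a x y z : wmul z (a *: x + y) = a *: wmul z x + wmul z y.
Proof.
elim/cls_ind: x => s hs; elim/cls_ind: y => t ht; elim/cls_ind: z => u hu.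
have has := cauchyseqZ a hs; have hst := cauchyseqD has ht.
rewrite (clsZ a hs) (clsD has ht) (wmul_cls hu hst) (wmul_cls hu hs) (wmul_cls hu ht).
rewrite (clsZ a (gmul_cauchy hu hs)) (clsD (cauchyseqZ a (gmul_cauchy hu hs)) (gmul_cauchy hu ht)).
by congr (cls N _); apply/funext => n; rewrite gmulPr.
Qed.

Fact wmul_bilinear : bilinear_for *:%R *:%R wmul.
Proof. by split=> z a x y; [exact: wmulPl | exact: wmulPr]. Qed.
HB.instance Definition _ := bilinear_isBilinear.Build R[i] W W W *:%R *:%R wmul
  wmul_bilinear.

Lemma wmulA : associative wmul.
Proof.
elim/cls_ind=> s hs; elim/cls_ind=> t ht; elim/cls_ind=> u hu.
have := @gmul_cauchy _ _ hs ht; have := @gmul_cauchy _ _ ht hu => h1 h2.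
by rewrite !wmul_cls //; congr (cls N _); apply/funext => n; rewrite gmulA.
Qed.

Lemma wmul1l : left_id (wemb 1%g) wmul.
Proof.
elim/cls_ind=> s hs; have h1 : cauchyseq N (fun=> gdelta R[i] (1 : G)%g).
  exact: cauchyseq_cst.
by rewrite wmul_cls //; congr (cls N _); apply/funext => n; rewrite gmul1l.
Qed.

Lemma wmul1r : right_id (wemb 1%g) wmul.
Proof.
elim/cls_ind=> s hs; have h1 : cauchyseq N (fun=> gdelta R[i] (1 : G)%g).
  exact: cauchyseq_cst.
by rewrite wmul_cls //; congr (cls N _); apply/funext => n; rewrite gmul1r.
Qed.

Lemma wstarK : involutive wstar.
Proof.
elim/cls_ind=> s hs; have h := gstar_cauchy hs; rewrite !wstar_cls //.
by congr (cls N _); apply/funext => n /=; rewrite gstarK.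
Qed.

Lemma wstarP a x y : wstar (a *: x + y) = Num.conj a *: wstar x + wstar y.
Proof.
elim/cls_ind: x => s hs; elim/cls_ind: y => t ht.
have has := cauchyseqZ a hs; have hst := cauchyseqD has ht.
have [h1 h2] := (gstar_cauchy hs, gstar_cauchy ht).
rewrite (clsZ a hs) (clsD has ht) (wstar_cls hst) (wstar_cls hs) (wstar_cls ht).
rewrite (clsZ _ h1) (clsD (cauchyseqZ _ h1) h2).
by congr (cls N _); apply/funext => n /=; rewrite gstarP.
Qed.

Lemma wstarM x y : wstar (wmul x y) = wmul (wstar y) (wstar x).
Proof.
elim/cls_ind: x => s hs; elim/cls_ind: y => t ht.
have h := gmul_cauchy hs ht.
have [h1 h2] := (gstar_cauchy hs, gstar_cauchy ht).
rewrite (wmul_cls hs ht) (wstar_cls h) (wstar_cls hs) (wstar_cls ht) (wmul_cls h2 h1).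
by congr (cls N _); apply/funext => n /=; rewrite gstarM.
Qed.

Lemma wmul_norm x y : `|wmul x y| <= `|x| * `|y|.
Proof.
rewrite !completion_normE -rmorphM lecR.
elim/cls_ind: x => s hs; elim/cls_ind: y => t ht; rewrite wmul_cls //.
apply: (cvgn_le (m := 0) (cnorm_cls (gmul_cauchy hs ht))
  (cvgM (cnorm_cls hs) (cnorm_cls ht))) => n _; exact: gnorm_mul.
Qed.

Lemma wstar_norm x : `|wmul (wstar x) x| = `|x| ^+ 2.
Proof.
rewrite !completion_normE -rmorphXn; congr (_%:C).
elim/cls_ind: x => s hs; have hs' := gstar_cauchy hs; rewrite wstar_cls // wmul_cls //.
have h1 := cnorm_cls (gmul_cauchy hs' hs).
have h2 : (fun n => N (s n) * N (s n)) @ \oo --> cnorm (cls N s) * cnorm (cls N s).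
  exact: (cvgM (cnorm_cls hs) (cnorm_cls hs)).
apply: (cvgn_uniq h1); rewrite expr2.
have -> : N \o (fun n => gmul ((@gstar R G \o s) n) (s n)) = (fun n => N (s n) * N (s n)).
  by apply/funext => n; rewrite /= gnorm_cstar expr2.
exact: h2.
Qed.

Definition max_cstar : cstarAlgebra R :=
  @CstarAlgebra R W wmul (wemb 1%g) wstar wmulA wmul1l wmul1r wstarK wstarP wstarM
    wmul_norm wstar_norm.

Lemma lincomb_wemb (s : seq (R[i] * G)) :
  lincomb wemb s = cemb N (lincomb (@gdelta R[i] G) s).
Proof. by rewrite (lincomb_linear (cemb N)). Qed.

Lemma max_group_cstarP : max_group_cstar (A := max_cstar) wemb.
Proof.
split.
- by [].
- move=> g h; rewrite /= [RHS]wmul_cls; try exact: cauchyseq_cst.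
  by congr (cls N _); apply/funext => n; rewrite gmul_delta.
- move=> g; rewrite /= [RHS]wstar_cls; last exact: cauchyseq_cst.
  by congr (cls N _); apply/funext => n /=; rewrite gstar_delta.
- apply/seteqP; split=> // x _; elim/cls_ind: x => s hs U.
  move=> /(cls_cvg hs)[n _ /(_ n (leqnn n))] /= Us.
  exists (cemb N (s n)); split=> //.
  by have [l lE] := lincomb_onto (s n); exists l => //; rewrite [LHS]lincomb_wemb lE.
- move=> s H pi x; rewrite lincomb_delta !hilbert_normE.
  rewrite [X in `|X|]lincomb_wemb [X in X * _]completion_normE cnorm_emb.
  by rewrite -rmorphM lecR; exact: gnorm_bound.
- move=> s M hM; rewrite [X in `|X|]lincomb_wemb [leLHS]completion_normE cnorm_emb lecR.
  have hb : bounded_by (lincomb (@gdelta R[i] G) s) M.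
    move=> H pi x; have := hM H pi x.
    by rewrite lincomb_delta !hilbert_normE -rmorphM lecR.
  apply: gnorm_le => //.
  have := hb _ (regular_rep R G) (delta1 R G); rewrite hnorm_emb hnorm_delta1 mulr1.
  by apply: le_trans; exact: hnorm_ge0.
Qed.

Lemma gtrB (x y : A) : gtr (x - y) = gtr x - gtr y.
Proof. by rewrite -scaleN1r addrC gtrP mulN1r addrC. Qed.

Definition wtr (x : max_cstar) : R[i] := clim (fun n => gtr (rep (x : W) n)).

Lemma wtr_cls s : cauchyseq N s -> ctends (@gtr R G \o s) (wtr (cls N s)).
Proof.
move=> hs; apply: (@ctends_close _ _ (@gtr R G \o rep (cls N s))).
  apply: (@additive_close R A R[i]^o N (cabs_seminorm R) _ gtrB (@gtr_le_gnorm R G)).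
  exact/seq_close_sym/rep_cls.
apply: clim_tends.
apply: (@additive_cauchy R A R[i]^o N (cabs_seminorm R) _ gtrB (@gtr_le_gnorm R G)).
exact: rep_cauchy.
Qed.

Fact wtr_linear : scalar wtr.
Proof.
move=> a; elim/cls_ind=> s hs; elim/cls_ind=> t ht.
have has := cauchyseqZ a hs; rewrite [X in wtr (X + _)]clsZ // [X in wtr X]clsD //.
apply: ctends_uniq (wtr_cls (cauchyseqD has ht)) _.
have := ctendsP a (wtr_cls hs) (wtr_cls ht); congr ctends.
by apply/funext => n /=; rewrite gtrP.
Qed.
HB.instance Definition _ := GRing.isLinear.Build R[i] max_cstar R[i] _ wtr wtr_linear.

Lemma canonical_traceP : canonical_trace (A := max_cstar) wemb wtr.
Proof.
split.
- elim/cls_ind=> s hs; have hs' := gstar_cauchy hs.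
  change (0 <= wtr (wmul (wstar (cls N s)) (cls N s))).
  rewrite (wstar_cls hs) (wmul_cls hs' hs).
  apply: ctends_ge0 (wtr_cls (gmul_cauchy hs' hs)) => n; exact: gtr_starmul_ge0.
- elim/cls_ind=> s hs; elim/cls_ind=> t ht.
  change (wtr (wmul (cls N s) (cls N t)) = wtr (wmul (cls N t) (cls N s))).
  rewrite (wmul_cls hs ht) (wmul_cls ht hs).
  apply: ctends_uniq (wtr_cls (gmul_cauchy hs ht)) _.
  have := wtr_cls (gmul_cauchy ht hs); congr ctends.
  by apply/funext => n /=; rewrite gtrC.
- move=> g /=; apply: ctends_uniq (wtr_cls (cauchyseq_cst _ _)) _.
  rewrite -gtr_delta; exact: seq_close_refl.
Qed.

End MaximalGroupCstar.

(** * Averaging over cyclic groups of prime order *)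

Section HeisenbergRelations.
Variables (G : groupType) (a b z : G).
Hypothesis baz : (b * a = a * b * z)%g.
Hypothesis za : commute z a.
Hypothesis zb : commute z b.

Lemma heis_swap (k c : nat) : (b ^+ k * a ^+ c = a ^+ c * b ^+ k * z ^+ (k * c))%g.
Proof.
have step d : (b * a ^+ d = a ^+ d * b * z ^+ d)%g.
  elim: d => [|d IH]; first by rewrite !expg0 !mulg1 mul1g.
  rewrite expgSr mulgA IH -2!mulgA.
  have -> : (z ^+ d * a = a * z ^+ d)%g by exact/esym/commuteX/commute_sym.
  by rewrite -(mulgA _ b) (mulgA b a) baz -!mulgA -expgS.
elim: k => [|k IH]; first by rewrite mul0n !expg0 mul1g !mulg1.
rewrite expgSr -mulgA step.
rewrite !mulgA IH -!mulgA; congr (_ * (_ * _))%g.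
rewrite mulgA (_ : z ^+ (k * c) * b = b * z ^+ (k * c))%g; last exact/esym/commuteX/commute_sym.
by rewrite -mulgA -expgnDr mulSn addnC.
Qed.

Lemma heis_center_expn p : (b ^+ p = 1)%g -> (z ^+ p = 1)%g.
Proof.
move=> bp; have := heis_swap p 1; rewrite bp mul1g mulg1 muln1 => h.
by apply: (mulgI (a ^+ 1)%g); rewrite mulg1 -h.
Qed.

End HeisenbergRelations.

Section Averages.
Variables (R : realType) (G : groupType) (W : lmodType R[i]) (rho : G -> W -> W).
Hypothesis rhoP : forall g, linear (rho g).
Hypothesis rho1 : forall x, rho 1%g x = x.
Hypothesis rhoM : forall g h x, rho (g * h)%g x = rho g (rho h x).
Variable p : nat.
Hypothesis p_pr : prime p.
Implicit Types (g h : G) (x y : W).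

Local Notation tau := (p%:R^-1 : R).

(** For g of order p acting unitarily, the orthogonal projection to the vectors
    fixed by g. *)
Definition avg g x : W := tau%:C *: \sum_(k < p) rho (g ^+ k)%g x.

Lemma tau_p : tau%:C * p%:R = 1 :> R[i].
Proof.
have -> : (p%:R : R[i]) = (p%:R)%:C by rewrite rmorph_nat.
by rewrite -rmorphM /= mulVf // pnatr_eq0 -lt0n prime_gt0.
Qed.

Lemma tau_sum_cst x : tau%:C *: \sum_(k < p) x = x.
Proof. by rewrite sumr_const card_ord -[x *+ p]scaler_nat scalerA tau_p scale1r. Qed.

Lemma rhoD g x y : rho g (x + y) = rho g x + rho g y.
Proof. by rewrite -[x in LHS]scale1r rhoP scale1r. Qed.
Lemma rho0 g : rho g 0 = 0.
Proof. by have := rhoP g (-1) 0 0; rewrite scaler0 addr0 scaleN1r addNr. Qed.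
Lemma rhoZ g c x : rho g (c *: x) = c *: rho g x.
Proof. by have := rhoP g c x 0; rewrite rho0 !addr0. Qed.
Lemma rhoB g x y : rho g (x - y) = rho g x - rho g y.
Proof. by rewrite rhoD -scaleN1r rhoZ scaleN1r. Qed.
Lemma rho_sum g (I : finType) (F : I -> W) :
  rho g (\sum_i F i) = \sum_i rho g (F i).
Proof. exact: (big_morph _ (rhoD g) (rho0 g)). Qed.

Lemma avgP g c x y : avg g (c *: x + y) = c *: avg g x + avg g y.
Proof.
rewrite /avg; under eq_bigr do rewrite rhoP.
by rewrite big_split -scaler_sumr scalerDr !scalerA mulrC.
Qed.
Lemma avgD g x y : avg g (x + y) = avg g x + avg g y.
Proof. by rewrite -[x in LHS]scale1r avgP scale1r. Qed.
Lemma avg0 g : avg g 0 = 0.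
Proof. by have := avgP g (-1) 0 0; rewrite scaler0 addr0 scaleN1r addNr. Qed.
Lemma avgB g x y : avg g (x - y) = avg g x - avg g y.
Proof. by rewrite addrC -scaleN1r avgP scaleN1r addrC. Qed.
Lemma avgZ g c x : avg g (c *: x) = c *: avg g x.
Proof. by have := avgP g c x 0; rewrite avg0 !addr0. Qed.

Lemma avg_id g x : rho g x = x -> avg g x = x.
Proof.
move=> gx; rewrite -[RHS]tau_sum_cst; congr (_ *: _); apply: eq_bigr => k _.
by elim: (k : nat) => [|j IH]; [rewrite expg0 rho1 | rewrite expgS rhoM IH].
Qed.

Lemma rho_avgC g h x : commute h g -> rho h (avg g x) = avg g (rho h x).
Proof.
move=> hg; rewrite /avg rhoZ rho_sum; congr (_ *: _); apply: eq_bigr => k _.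
by rewrite -!rhoM (commuteX k hg).
Qed.

Lemma rho_avg g x : (g ^+ p = 1)%g -> rho g (avg g x) = avg g x.
Proof.
move=> gp; rewrite /avg rhoZ rho_sum; congr (_ *: _).
under eq_bigr do rewrite -rhoM -expgS.
move: gp; case: p => [|n] gp; first by rewrite !big_ord0.
by rewrite big_ord_recr big_ord_recl /= gp expg0 addrC.
Qed.

Lemma avg_rho g x : (g ^+ p = 1)%g -> avg g (rho g x) = avg g x.
Proof. by move=> gp; rewrite -rho_avgC ?rho_avg //; exact: commute_refl. Qed.

Lemma avg_rhoX g k x : (g ^+ p = 1)%g -> avg g (rho (g ^+ k)%g x) = avg g x.
Proof.
move=> gp; elim: k x => [|k IH] x; first by rewrite expg0 rho1.
by rewrite expgSr rhoM IH avg_rho.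
Qed.

Lemma avg_idem g x : (g ^+ p = 1)%g -> avg g (avg g x) = avg g x.
Proof. by move=> gp; rewrite avg_id // rho_avg. Qed.

Lemma avgC g h x : commute g h -> avg g (avg h x) = avg h (avg g x).
Proof.
move=> gh; rewrite /avg; rewrite [in LHS](eq_bigr _ (fun k _ => rhoZ _ _ _)).
rewrite [in RHS](eq_bigr _ (fun k _ => rhoZ _ _ _)) -!scaler_sumr !scalerA.
congr (_ *: _); under eq_bigr do rewrite rho_sum.
under [RHS]eq_bigr do rewrite rho_sum.
rewrite exchange_big; apply: eq_bigr => k _; apply: eq_bigr => l _.
by rewrite -!rhoM; congr (rho _ x); exact: commuteX2.
Qed.

Lemma rho_fixX g k x : rho g x = x -> rho (g ^+ k)%g x = x.
Proof. by move=> gx; elim: k => [|k IH]; rewrite ?expg0 ?rho1 // expgS rhoM IH. Qed.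

(** The powers z ^ k with k prime to p generate the same group as z. *)
Lemma avg_expn z k x : (z ^+ p = 1)%g -> (0 < k < p)%N -> avg (z ^+ k)%g x = avg z x.
Proof.
move=> zp /andP[k0 kp].
have zkp : ((z ^+ k) ^+ p = 1)%g by rewrite -expgnA mulnC expgnA zp expg1n.
have cz : commute z (z ^+ k)%g by exact/commuteX/commute_refl.
have [u [v uv]] : exists u v, (k * u = p * v + 1)%N.
  have kpc : coprime k p by rewrite coprime_sym prime_coprime // gtnNdvd.
  have [u v uv _] := egcdnP p k0.
  by exists u, v; rewrite mulnC uv mulnC (eqP kpc).
have z_u : ((z ^+ k) ^+ u = z)%g.
  by rewrite -expgnA uv expgnDr expgnA zp expg1n mul1g expg1.
have fixz : rho z (avg (z ^+ k)%g x) = avg (z ^+ k)%g x.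
  by rewrite -{1}z_u; apply: rho_fixX; exact: rho_avg.
rewrite -(avg_id fixz) avgC // avg_id //; apply: rho_fixX; exact: rho_avg.
Qed.

Section Heisenberg.
Variables a b z : G.
Hypothesis baz : (b * a = a * b * z)%g.
Hypothesis za : commute z a.
Hypothesis zb : commute z b.
Hypothesis ap : (a ^+ p = 1)%g.
Hypothesis bp : (b ^+ p = 1)%g.

Let zp : (z ^+ p = 1)%g := heis_center_expn baz za zb bp.

(** On vectors fixed by z the actions of a and b commute. *)
Lemma avg_commute_center x :
  avg a (avg b (avg z x)) = avg b (avg a (avg z x)).
Proof.
have fz k : rho (z ^+ k)%g (avg z x) = avg z x by apply: rho_fixX; exact: rho_avg.
set y := avg z x in fz *.
rewrite /avg; rewrite [in LHS](eq_bigr _ (fun k _ => rhoZ _ _ _)).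
rewrite [in RHS](eq_bigr _ (fun k _ => rhoZ _ _ _)) -!scaler_sumr !scalerA.
congr (_ *: _); under eq_bigr do rewrite rho_sum.
under [RHS]eq_bigr do rewrite rho_sum.
rewrite exchange_big; apply: eq_bigr => k _; apply: eq_bigr => l _.
by rewrite -[RHS]rhoM (heis_swap baz za zb) [RHS]rhoM fz rhoM.
Qed.

(** On the complement the two averages make a small angle: conjugation by a
    spreads b over the centre, so only the trivial power of b survives. *)
Lemma avg_sandwich x : avg z x = 0 -> avg a (avg b (avg a x)) = tau%:C *: avg a x.
Proof.
move=> zx.
have term (k : 'I_p) :
    avg a (rho (b ^+ k)%g (avg a x)) = if k == 0 :> nat then avg a x else 0.
  have -> : avg a (rho (b ^+ k)%g (avg a x)) = avg a (rho (b ^+ k)%g (avg (z ^+ k)%g x)).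
    rewrite [X in rho _ X]/avg rhoZ rho_sum avgZ.
    rewrite [X in _ = avg a (rho _ X)]/avg rhoZ rho_sum avgZ; congr (_ *: _).
    rewrite !(big_morph _ (avgD a) (avg0 a)); apply: eq_bigr => c _.
    by rewrite -[rho _ (rho (a ^+ c)%g x)]rhoM (heis_swap baz za zb) -mulgA rhoM avg_rhoX // rhoM expgnA.
  have [k0|k0] := eqVneq (k : nat) 0%N.
    by rewrite k0 !expg0 rho1 (avg_id (rho1 _)).
  by rewrite avg_expn ?zp // ?lt0n ?k0 ?ltn_ord // zx rho0 avg0.
rewrite [X in avg a X]/avg avgZ (big_morph _ (avgD a) (avg0 a)); congr (_ *: _).
rewrite (eq_bigr _ (fun k _ => term k)).
have p0 := prime_gt0 p_pr; rewrite (bigD1 (Ordinal p0)) //= big1 ?addr0 // => k.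
by rewrite -val_eqE /= => /negbTE ->.
Qed.

End Heisenberg.

End Averages.

(** * Averages in a unitary action *)

(** Two projections p, q with p q p = e^2 p and q p q = e^2 q, seen on a vector
    y through s = p y and t = q y: an angle bound for the orthogonal
    complements. The hypotheses are the positivity of the squared norms of
    (1 - e^2) y - (s - q s) - (t - p t) and of e s - p t. *)
Lemma gram_angle (F : realFieldType) (e X sg th kp : F) : 0 < e -> e < 1 ->
  0 <= (1 - e ^+ 2) * X - (sg + th - 2 * kp) ->
  0 <= e ^+ 2 * (sg + th) - 2 * e * kp ->
  - (e / 2) * ((X - sg) + (X - th)) <= X - sg - th + kp.
Proof.
move=> e0 e1 N1 N2.
have N2' : 2 * kp <= e * (sg + th).
  by rewrite -(ler_pM2l e0); lra.
rewrite -subr_ge0 -(pmulr_rge0 _ (_ : 0 < 1 - e)); last lra.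
have e1' : 0 < 1 + e by lra.
have := mulr_ge0 (ltW e1') (_ : 0 <= e * (sg + th) - 2 * kp).
move=> /(_ ltac:(lra)) N3; lra.
Qed.

Section UnitaryAverages.
Variables (R : realType) (G : groupType) (V : lmodType R[i]) (B : hform V).
Variable pi : G -> V -> V.
Hypothesis piP : forall g, linear (pi g).
Hypothesis pi1 : forall x, pi 1%g x = x.
Hypothesis piM : forall g h x, pi (g * h)%g x = pi g (pi h x).
Hypothesis pi_iso : forall g x y, B (pi g x) (pi g y) = B x y.
Variable p : nat.
Hypothesis p_pr : prime p.
Implicit Types (g h : G) (x y : V).

Local Notation pr := (avg pi p).
Local Notation tau := (p%:R^-1 : R).

Lemma pi_rform g x y : rform B (pi g x) (pi g y) = rform B x y.
Proof. by rewrite /rform pi_iso. Qed.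

Lemma rform_sumr (I : finType) (F : I -> V) x :
  rform B x (\sum_i F i) = \sum_i rform B x (F i).
Proof. exact: (big_morph _ (fun y z => rformDr B y z x) (rform0r B x)). Qed.

Lemma rformBl x y z : rform B (x - y) z = rform B x z - rform B y z.
Proof. by rewrite rformDl rformNl. Qed.
Lemma rformBr x y z : rform B z (x - y) = rform B z x - rform B z y.
Proof. by rewrite rformDr rformNr. Qed.

Lemma avg_selfadj1 g x y : (g ^+ p = 1)%g ->
  rform B (pr g x) (pr g y) = rform B (pr g x) y.
Proof.
move=> gp; rewrite [X in rform B _ X]/avg rformZr rform_sumr.
have fx := rho_avg piP piM x gp.
rewrite (eq_bigr (fun=> rform B (pr g x) y)); last first.
  move=> k _; rewrite -[X in rform B X _](rho_fixX pi1 piM k fx) pi_rform //.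
rewrite sumr_const card_ord -[X in _ * X]mulr_natl mulrA mulVf ?mul1r //.
by rewrite pnatr_eq0 -lt0n prime_gt0.
Qed.

Lemma avg_selfadj g x y : (g ^+ p = 1)%g ->
  rform B (pr g x) y = rform B x (pr g y).
Proof.
by move=> gp; rewrite -avg_selfadj1 // rformC avg_selfadj1 // rformC.
Qed.

(** Pythagoras for the decomposition of x by the projection of g. *)
Lemma compl_norm g x : (g ^+ p = 1)%g ->
  rform B (x - pr g x) (x - pr g x) = rform B x x - rform B (pr g x) (pr g x).
Proof.
move=> gp; rewrite !(rformBl, rformBr) (avg_selfadj1 _ _ gp).
by rewrite (rformC _ x (pr g x)); lra.
Qed.

Lemma compl_norm_le g x : (g ^+ p = 1)%g ->
  rform B (x - pr g x) (x - pr g x) <= rform B x x.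
Proof. by move=> gp; rewrite compl_norm // lerBlDr lerDl rform_ge0. Qed.

Section Angle.
Variables a b z : G.
Hypothesis baz : (b * a = a * b * z)%g.
Hypothesis za : commute z a.
Hypothesis zb : commute z b.
Hypothesis ap : (a ^+ p = 1)%g.
Hypothesis bp : (b ^+ p = 1)%g.
Variable e : R.
Hypothesis e0 : 0 < e.
Hypothesis e1 : e < 1.
Hypothesis ee : e ^+ 2 = tau.

Let zp : (z ^+ p = 1)%g := heis_center_expn baz za zb bp.

Let abz : (a * b = b * a * z^-1)%g.
Proof. by rewrite baz mulgK. Qed.

(** Off the fixed vectors of z the sandwich identity holds in both orders, as z^-1
    generates the same group as z; this is the case of [gram_angle]. *)
Lemma angle_off_center y : pr z y = 0 ->
  - (e / 2) * (rform B (y - pr a y) (y - pr a y) + rform B (y - pr b y) (y - pr b y))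
    <= rform B (y - pr a y) (y - pr b y).
Proof.
move=> zy.
have zVy : pr z^-1%g y = 0.
  have p0 := prime_gt0 p_pr; have p1 := prime_gt1 p_pr.
  have -> : (z^-1 = z ^+ p.-1)%g.
    by apply/eqP; rewrite -(inj_eq (mulgI z)) mulgV -expgS prednK // zp.
  by rewrite (avg_expn piP pi1 piM p_pr) // -ltnS prednK // p1 /=.
have sa := avg_sandwich piP pi1 piM p_pr baz za zb ap bp zy.
have sb := avg_sandwich piP pi1 piM p_pr abz
  (commute_sym (commuteV (commute_sym zb))) (commute_sym (commuteV (commute_sym za))) bp ap zVy.
set s := pr a y in sa *; set t := pr b y in sb *.
set s' := pr b s in sa; set t' := pr a t in sb.
have as_ : pr a s = s by exact: avg_idem.
have bt_ : pr b t = t by exact: avg_idem.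
pose X := rform B y y; pose sg := rform B s s; pose th := rform B t t.
pose kp := rform B s t.
have ys : rform B y s = sg by rewrite -as_ -avg_selfadj //.
have yt : rform B y t = th by rewrite -bt_ -avg_selfadj //.
have st : rform B s t = kp by [].
have ys' : rform B y s' = kp by rewrite -avg_selfadj // rformC.
have yt' : rform B y t' = kp by rewrite -avg_selfadj.
have st' : rform B s t' = kp by rewrite -avg_selfadj // as_.
have ts' : rform B t s' = kp by rewrite -avg_selfadj // bt_ rformC.
have ss' : rform B s s' = tau * sg.
  by rewrite -{1}as_ avg_selfadj // sa rformZr.
have tt' : rform B t t' = tau * th.
  by rewrite -{1}bt_ avg_selfadj // sb rformZr.
have s's' : rform B s' s' = tau * sg by rewrite avg_selfadj1 // rformC.
have t't' : rform B t' t' = tau * th by rewrite avg_selfadj1 // rformC.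
have s't' : rform B s' t' = tau * kp.
  by rewrite -avg_selfadj // sa rformZl.
rewrite !compl_norm // -/s -/t -/sg -/th -/X.
rewrite !(rformBl, rformBr) -/X yt st (rformC _ s y) ys.
clear sa sb as_ bt_; clearbody s' t' s t.
have -> : X - th - (sg - kp) = X - sg - th + kp by lra.
have C := rformC B.
apply: gram_angle => //; rewrite ee.
  have := rform_ge0 B ((1 - tau)%:C *: y - ((s - s') + (t - t'))).
  rewrite !(rformBl, rformBr, rformDl, rformDr, rformZl, rformZr).
  rewrite (C s y) (C t y) (C s' y) (C t' y) (C t s) (C s' s) (C t' s) (C t' t) (C s' t) (C t' s').
  rewrite ys yt ys' yt' ss' tt' st' ts' s's' t't' s't' -/X -/sg -/th -/kp => h.
  have t1 : 0 < 1 - tau by rewrite -ee subr_gt0 expr_lt1 ?ltW.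
  rewrite -(pmulr_rge0 _ t1); move: h; lra.
have := rform_ge0 B (e%:C *: s - t').
rewrite !(rformBl, rformBr, rformZl, rformZr) (C t' s) st' t't' -/sg.
by rewrite -ee; lra.
Qed.

(** Split y by the projection of z. On the part fixed by z the two complementary
    projections commute, so that their product is positive; the other part is
    [angle_off_center]; the two are orthogonal. *)
Lemma angle y :
  - (e / 2) * (rform B (y - pr a y) (y - pr a y) + rform B (y - pr b y) (y - pr b y))
    <= rform B (y - pr a y) (y - pr b y).
Proof.
set y0 := pr z y; set y1 := y - y0.
have zy0 : pr z y0 = y0 by exact: avg_idem.
have zy1 : pr z y1 = 0 by rewrite /y1 (avgB piP) zy0 subrr.
have comm_ : pr a (pr b y0) = pr b (pr a y0).
  exact: (avg_commute_center piP pi1 piM baz za zb bp y).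
have yE : y = y0 + y1 by rewrite /y1 addrC subrK.
clearbody y1 y0; subst y.
have split_ c : commute c z -> y0 + y1 - pr c (y0 + y1) = (y0 - pr c y0) + (y1 - pr c y1) /\
    (pr z (y0 - pr c y0) = y0 - pr c y0 /\ pr z (y1 - pr c y1) = 0).
  move=> cz; split.
    by rewrite addrACA -opprD -(avgD piP).
  rewrite !(avgB piP) !(avgC piP piM _ _ (commute_sym cz)) zy0 zy1.
  by rewrite (avg0 piP) subr0.
have [-> [a0 a1]] := split_ a (commute_sym za).
have [-> [b0 b1]] := split_ b (commute_sym zb).
have orth u v : pr z u = u -> pr z v = 0 -> rform B u v = 0.
  by move=> <- zv; rewrite avg_selfadj // zv rform0r.
have off := angle_off_center zy1.
set u0 := y0 - pr a y0 in a0 *; set u1 := y1 - pr a y1 in a1 off *.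
set v0 := y0 - pr b y0 in b0 *; set v1 := y1 - pr b y1 in b1 off *.
have pos : 0 <= rform B u0 v0.
  have qu x c : (c ^+ p = 1)%g -> rform B (x - pr c x) v0 = rform B x (v0 - pr c v0).
    by move=> cp; rewrite rformBl rformBr avg_selfadj.
  have E : v0 - pr a v0 = u0 - pr b u0.
    rewrite /u0 /v0 !(avgB piP) comm_ !opprB.
    by rewrite addrACA [RHS]addrACA [X in _ + X = _]addrC.
  have -> : rform B u0 v0 = rform B (u0 - pr b u0) (u0 - pr b u0).
    have bv0 : pr b v0 = 0 by rewrite /v0 (avgB piP) avg_idem // subrr.
    have aE : pr a (u0 - pr b u0) = 0.
      by rewrite -E (avgB piP) avg_idem // subrr.
    have bE : pr b (u0 - pr b u0) = 0 by rewrite (avgB piP) avg_idem // subrr.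
    rewrite [RHS]rformBl (avg_selfadj _ _ bp) bE rform0r subr0 -E.
    rewrite [RHS]rformBr; have -> : rform B u0 (pr a v0) = 0; last by rewrite subr0.
    by rewrite -avg_selfadj // /u0 (avgB piP) avg_idem // subrr rform0l.
  exact: rform_ge0.
clear comm_; clearbody u0 u1 v0 v1.
rewrite !(rformDl, rformDr) (orth u0 v1) // (orth u0 u1) //.
rewrite (rformC _ u1 v0) (orth v0 u1) // (rformC _ u1 u0) (orth u0 u1) //.
rewrite (rformC _ v1 v0) (orth v0 v1) //.
have := rform_ge0 B u0; have := rform_ge0 B v0.
have := mulr_ge0 (ltW e0) (rform_ge0 B u0); have := mulr_ge0 (ltW e0) (rform_ge0 B v0).
move: pos off; lra.
Qed.

End Angle.
End UnitaryAverages.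

(** * Property (T) from small angles *)

Section SmallAngles.
Variables (R : realType) (G : groupType) (I : finType) (s : I -> G) (p : nat).
Hypothesis p_pr : prime p.
Hypothesis sp : forall i, (s i ^+ p = 1)%g.
Hypothesis sz : forall i j, exists z,
  [/\ (s j * s i = s i * s j * z)%g, commute z (s i) & commute z (s j)].
Hypothesis sgen : forall P : G -> Prop, P 1%g ->
  (forall i g, P g -> P (s i * g)%g) -> forall g, P g.
Hypothesis I_gt0 : (0 < #|I|)%N.
Hypothesis p_large : (#|I|.-1 ^ 2 < p)%N.

Local Notation n := #|I|.

Section AffineAction.
Variables (V : lmodType R[i]) (B : hform V) (pi : G -> V -> V) (c : G -> V).
Hypothesis piP : forall g, linear (pi g).
Hypothesis pi1 : forall x, pi 1%g x = x.
Hypothesis piM : forall g h x, pi (g * h)%g x = pi g (pi h x).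
Hypothesis pi_iso : forall g x y, B (pi g x) (pi g y) = B x y.
Hypothesis cM : forall g h, c (g * h)%g = pi g (c h) + c g.

Local Notation W := (V * R[i]^o)%type.
Implicit Types (x : V) (g h : G) (i j : I).

(** The affine action x |-> pi g x + c g, made linear on V * C. *)
Definition affine_rho (g : G) (w : W) : W := (pi g w.1 + w.2 *: c g, w.2).

Lemma cocycle1 : c 1%g = 0.
Proof. by have := cM 1 1; rewrite mulg1 pi1 -{1}[c 1%g]add0r => /addIr. Qed.

Fact affine_rhoP g : linear (affine_rho g).
Proof.
by move=> a x y; congr pair; rewrite /= piP scalerDl scalerDr scalerA addrACA.
Qed.
Fact affine_rho1 w : affine_rho 1%g w = w.
Proof. by case: w => x r; rewrite /affine_rho /= pi1 cocycle1 scaler0 addr0. Qed.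
Fact affine_rhoM g h w : affine_rho (g * h)%g w = affine_rho g (affine_rho h w).
Proof.
by rewrite /affine_rho /= piM cM (rhoD piP) (rhoZ piP) scalerDr !addrA.
Qed.

Local Notation av := (avg affine_rho p).
Local Notation pr := (avg pi p).

Definition translation_part g : V := (av g (0, 1)).1.

(** Averages of the affine action are affine, with linear part the average of the
    linear action. *)
Lemma avE g w : av g w = (pr g w.1 + w.2 *: translation_part g, w.2).
Proof.
have E2 w' : (av g w').2 = w'.2.
  have -> : (av g w').2 = (p%:R^-1)%:C *: (\sum_(k < p) affine_rho (g ^+ k)%g w').2 by [].
  rewrite (big_morph snd (fun _ _ => erefl) erefl) /=.
  exact: (@tau_sum_cst R R[i]^o p p_pr).
have E0 x : (av g (x, 0)).1 = pr g x.
  have -> : (av g (x, 0)).1 = (p%:R^-1)%:C *: (\sum_(k < p) affine_rho (g ^+ k)%g (x, 0)).1.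
    by [].
  rewrite (big_morph fst (fun _ _ => erefl) erefl) /=.
  by congr (_ *: _); apply: eq_bigr => k _; rewrite scale0r addr0.
rewrite [LHS]surjective_pairing E2; congr pair.
have wE : w = (w.2 : R[i]) *: ((0, 1) : W) + (w.1, 0).
  case: w => x r; congr pair => /=; first by rewrite scaler0 add0r.
  by rewrite addr0 [RHS]mulr1.
rewrite -E0 addrC {1}wE (avgP affine_rhoP) /translation_part.
by move: (av g (0, 1)) (av g (w.1, 0)) => u v.
Qed.

(** The affine projection of x on the fixed points of s i, and the vector from
    there to x. *)
Definition pfix i (x : V) : V := (av (s i) (x, 1)).1.
Definition dfix i (x : V) : V := x - pfix i x.

Lemma av1 g x : av g (x, 1) = ((av g (x, 1)).1, 1).
Proof. by rewrite [LHS]avE [in RHS]avE. Qed.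

Lemma dfix_shift i x (h : V) : dfix i (x + h) = dfix i x + (h - pr (s i) h).
Proof.
rewrite /dfix /pfix !avE /= (avgD piP) !scale1r; move: (translation_part _) => t.
by rewrite (addrAC (pr _ x)) opprD addrACA.
Qed.

(** The composite of the averages over s i, s j and the central z projects to the
    common fixed points: below the average over z the other two commute. *)
Lemma common_fixpoint i j x : exists o, dfix i o = 0 /\ dfix j o = 0.
Proof.
have [z [E zi zj]] := sz i j.
pose O := av (s i) (av (s j) (av z (x, 1))).
have Oi : av (s i) O = O by apply: (avg_idem affine_rhoP affine_rho1 affine_rhoM p_pr).
have Oj : av (s j) O = O.
  rewrite /O (avg_commute_center affine_rhoP affine_rho1 affine_rhoM E zi zj (sp j)).
  by apply: (avg_idem affine_rhoP affine_rho1 affine_rhoM p_pr).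
have OE : O = (O.1, 1) by rewrite /O !avE.
exists O.1; rewrite /dfix /pfix -OE Oi Oj; split; exact: subrr.
Qed.

Definition eps : R := Num.sqrt p%:R^-1.

Lemma eps_sqr : eps ^+ 2 = p%:R^-1.
Proof. by rewrite sqr_sqrtr // invr_ge0. Qed.
Lemma eps_gt0 : 0 < eps.
Proof. by rewrite sqrtr_gt0 invr_gt0 ltr0n prime_gt0. Qed.
Lemma eps_lt1 : eps < 1.
Proof.
rewrite -(ltr_pXn2r (n := 2)) ?nnegrE ?ltW ?eps_gt0 // eps_sqr expr1n.
by rewrite invf_lt1 ?ltr1n ?prime_gt1 // ltr0n prime_gt0.
Qed.

(** Around a common fixed point of s i and s j the affine action is linear. *)
Lemma dfix_angle i j x :
  - (eps / 2) * (rform B (dfix i x) (dfix i x) + rform B (dfix j x) (dfix j x))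
    <= rform B (dfix i x) (dfix j x).
Proof.
have [y [yi yj]] := common_fixpoint i j x; have [z [E zi zj]] := sz i j.
have xE : x = y + (x - y) by rewrite addrC subrK.
rewrite xE !dfix_shift yi yj !add0r.
exact: (angle piP pi1 piM pi_iso p_pr E zi zj (sp i) (sp j) eps_gt0 eps_lt1 eps_sqr).
Qed.

Lemma avg_dfix i x : pr (s i) (dfix i x) = 0.
Proof.
have [y [yi _]] := common_fixpoint i i x.
have xE : x = y + (x - y) by rewrite addrC subrK.
rewrite xE dfix_shift yi add0r (avgB piP).
by rewrite (avg_idem piP pi1 piM p_pr) // subrr.
Qed.

(** The sum of the squared distances of x to the fixed points of the generators;
    up to a factor 2 its gradient is [grad]. *)
Definition energy x : R := \sum_i rform B (dfix i x) (dfix i x).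
Definition grad x : V := \sum_i dfix i x.
Definition descent x : V := x - (n%:R^-1)%:C *: grad x.

Lemma dfix_energy i x : rform B (dfix i x) (dfix i x) <= energy x.
Proof.
by rewrite /energy (bigD1 i) //= lerDl; apply: sumr_ge0 => j _; exact: rform_ge0.
Qed.

Lemma hnorm_dfix i x : hnorm B (dfix i x) <= Num.sqrt (energy x).
Proof. exact/ler_wsqrtr/dfix_energy. Qed.

(** Expand the square of the sum: the off-diagonal terms are controlled by
    [dfix_angle]. *)
Lemma grad_lower x : (1 - n.-1%:R * eps) * energy x <= rform B (grad x) (grad x).
Proof.
have -> : rform B (grad x) (grad x) =
    \sum_i \sum_j rform B (dfix i x) (dfix j x).
  rewrite {1}/grad rformC rform_sumr; apply: eq_bigr => i _.
  by rewrite rformC rform_sumr.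
pose E i := rform B (dfix i x) (dfix i x).
have row i : E i - (eps / 2) * (n.-1%:R * E i + (energy x - E i))
    <= \sum_j rform B (dfix i x) (dfix j x).
  rewrite (bigD1 i) //= lerD2l /energy (bigD1 i) //= [X in X - E i]addrC addrK.
  have -> : n.-1%:R * E i = \sum_(j | j != i) E i.
    rewrite sumr_const mulr_natl; congr (_ *+ _).
    by rewrite -(cardC1 i); apply: eq_card => j; rewrite !inE.
  rewrite -big_split /= mulr_sumr -sumrN; apply: ler_sum => j _.
  by rewrite -mulNr; exact: dfix_angle.
apply: le_trans (ler_sum _ (fun i _ => row i)).
rewrite big_split /= sumrN -mulr_sumr big_split /= -mulr_sumr big_split /= sumrN.
rewrite sumr_const -/(energy x) -[energy x *+ _]mulr_natl.
have -> : #|{: I}|%:R = n.-1%:R + 1 :> R by rewrite natr1 prednK.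
by rewrite -/(energy x); lra.
Qed.

Lemma grad_le x : hnorm B (grad x) <= n%:R * Num.sqrt (energy x).
Proof.
have -> : n%:R * Num.sqrt (energy x) = \sum_(i : I) Num.sqrt (energy x).
  by rewrite sumr_const mulr_natl.
rewrite /grad; elim/big_rec2: _ => [|i a u _ IH]; first by rewrite hnorm0.
by apply: le_trans (hnormD _ _ _) (lerD (hnorm_dfix i x) IH).
Qed.

(** The step 1 / n makes the quadratic term cancel half of the linear one. *)
Lemma descent_energy x :
  energy (descent x) <= (1 - (1 - n.-1%:R * eps) / n%:R) * energy x.
Proof.
have n0 : 0 < n%:R :> R by rewrite ltr0n.
pose l : R := n%:R^-1; have l0 : 0 < l by rewrite invr_gt0.
set g := grad x.
have term i : rform B (dfix i (descent x)) (dfix i (descent x)) <=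
    rform B (dfix i x) (dfix i x) - 2 * l * rform B g (dfix i x) + l ^+ 2 * rform B g g.
  rewrite /descent -/g -scaleN1r scalerA -(rmorphN1 (real_complex R)) -rmorphM mulN1r /=.
  rewrite dfix_shift (avgZ piP) -scalerBr.
  have := compl_norm_le piP pi1 piM pi_iso p_pr g (sp i).
  have -> : rform B g (dfix i x) = rform B (g - pr (s i) g) (dfix i x).
    rewrite rformBl (avg_selfadj piP pi1 piM pi_iso p_pr) //.
    by rewrite avg_dfix rform0r subr0.
  move: (dfix i x) (g - pr _ g) => d q; rewrite -/l => qg.
  rewrite !(rformDl, rformDr, rformZl, rformZr) (rformC _ d q).
  have := ler_wpM2l (sqr_ge0 l) qg; lra.
apply: le_trans (ler_sum _ (fun i _ => term i)) _.
rewrite !big_split /= sumrN -mulr_sumr -rform_sumr -/(grad x) -/g -/(energy x).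
have -> : \sum_(i : I) l ^+ 2 * rform B g g = l * rform B g g.
  rewrite sumr_const -[LHS]mulr_natl mulrA expr2 mulrA [n%:R * l]mulfV ?mul1r //.
  by rewrite gt_eqF.
have := ler_wpM2l (ltW l0) (grad_lower x); rewrite -/g -/l.
lra.
Qed.

Lemma descent_dist x : hnorm B (descent x) <= hnorm B x + Num.sqrt (energy x).
Proof.
apply: le_trans (hnormD _ _ _) _; rewrite lerD2l -scaleN1r !hnormZ cabsN cabs1 mul1r.
rewrite cabs_real ger0_norm ?invr_ge0 // ler_pdivrMl ?ltr0n //; exact: grad_le.
Qed.

(** A point of small energy is moved little by every group element, with a
    constant that grows with its word length. *)
Lemma displacement g : exists2 L : R, 0 <= L & forall x,
  hnorm B (pi g x + c g - x) <= L * Num.sqrt (energy x).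
Proof.
elim/sgen: g => [|i g [L L0 IH]].
  by exists 0 => // x; rewrite pi1 cocycle1 addr0 subrr hnorm0 mul0r.
exists (L + 2) => [|x]; first lra.
have fixed : pi (s i) (pfix i x) + c (s i) = pfix i x.
  have := congr1 fst (rho_avg affine_rhoP affine_rhoM (x, 1) (sp i)).
  rewrite av1 -/(pfix i x); move: (pfix i x) => q.
  by rewrite /affine_rho /= scale1r.
have cs : c (s i) = pfix i x - pi (s i) (pfix i x) by rewrite -{1}fixed addrAC subrr add0r.
have -> : pi (s i * g)%g x + c (s i * g)%g - x =
    pi (s i) (pi g x + c g - x) + (pi (s i) (dfix i x) - dfix i x).
  rewrite piM cM cs !(rhoB piP) !(rhoD piP) /dfix.
  move: (pi (s i) (pi g x)) (pi (s i) (c g)) (pi (s i) x) (pfix i x) (pi _ (pfix i x)).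
  by move=> a1 a2 a3 q1 q2; rewrite !addrA subrK opprB !addrA (addrAC _ q1).
have isom y : hnorm B (pi (s i) y) = hnorm B y by rewrite /hnorm /rform pi_iso.
apply: le_trans (hnormD _ _ _) _; rewrite isom.
have := hnormD B (pi (s i) (dfix i x)) (- dfix i x).
rewrite isom -scaleN1r hnormZ cabsN cabs1 mul1r.
have := IH x; have := hnorm_dfix i x; rewrite mulrDl scaleN1r; lra.
Qed.

(** The fixed point of s i closest to 0 is the mean of the c (s i ^ k), k < p. *)
Lemma energy0 K : 0 <= K -> (forall i, hnorm B (c (s i)) <= K) ->
  Num.sqrt (energy 0) <= n%:R * p%:R * K.
Proof.
move=> K0 cK.
have pK0 : 0 <= p%:R * K by rewrite mulr_ge0.
have cX i k : hnorm B (c (s i ^+ k)%g) <= k%:R * K.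
  elim: k => [|k IH]; first by rewrite expg0 cocycle1 hnorm0 mul0r.
  rewrite expgS cM; apply: le_trans (hnormD _ _ _) _.
  rewrite {1}/hnorm {1}/rform pi_iso -/(rform _ _ _) -/(hnorm _ _).
  by have := cK i; rewrite -natr1 mulrDl mul1r; lra.
have d0 i : hnorm B (dfix i 0) <= p%:R * K.
  rewrite /dfix sub0r -scaleN1r hnormZ cabsN cabs1 mul1r.
  have -> : pfix i 0 = (p%:R^-1)%:C *: \sum_(k < p) c (s i ^+ k)%g.
    rewrite /pfix; have -> : (av (s i) (0, 1)).1 =
      (p%:R^-1)%:C *: (\sum_(k < p) affine_rho (s i ^+ k)%g (0, 1)).1 by [].
    rewrite (big_morph fst (fun _ _ => erefl) erefl) /=; congr (_ *: _).
    by apply: eq_bigr => k _; rewrite (rho0 piP) add0r scale1r.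
  have p0 : 0 < p%:R :> R by rewrite ltr0n prime_gt0.
  rewrite hnormZ cabs_real ger0_norm ?invr_ge0 // ler_pdivrMl //.
  have -> : p%:R * (p%:R * K) = \sum_(k < p) p%:R * K.
    by rewrite sumr_const card_ord mulr_natl.
  elim/big_rec2: _ => [|k a u _ IH]; first by rewrite hnorm0.
  apply: le_trans (hnormD _ _ _) (lerD _ IH); apply: le_trans (cX _ _) _.
  by apply: ler_wpM2r => //; rewrite ler_nat ltnW.
have nK : 0 <= n%:R * p%:R * K by rewrite -mulrA mulr_ge0.
rewrite -[leRHS](ger0_norm nK) -sqrtr_sqr ler_wsqrtr // /energy.
apply: le_trans (_ : _ <= \sum_(i : I) (p%:R * K) ^+ 2) _.
  apply: ler_sum => i _; rewrite -hnorm_sqr ler_pXn2r ?nnegrE ?hnorm_ge0 //.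
rewrite sumr_const -[leLHS]mulr_natl -mulrA [leRHS]exprMn.
apply: ler_wpM2r; first exact: sqr_ge0.
by rewrite expr2 ler_peMl // ler1n.
Qed.

(** The factor by which a step contracts the square root of the energy; it is less
    than 1 because (n - 1)^2 < p. *)
Definition rate : R := Num.sqrt (1 - (1 - n.-1%:R * eps) / n%:R).

Lemma rate_lt1 : rate < 1.
Proof.
rewrite -[ltRHS]sqrtr1 ltr_sqrt // gtrBl divr_gt0 ?ltr0n // subr_gt0.
have ne : 0 <= n.-1%:R * eps by rewrite mulr_ge0 // ltW // eps_gt0.
rewrite -(ltr_pXn2r (n := 2)) ?nnegrE // exprMn eps_sqr expr1n.
by rewrite ltr_pdivrMr ?ltr0n ?prime_gt0 // mul1r -natrX ltr_nat.
Qed.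

(** Descend from 0 until the displacement by g, whose constant L depends on g, is
    at most the square root of the initial energy; the distance of that point to 0
    is bounded by a geometric series that does not depend on g. *)
Lemma cocycle_bound K : 0 <= K -> (forall i, hnorm B (c (s i)) <= K) ->
  forall g, hnorm B (c g) <= (1 + 2 / (1 - rate)) * (n%:R * p%:R) * K.
Proof.
move=> K0 cK g; set E0 := Num.sqrt (energy 0).
have r0 : 0 <= rate by exact: sqrtr_ge0.
have r1 := rate_lt1; have E00 : 0 <= E0 by exact: sqrtr_ge0.
pose x m := iter m descent 0.
have decay m : Num.sqrt (energy (x m)) <= rate ^+ m * E0.
  elim: m => [|m IH]; first by rewrite expr0 mul1r.
  rewrite exprS -mulrA; apply: le_trans (_ : _ <= rate * Num.sqrt (energy (x m))) _.
    rewrite /rate -sqrtrM; first exact/ler_wsqrtr/descent_energy.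
    have n1 : 1 <= n%:R :> R by rewrite ler1n.
    have ne : 0 <= n.-1%:R * eps by rewrite mulr_ge0 // ltW // eps_gt0.
    by rewrite subr_ge0 ler_pdivrMr ?ltr0n // mul1r; lra.
  exact: ler_wpM2l.
have norm_x m : hnorm B (x m) * (1 - rate) <= E0 * (1 - rate ^+ m).
  elim: m => [|m IH]; first by rewrite expr0 subrr mulr0 hnorm0 mul0r.
  have h := le_trans (descent_dist (x m)) (_ : _ <= hnorm B (x m) + rate ^+ m * E0).
  have := ler_wpM2r (_ : 0 <= 1 - rate) (h _); rewrite -/(x m.+1) exprS.
  move=> /(_ ltac:(lra) ltac:(by rewrite lerD2l)); lra.
have [L L0 hL] := displacement g.
have [m hm] : exists m, L * rate ^+ m <= 1.
  have rc : (fun m => rate ^+ m) @ \oo --> (0 : R) by apply: cvg_expr; rewrite ger0_norm.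
  have [m hm] := (cvgn_dist_le _ _).2 rc (L + 1)^-1 ltac:(rewrite invr_gt0; lra).
  exists m; have := hm m (leqnn _); rewrite sub0r normrN ger0_norm ?exprn_ge0 // => h.
  have L1 : 0 < L + 1 by lra.
  have := ler_wpM2l (ltW L1) h; rewrite mulfV ?gt_eqF //.
  have := exprn_ge0 m r0; lra.
have rm : 0 <= rate ^+ m by exact: exprn_ge0.
have cE : c g = (pi g (x m) + c g - x m) + (x m - pi g (x m)).
  by rewrite addrA subrK addrAC subrr add0r.
have hx : hnorm B (x m) <= E0 / (1 - rate).
  have r1' : 0 < 1 - rate by lra.
  rewrite ler_pdivlMr //; apply: le_trans (norm_x m) _.
  by have := mulr_ge0 E00 rm; lra.
have hd : hnorm B (pi g (x m) + c g - x m) <= E0.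
  apply: le_trans (hL _) _; apply: le_trans (ler_wpM2l L0 (decay m)) _.
  by rewrite mulrA; have := ler_wpM2r E00 hm; rewrite mul1r.
have hp : hnorm B (x m - pi g (x m)) <= 2 * hnorm B (x m).
  apply: le_trans (hnormD _ _ _) _; rewrite -scaleN1r hnormZ cabsN cabs1 mul1r.
  by rewrite [X in _ + X]/hnorm /rform pi_iso -/(rform _ _ _) -/(hnorm _ _); lra.
have bound : hnorm B (c g) <= (1 + 2 / (1 - rate)) * E0.
  rewrite cE; apply: le_trans (hnormD _ _ _) _; rewrite mulrDl mul1r.
  have -> : 2 / (1 - rate) * E0 = 2 * (E0 / (1 - rate)) by rewrite mulrAC mulrA.
  lra.
apply: le_trans bound _; rewrite -mulrA; apply: ler_wpM2l; last exact: energy0.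
by have : 0 < (1 - rate)^-1 by [rewrite invr_gt0; lra]; lra.
Qed.

End AffineAction.
End SmallAngles.

(** * Unitary representations and positive definite functions under small angles *)

Section PositiveDefinite.
Variables (R : realType) (G : groupType) (psi : G -> R).
Local Notation A := (free_module R[i] G).
Hypothesis psiV : forall g, psi g^-1%g = psi g.
Hypothesis psi_pd : forall (m : nat) (g : 'I_m -> G) (c : 'I_m -> R[i]),
  0 <= \sum_i \sum_j c i * conjc (c j) * (psi ((g j)^-1 * g i)%g)%:C.

(** The positive semidefinite form of the GNS construction, on the group algebra
    itself. *)
Definition gns (v w : A) : R[i] :=
  gext idfun (fun g => gext (@conjc R) (fun h => (psi (h^-1 * g)%g)%:C : R[i]^o) w
    : R[i]^o) v.

Fact gnsPl a x y z : gns (a *: x + y) z = a * gns x z + gns y z.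
Proof. exact: gextP. Qed.

Fact gnsPr a x y z : gns z (a *: x + y) = conjc a * gns z x + gns z y.
Proof.
elim/free_ind: z => [|b g z IH]; first by rewrite /gns !gext0 mulr0 addr0.
rewrite !gnsPl IH /gns !gext_delta gextP.
exact: (scale_add_exchange (U := R[i]^o)).
Qed.

Lemma gns0l x : gns 0 x = 0. Proof. exact: gext0. Qed.
Lemma gns0r x : gns x 0 = 0.
Proof. by have := gnsPr (-1) 0 0 x; rewrite scaler0 addr0 rmorphN1 mulN1r addNr. Qed.

Lemma gns_delta g h : gns (gdelta R[i] g) (gdelta R[i] h) = (psi (h^-1 * g)%g)%:C.
Proof. by rewrite /gns !gext_delta. Qed.

Fact gnsC x y : gns x y = conjc (gns y x).
Proof.
elim/free_ind: x => [|a g x IH]; first by rewrite gns0l gns0r conjc0.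
rewrite gnsPl gnsPr IH rmorphD rmorphM; congr (_ + _); clear x IH.
rewrite [in RHS]/= conjcK; congr (_ * _).
elim/free_ind: y => [|b h y IH]; first by rewrite gns0l gns0r conjc0.
rewrite gnsPl gnsPr IH rmorphD rmorphM; congr (_ * _ + _).
by rewrite !gns_delta /= oppr0 -psiV invgM invgK.
Qed.

Fact gns_ge0 v : 0 <= gns v v.
Proof.
have [D vE] := gcoefE v; pose c k := gcoef k v; rewrite -/(c _) in vE.
have lin w : gns v w = \sum_(k <- D) c k * gns (gdelta R[i] k) w.
  rewrite {1}vE; elim: D {vE} => [|k D IH]; first by rewrite !big_nil gns0l.
  by rewrite !big_cons gnsPl IH.
have linr k : gns (gdelta R[i] k) v =
    \sum_(l <- D) conjc (c l) * gns (gdelta R[i] k) (gdelta R[i] l).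
  rewrite {1}vE; elim: D {vE lin} => [|l D IH]; first by rewrite !big_nil gns0r.
  by rewrite !big_cons gnsPr IH.
rewrite lin; have := psi_pd (fun i : 'I_(size D) => tnth (in_tuple D) i)
  (fun i => c (tnth (in_tuple D) i)).
congr (0 <= _); rewrite [RHS]big_tnth; apply: eq_bigr => i _.
rewrite linr mulr_sumr [RHS]big_tnth; apply: eq_bigr => j _.
by rewrite gns_delta mulrA.
Qed.

Definition gns_form : hform A := HForm gnsPl gnsC gns_ge0.

Lemma gns_shift g v w : gns (gshift g v) (gshift g w) = gns v w.
Proof.
elim/free_ind: v => [|a h v IH]; first by rewrite /gshift gmul0r !gns0l.
rewrite gshift_linear !gnsPl IH; congr (_ * _ + _); clear v IH.
elim/free_ind: w => [|b k w IH]; first by rewrite /gshift gmul0r !gns0r.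
rewrite gshift_linear !gnsPr IH; congr (_ * _ + _).
by rewrite /gshift !gmul_delta !gns_delta invgM -mulgA mulKg.
Qed.

(** g |-> delta_g - delta_1 is a cocycle for left translation. *)
Lemma gns_displacement g :
  hnorm gns_form (gdelta R[i] g - gdelta R[i] 1%g) ^+ 2 = 2 * psi 1%g - 2 * psi g.
Proof.
rewrite hnorm_sqr !(rformBl, rformBr) /rform /= !gns_delta /=.
by rewrite !mulVg invg1 mulg1 mul1g psiV; lra.
Qed.

End PositiveDefinite.

Section SmallAngleConsequences.
Variables (R : realType) (G : groupType) (I : finType) (s : I -> G) (p : nat).
Hypothesis p_pr : prime p.
Hypothesis sp : forall i, (s i ^+ p = 1)%g.
Hypothesis sz : forall i j, exists z,
  [/\ (s j * s i = s i * s j * z)%g, commute z (s i) & commute z (s j)].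
Hypothesis sgen : forall P : G -> Prop, P 1%g ->
  (forall i g, P g -> P (s i * g)%g) -> forall g, P g.
Hypothesis I_gt0 : (0 < #|I|)%N.
Hypothesis p_large : (#|I|.-1 ^ 2 < p)%N.

(** The bound for cocycles, with K the sum of the norms on the generators. *)
Theorem small_angle_kazhdan : kazhdan R G.
Proof.
move=> H pi c cM; pose B := hilbert_hform H.
pose K := \sum_i hnorm B (c (s i)).
have K0 : 0 <= K by apply: sumr_ge0 => i _; exact: hnorm_ge0.
have cK i : hnorm B (c (s i)) <= K.
  by rewrite /K (bigD1 i) //= lerDl; apply: sumr_ge0 => j _; exact: hnorm_ge0.
have piP g : linear (pi g) by move=> a x y; rewrite linearP.
have iso g x y : B (pi g x) (pi g y) = B x y by exact: rep_unitary.
exists ((1 + 2 / (1 - rate R I p)) * (#|I|%:R * p%:R) * K) => g.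
rewrite hilbert_normE lecR.
exact: (cocycle_bound p_pr sp sz sgen I_gt0 p_large piP (rep1 pi) (@repM _ _ _ pi) iso cM K0 cK).
Qed.

(** The cocycle bound for g |-> delta_g - delta_1 in the GNS form of psi. *)
Theorem small_angle_spectral_gap : exists2 M : R, 0 < M &
  forall psi : G -> R, psi 1%g = 1 -> (forall g, psi g^-1%g = psi g) ->
  (forall (m : nat) (g : 'I_m -> G) (c : 'I_m -> R[i]),
    0 <= \sum_i \sum_j c i * conjc (c j) * (psi ((g j)^-1 * g i)%g)%:C) ->
  forall d, (forall i, 1 - psi (s i) <= d) -> forall g, 1 - psi g <= M * d.
Proof.
pose M0 : R := (1 + 2 / (1 - rate R I p)) * (#|I|%:R * p%:R).
(* The square of the displacement by g is 2 (1 - psi g). *)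
exists (M0 ^+ 2 + 1); first by have := sqr_ge0 M0; lra.
move=> psi psi1 psiV psi_pd d hd g.
pose B := gns_form psiV psi_pd.
pose c h : free_module R[i] G := gdelta R[i] h - gdelta R[i] 1%g.
have cE h : hnorm B (c h) ^+ 2 = 2 - 2 * psi h by rewrite gns_displacement psi1 mulr1.
have d0 : 0 <= d.
  have [i0 _] := card_gt0P I_gt0; apply: le_trans (hd i0).
  by have := cE (s i0); have := sqr_ge0 (hnorm B (c (s i0))); lra.
have iso h v w : B (gshift h v) (gshift h w) = B v w by exact: gns_shift.
have pi1 (v : free_module R[i] G) : gshift 1%g v = v by exact: gmul1l.
have piM h k (v : free_module R[i] G) : gshift (h * k)%g v = gshift h (gshift k v).
  by rewrite /gshift -gmul_delta gmulA.
have cM h k : c (h * k)%g = gshift h (c k) + c h.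
  by rewrite /c gshiftB /gshift !gmul_delta mulg1 addrA subrK.
pose K := Num.sqrt (2 * d); have K0 : 0 <= K by exact: sqrtr_ge0.
have K2 : K ^+ 2 = 2 * d by rewrite sqr_sqrtr // mulr_ge0.
have cK i : hnorm B (c (s i)) <= K.
  rewrite -(ler_pXn2r (n := 2)) ?nnegrE ?hnorm_ge0 // cE K2.
  by have := hd i; lra.
have := cocycle_bound p_pr sp sz sgen I_gt0 p_large (@gshift_linear R G) pi1 piM iso cM K0 cK g.
rewrite -/M0 -(ler_pXn2r (n := 2)) ?nnegrE ?hnorm_ge0 //; last first.
  exact: le_trans (hnorm_ge0 _ _) (cocycle_bound p_pr sp sz sgen I_gt0 p_large
    (@gshift_linear R G) pi1 piM iso cM K0 cK g).
rewrite exprMn cE K2; have := mulr_ge0 (sqr_ge0 M0) d0; lra.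
Qed.

End SmallAngleConsequences.

(** * Positive block matrices *)

Section Adjoint.
Variable R : realType.
Local Notation C := R[i].

Lemma adjmxE m n (A : 'M[C]_(m, n)) i j : adjmx A i j = conjc (A j i).
Proof. by rewrite !mxE. Qed.

Lemma adjmxK m n (A : 'M[C]_(m, n)) : adjmx (adjmx A) = A.
Proof. by apply/matrixP => i j; rewrite !adjmxE conjcK. Qed.

Lemma adjmxM m n q (A : 'M[C]_(m, n)) (B : 'M[C]_(n, q)) :
  adjmx (A *m B) = adjmx B *m adjmx A.
Proof. by rewrite /adjmx trmx_mul map_mxM. Qed.

Lemma adjmxD m n (A B : 'M[C]_(m, n)) : adjmx (A + B) = adjmx A + adjmx B.
Proof. by apply/matrixP => i j; rewrite !mxE rmorphD. Qed.

Lemma adjmxZ m n a (A : 'M[C]_(m, n)) : adjmx (a *: A) = conjc a *: adjmx A.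
Proof. by apply/matrixP => i j; rewrite !mxE rmorphM. Qed.

Lemma adjmx1 n : adjmx (1%:M : 'M[C]_n) = 1%:M.
Proof. by rewrite /adjmx trmx1 map_mx1. Qed.

Lemma adjmxB m n (A B : 'M[C]_(m, n)) : adjmx (A - B) = adjmx A - adjmx B.
Proof. by apply/matrixP => i j; rewrite !mxE rmorphB. Qed.

Lemma mxtrace_adj n (A : 'M[C]_n) : \tr (adjmx A) = conjc (\tr A).
Proof. by rewrite /mxtrace rmorph_sum; apply: eq_bigr => i _; rewrite adjmxE. Qed.

Lemma adjmx_delta n (i : 'I_n) : adjmx (delta_mx i 0 : 'cV[C]_n) = delta_mx 0 i.
Proof. by apply/matrixP => k l; rewrite !mxE rmorph_nat andbC. Qed.

(** Polarization: positivity on u + v and u + i v gives the real and the imaginary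
    parts. *)
Lemma psdmx_herm n (M : 'M[C]_n) : psdmx M -> adjmx M = M.
Proof.
move=> hM; pose Q (u v : 'cV[C]_n) := (adjmx u *m M *m v) 0 0.
have QDr u v w : Q w (u + v) = Q w u + Q w v by rewrite /Q mulmxDr mxE.
have QZr a u w : Q w (a *: u) = a * Q w u by rewrite /Q -scalemxAr mxE.
have QDl u v w : Q (u + v) w = Q u w + Q v w.
  by rewrite /Q adjmxD !mulmxDl mxE.
have QZl a u w : Q (a *: u) w = conjc a * Q u w.
  by rewrite /Q adjmxZ -!scalemxAl mxE.
have Qre u : Im (Q u u) = 0 by exact/ger0_Im/hM.
have key u v : Q v u = conjc (Q u v).
  have := Qre (u + v); have := Qre (u + 'i%C *: v); rewrite !(QDl, QDr, QZl, QZr).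
  have := Qre u; have := Qre v.
  case: (Q u u) (Q v v) (Q u v) (Q v u) => [a1 a2] [b1 b2] [c1 c2] [d1 d2] /=.
  move=> -> ->; rewrite !(mulr0, mul0r, mulr1, mul1r, subr0, addr0, add0r, oppr0).
  rewrite !(mulNr, mulrN, mul1r, opprK) => h1 h2.
  by congr Complex; lra.
have QE i j : Q (delta_mx i 0) (delta_mx j 0) = M i j.
  by rewrite /Q adjmx_delta -rowE -colE !mxE.
apply/matrixP => i j; rewrite adjmxE -(QE i j) -(QE j i).
exact/esym/key.
Qed.

(** By the spectral theorem; B is the square root of the diagonal part in an
    orthonormal basis of eigenvectors. *)
Lemma psdmx_factor n (M : 'M[C]_n) : psdmx M -> exists B : 'M[C]_n, M = adjmx B *m B.
Proof.
move=> hM; have Mh := psdmx_herm hM.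
have /orthomx_spectralP : M \is normalmx.
  by apply/normalmxP; change (M *m adjmx M = adjmx M *m M); rewrite Mh.
set P := spectralmx M; set d := spectral_diag M.
have Pu : P \is unitarymx by exact: spectral_unitarymx.
have PP : P *m adjmx P = 1%:M by exact/unitarymxP.
rewrite (invmx_unitary Pu) => ME0; have ME : M = adjmx P *m diag_mx d *m P by exact: ME0.
have d0 i : 0 <= d 0 i.
  have := hM (adjmx P *m delta_mx i 0); rewrite ME.
  rewrite adjmxM adjmxK.
  rewrite -!mulmxA (mulmxA P (adjmx P)) PP mul1mx (mulmxA P (adjmx P)) PP mul1mx.
  by rewrite adjmx_delta mulmxA -rowE -colE !mxE eqxx mulr1n.
exists (diag_mx (map_mx sqrtC d) *m P).
rewrite adjmxM ME.
rewrite -!mulmxA; congr (_ *m _); rewrite mulmxA; congr (_ *m _).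
apply/matrixP => i j; rewrite !mxE (bigD1 i) //= big1 => [|k ki].
  rewrite !mxE eqxx addr0; case: eqP => [->|_]; rewrite ?mulr1n ?mulr0n ?mulr0 //.
  have r0 : sqrtC (d 0 j) \is Num.real by rewrite ger0_real // sqrtC_ge0.
  by rewrite (CrealP r0) -expr2 sqrtCK.
by rewrite !mxE (negbTE ki) mulr0n conjC0 mul0r.
Qed.

Definition frob N n (X Y : 'M[C]_(N, n)) : C := ntr (adjmx Y *m X).

Lemma ntrP n a (X Y : 'M[C]_n) : ntr (a *: X + Y) = a * ntr X + ntr Y.
Proof. by rewrite /ntr mxtraceD mxtraceZ mulrDl mulrA. Qed.

Lemma ntrB n (X Y : 'M[C]_n) : ntr (X - Y) = ntr X - ntr Y.
Proof. by rewrite /ntr raddfB mulrBl. Qed.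

Lemma ntr_adj n (X : 'M[C]_n) : ntr (adjmx X) = conjc (ntr X).
Proof. by rewrite /ntr mxtrace_adj rmorphM /= conjc_inv conjc_nat. Qed.

Lemma ntrC n (X Y : 'M[C]_n) : ntr (X *m Y) = ntr (Y *m X).
Proof. by rewrite /ntr mxtrace_mulC. Qed.

Lemma mxtrace_adj_ge0 N n (X : 'M[C]_(N, n)) : 0 <= \tr (adjmx X *m X).
Proof.
apply: sumr_ge0 => i _; rewrite mxE; apply: sumr_ge0 => j _.
by rewrite adjmxE mulrC -conjCE mul_conjC_ge0.
Qed.

Fact frobPl N n a (X Y Z : 'M[C]_(N, n)) :
  frob (a *: X + Y) Z = a * frob X Z + frob Y Z.
Proof. by rewrite /frob mulmxDr -scalemxAr ntrP. Qed.
Fact frobC N n (X Y : 'M[C]_(N, n)) : frob X Y = conjc (frob Y X).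
Proof. by rewrite /frob -ntr_adj adjmxM adjmxK. Qed.
Fact frob_ge0 N n (X : 'M[C]_(N, n)) : 0 <= frob X X.
Proof. by rewrite /frob /ntr mulr_ge0 ?mxtrace_adj_ge0 // invr_ge0. Qed.

Definition frob_form N n : hform 'M[C]_(N, n) := HForm (@frobPl N n) (@frobC N n) (@frob_ge0 N n).

End Adjoint.

(** * Uniform almost multiplicativity *)

Section GramFunctions.
Variables (R : realType) (G : groupType) (n : nat) (phi : G -> 'M[R[i]]_n).
Hypothesis n_gt0 : (0 < n)%N.
Local Notation C := R[i].

(** The matrix form of complete positivity: phi (h^-1 g) = B_h^* B_g. *)
Definition gram_function := forall (m : nat) (g : 'I_m -> G),
  exists (N : nat) (B : 'I_m -> 'M[C]_(N, n)),
    forall i j, phi ((g i)^-1 * g j)%g = adjmx (B i) *m B j.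

Hypothesis phi_gram : gram_function.
Hypothesis phi1 : phi 1%g = 1%:M.

Definition psi (g : G) : R := rform (frob_form R n n) (phi g) (phi g).
Definition rtr (g : G) : R := Re (ntr (phi g)).

Lemma ntr1 : ntr (1%:M : 'M[C]_n) = 1.
Proof. by rewrite /ntr mxtrace1 mulfV // pnatr_eq0 -lt0n. Qed.

Lemma psiE g : (psi g)%:C = ntr (adjmx (phi g) *m phi g).
Proof. by rewrite /psi -hf_real. Qed.

(** Three points of the group suffice for the Schwarz-type inequalities below. *)
Lemma phi_triple (g0 g1 g2 : G) : exists (N : nat) (B : nat -> 'M[C]_(N, n)),
  forall i j, (i < 3)%N -> (j < 3)%N ->
    adjmx (B i) *m B j = phi ((nth 1 [:: g0; g1; g2] i)^-1 * nth 1 [:: g0; g1; g2] j)%g.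
Proof.
have [N [B hB]] := phi_gram (fun i : 'I_3 => nth 1%g [:: g0; g1; g2] i).
exists N, (fun i => B (inord i)) => i j i3 j3.
by rewrite -hB !inordK.
Qed.

Lemma phiV g : phi g^-1%g = adjmx (phi g).
Proof.
have [N [B hB]] := phi_triple 1%g g 1%g.
have := hB 0 1 isT isT; have := hB 1 0 isT isT.
by rewrite /= invg1 mul1g mulg1 => <- <-; rewrite adjmxM adjmxK.
Qed.

Lemma psi1 : psi 1%g = 1.
Proof. by apply: complexI; rewrite psiE phi1 adjmx1 mulmx1 ntr1. Qed.

Lemma psiV g : psi g^-1%g = psi g.
Proof. by apply: complexI; rewrite !psiE phiV adjmxK ntrC. Qed.

(** psi (h^-1 g) is the normalized Hilbert-Schmidt product of B_g B_g^* and
    B_h B_h^*. *)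
Lemma psi_pd (m : nat) (g : 'I_m -> G) (c : 'I_m -> C) :
  0 <= \sum_i \sum_j c i * conjc (c j) * (psi ((g j)^-1 * g i)%g)%:C.
Proof.
have [N [B hB]] := phi_gram g.
pose P i := B i *m adjmx (B i); pose S := \sum_i c i *: P i.
have aS : adjmx S = \sum_j conjc (c j) *: adjmx (P j).
  rewrite /S; elim/big_rec2: _ => [|j X Y _ <-]; first by apply/matrixP => i k; rewrite !mxE rmorph0.
  by rewrite adjmxD adjmxZ.
have -> : \sum_i \sum_j c i * conjc (c j) * (psi ((g j)^-1 * g i)%g)%:C =
    \tr (adjmx S *m S) / n%:R.
  rewrite aS mulmx_suml raddf_sum mulr_suml exchange_big; apply: eq_bigr => j _ /=.
  rewrite mulmx_sumr raddf_sum mulr_suml; apply: eq_bigr => i _ /=.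
  rewrite -scalemxAl -scalemxAr scalerA mxtraceZ -[RHS]mulrA (mulrC (conjc _)); congr (_ * _).
  rewrite psiE hB adjmxM adjmxK /P adjmxM adjmxK /ntr; congr (_ / _).
  by rewrite -[LHS]mxtrace_mulC -!mulmxA [RHS]mxtrace_mulC -!mulmxA.
by rewrite mulr_ge0 ?mxtrace_adj_ge0 // invr_ge0.
Qed.

(** The multiplicative domain estimate: with 1, g^-1, h represented by B_1, B_0,
    B_2, the difference is the inner product of B_0 with the component of B_2
    orthogonal to the range of B_1, whose squared norm is 1 - psi h. *)
Lemma ntr_mul_close g h :
  cabs (ntr (phi (g * h)%g) - ntr (phi g *m phi h)) <= Num.sqrt (1 - psi h).
Proof.
have [N [B hB]] := phi_triple g^-1%g 1%g h.
have := (hB 0 1 isT isT, hB 1 2 isT isT, hB 0 2 isT isT, hB 0 0 isT isT, hB 2 2 isT isT, hB 1 1 isT isT)%N.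
rewrite /= !mulVg invgK invg1 mulg1 mul1g phi1.
move: (B 0%N) (B 1%N) (B 2%N) => B0 B1 B2 [[[[[E01 E12] E02] E00] E22] E11].
pose D := B2 - B1 *m (adjmx B1 *m B2); pose F := frob_form R N n.
have -> : ntr (phi (g * h)%g) - ntr (phi g *m phi h) = F D B0.
  by rewrite -ntrB /= /frob /D mulmxBr (mulmxA (adjmx B0)) E01 E02 E12.
apply: le_trans (hf_cauchy_schwarz F _ _) _.
have -> : hnorm F B0 = 1 by rewrite /hnorm /rform /= /frob E00 ntr1 /= sqrtr1.
rewrite mulr1 /hnorm ler_wsqrtr // /rform /= /frob.
rewrite /D adjmxB !adjmxM adjmxK mulmxBl !mulmxBr E22.
have -> : adjmx B2 *m B1 *m adjmx B1 *m (B1 *m (adjmx B1 *m B2)) =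
    adjmx B2 *m B1 *m adjmx B1 *m B2.
  by rewrite -!mulmxA (mulmxA (adjmx B1) B1) E11 mul1mx.
rewrite subrr subr0 ntrB ntr1 ReB /= lerD2l lerN2 -lecR psiE -E12 adjmxM adjmxK.
rewrite -!mulmxA RRe_real // ger0_real // ; have := frob_ge0 (adjmx B1 *m B2).
by rewrite /frob adjmxM adjmxK -!mulmxA.
Qed.

Lemma rtr_swap d g h : (forall k, 1 - psi k <= d) ->
  `|rtr (g * h)%g - rtr (h * g)%g| <= 2 * Num.sqrt d.
Proof.
move=> hd.
have hk k l : `|rtr (k * l)%g - Re (ntr (phi k *m phi l))| <= Num.sqrt d.
  rewrite -ReB; apply: le_trans (Re_le_cabs _) (le_trans (ntr_mul_close _ _) _).
  exact: ler_wsqrtr.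
have := hk g h; have := hk h g; rewrite [ntr (phi h *m _)]ntrC !ler_norml.
by move=> /andP[h1 h2] /andP[h3 h4]; apply/andP; split; lra.
Qed.

(** With vectors B_1, B_g, B_h for 1, g, h, the number 1 - rtr (g^-1 h) is half
    the squared distance of B_g and B_h; compare with the distances to B_1. *)
Lemma rtr_triangle g h : 1 - rtr (g^-1 * h)%g <= 2 * (1 - rtr g) + 2 * (1 - rtr h).
Proof.
have [N [B hB]] := phi_triple 1%g g h.
have := (hB 0 1 isT isT, hB 1 2 isT isT, hB 0 2 isT isT, hB 0 0 isT isT, hB 2 2 isT isT, hB 1 1 isT isT)%N.
rewrite /= !mulVg invg1 !mul1g phi1.
move: (B 0%N) (B 1%N) (B 2%N) => B0 B1 B2 [[[[[E01 E12] E02] E00] E22] E11].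
pose F := frob_form R N n.
have := rform_ge0 F ((B1 - B0) + (B2 - B0)).
rewrite !(rformDl, rformDr, rformNl, rformNr).
have FE X Y : rform F X Y = Re (ntr (adjmx Y *m X)) by [].
rewrite (rformC F B0 B1) (rformC F B0 B2) (rformC F B1 B2).
by rewrite !FE E01 E02 E12 E00 E11 E22 ntr1 /= /rtr; lra.
Qed.

End GramFunctions.

(** * Failure of the factorization property *)

Lemma nat_pigeonhole (T : finType) (f : nat -> T) : exists j k, (j < k)%N /\ f j = f k.
Proof.
have /injectivePn[a [b ab fab]] : ~~ injectiveb (fun i : 'I_#|T|.+1 => f i).
  apply/injectiveP => /leq_card; by rewrite card_ord ltnn.
have [ltab|ltba|/ord_inj eab] := ltngtP a b.
- by exists a, b.
- by exists b, a.
- by rewrite eab eqxx in ab.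
Qed.

(** Cut the range into intervals of length e and use the pigeonhole principle. *)
Lemma bounded_close_pair (R : realType) (J : finType) (x : nat -> J -> R) (M e : R) :
  0 < e -> (forall k j, `|x k j| <= M) ->
  exists a b, (a < b)%N /\ forall j, `|x a j - x b j| <= e.
Proof.
move=> e0 xM; pose u k j := (x k j + M) / e.
have uM k j : 0 <= u k j <= 2 * M / e.
  have := xM k j; rewrite ler_norml => /andP[h1 h2].
  by rewrite divr_ge0 ?(ltW e0) ?ler_pM2r ?invr_gt0 //; lra.
pose Q := Num.truncn (2 * M / e).
have uQ k j : (Num.truncn (u k j) < Q.+1)%N.
  by rewrite ltnS le_truncn //; case/andP: (uM k j).
have [a [b [ab E]]] := nat_pigeonhole (fun k => [ffun j => Ordinal (uQ k j)]).
exists a, b; split=> // j.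
have /(congr1 val) /= := congr1 (fun h : {ffun J -> 'I_Q.+1} => h j) E.
rewrite !ffunE /= => tE.
have /andP[a0 _] := uM a j; have /andP[b0 _] := uM b j.
have /andP[a1 a2] := truncn_itv a0; have /andP[b1 b2] := truncn_itv b0.
rewrite tE in a1 a2.
have -> : x a j - x b j = (u a j - u b j) * e.
  by rewrite /u; field; rewrite gt_eqF.
rewrite normrM (gtr0_norm e0) ler_piMl ?(ltW e0) //.
move: a1 a2 b1 b2; rewrite -natr1 ler_norml => a1 a2 b1 b2.
by apply/andP; split; lra.
Qed.

Section GramContradiction.
Variables (R : realType) (G : groupType) (n : nat) (phi : G -> 'M[R[i]]_n).
Hypothesis n_gt0 : (0 < n)%N.
Hypothesis phi_gram : gram_function phi.
Hypothesis phi1 : phi 1%g = 1%:M.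
Local Notation F := (frob_form R n n).

Lemma psi_le1 g : psi phi g <= 1.
Proof.
have := sqr_ge0 (hnorm (gns_form (psiV phi_gram) (psi_pd phi_gram))
  (gdelta R[i] g - gdelta R[i] 1%g)).
by rewrite gns_displacement psi1 //; lra.
Qed.

Lemma frob_entries (X : 'M[R[i]]_n) :
  rform F X X = (\sum_a \sum_b cabs (X a b) ^+ 2) / n%:R.
Proof.
rewrite exchange_big; apply: complexI.
rewrite -hf_real /= /frob /ntr rmorphM /= fmorphV rmorph_nat.
congr (_ / _); rewrite rmorph_sum /=; apply: eq_bigr => b _.
rewrite mxE rmorph_sum; apply: eq_bigr => a _.
by rewrite adjmxE mulrC -cabs_sqr.
Qed.

(** The matrices phi g have bounded entries, since psi g <= 1. *)
Lemma close_pair (x : nat -> G) (e : R) : 0 < e -> exists j k, (j < k)%N /\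
  hnorm F (phi (x j) - phi (x k)) ^+ 2 <= e.
Proof.
move=> e0; have nn : 0 < n%:R :> R by rewrite ltr0n.
have n1 : 1 <= n%:R :> R by rewrite ler1n.
pose entry k (t : 'I_n * 'I_n * bool) : R :=
  if t.2 then Re (phi (x k) t.1.1 t.1.2) else Im (phi (x k) t.1.1 t.1.2).
have ebound k a b : cabs (phi (x k) a b) <= n%:R.
  rewrite -(ler_pXn2r (n := 2)) ?nnegrE ?cabs_ge0 //.
  have := psi_le1 (x k); rewrite /psi frob_entries ler_pdivrMr // mul1r => h.
  apply: le_trans (_ : n%:R <= _); last by rewrite expr2 ler_peMl.
  apply: le_trans h; rewrite (bigD1 a) //= (bigD1 b) //= -addrA lerDl addr_ge0 //.
    by apply: sumr_ge0 => i _; exact: sqr_ge0.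
  by apply: sumr_ge0 => i _; apply: sumr_ge0 => j _; exact: sqr_ge0.
have tbound k t : `|entry k t| <= n%:R.
  rewrite /entry; case: t.2; apply: le_trans (ebound k t.1.1 t.1.2).
    exact: Re_le_cabs.
  exact: Im_le_cabs.
pose d := Num.sqrt (e / (4 * n%:R)).
have d2 : d ^+ 2 = e / (4 * n%:R) by rewrite sqr_sqrtr // divr_ge0 ?mulr_ge0 ?ltW.
have d0 : 0 < d by rewrite sqrtr_gt0 divr_gt0 // mulr_gt0.
have [j [k [jk h]]] := bounded_close_pair d0 tbound.
exists j, k; split=> //; rewrite hnorm_sqr frob_entries ler_pdivrMr //.
apply: le_trans (_ : _ <= \sum_(a < n) \sum_(b < n) (2 * d) ^+ 2) _.
  apply: ler_sum => a _; apply: ler_sum => b _.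
  rewrite ler_pXn2r ?nnegrE ?cabs_ge0 ?mulr_ge0 ?(ltW d0) //.
  rewrite !mxE; apply: le_trans (cabs_le_ReIm _) _; rewrite ReB ImB.
  by have := h (a, b, true); have := h (a, b, false); rewrite /entry /=; lra.
rewrite !sumr_const card_ord exprMn d2 -mulrnA -[leLHS]mulr_natr natrM.
by rewrite le_eqVlt; apply/orP; left; apply/eqP; field; rewrite gt_eqF.
Qed.

(** For some j < k the element w = x_j^-1 x_k has trace close to 1, and so has its
    conjugate w z by y_k. The bounds 1 / 100 are small enough for all errors together
    to stay below 1 / 2. *)
Lemma rtr_commutator (x y : nat -> G) (z : G) (d : R) :
  (forall g, 1 - psi phi g <= d) -> d <= 1 / 100 -> Num.sqrt d <= 1 / 100 ->
  (forall j k, (j < k)%N -> (y k * x j = x j * y k)%g) ->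
  (forall k, (x k * y k = y k * x k * z)%g) ->
  1 / 2 < rtr phi z.
Proof.
move=> hd d1 sd xy xyz.
have [j [k [jk close]]] := @close_pair x (1 / 100) ltac:(lra).
pose w := ((x j)^-1 * x k)%g.
have wy : (w * y k = y k * (w * z))%g.
  have yV : ((x j)^-1 * y k = y k * (x j)^-1)%g.
    by apply: (mulgI (x j)); rewrite mulVKg mulgA -xy // mulgK.
  by rewrite /w -mulgA xyz !mulgA yV.
have zE : z = (w^-1 * ((y k)^-1 * (w * y k)))%g by rewrite wy !mulKg.
have fw : 1 - rtr phi w <= 1 / 40.
  have := ntr_mul_close n_gt0 phi_gram phi1 (x j)^-1%g (x k).
  move=> /(le_trans (Re_le_cabs _)); rewrite ReB -/(rtr _ _) -/w phiV //.
  have := ler_wsqrtr (hd (x k)) => h1 /le_trans/(_ (le_trans h1 sd)).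
  have E : hnorm F (phi (x j) - phi (x k)) ^+ 2 =
      psi phi (x j) + psi phi (x k) - 2 * Re (ntr (adjmx (phi (x j)) *m phi (x k))).
    rewrite hnorm_sqr rformBl !rformBr (rformC F (phi (x j)) (phi (x k))) /psi.
    have -> : rform F (phi (x k)) (phi (x j)) = Re (ntr (adjmx (phi (x j)) *m phi (x k))) by [].
    by move: (rform _ _ _) (rform _ _ _) (Re _) => *; ring.
  have := hd (x j); have := hd (x k); rewrite E in close; move: close.
  move: (psi phi (x j)) (psi phi (x k)) (rtr phi w) => a b c.
  by move: (Re _) => r h2 h3 h4; rewrite ler_norml => /andP[h5 h6]; lra.
have fwy : 1 - rtr phi ((y k)^-1 * (w * y k))%g <= 1 / 20.
  have := rtr_swap n_gt0 phi_gram phi1 (y k)^-1%g (w * y k)%g hd.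
  by rewrite mulgK ler_norml => /andP[h1 h2]; lra.
have := rtr_triangle n_gt0 phi_gram phi1 w ((y k)^-1 * (w * y k))%g.
rewrite -zE; lra.
Qed.

End GramContradiction.

Section CompletelyPositive.
Variables (R : realType) (G : groupType) (A : cstarAlgebra R) (u : G -> A).
Hypothesis u1 : u 1%g = cone A.
Hypothesis uM : forall g h : G, u (g * h)%g = cmul A (u g) (u h).
Hypothesis uV : forall g : G, u g^-1%g = cstar A (u g).

(** Complete positivity for the matrix Y with one nonzero row, the u (g i). *)
Lemma cp_gram n (phi : {linear A -> 'M[R[i]]_n}) :
  completely_positive phi -> gram_function (fun g => phi (u g)).
Proof.
move=> cp [|m] g; first by exists 0%N, (fun=> 0) => -[].
pose Y : 'M[A]_m.+1 := \matrix_(l, i) (if l == 0 then u (g i) else 0).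
have s0 : cstar A 0 = 0.
  by have := cstarP (-1) (0 : A) 0; rewrite scaler0 addr0 rmorphN1 scaleN1r addNr.
have YE i j : \sum_l cmul A (cstar A (Y l i)) (Y l j) = u ((g i)^-1 * g j)%g.
  rewrite (bigD1 0) //= !mxE eqxx big1 ?addr0 => [|l l0]; first by rewrite uM uV.
  by rewrite !mxE (negbTE l0) s0 linear0l.
have /psdmx_factor[B BE] := cp _ Y.
exists _, (fun i => submxrow B i) => i j.
have : \mxblock_(i < m.+1, j < m.+1) phi (u ((g i)^-1 * g j)%g) =
    \mxblock_(i < m.+1, j < m.+1) (adjmx (submxrow B i) *m submxrow B j).
  rewrite -mul_mxcol_mxrow submxrowK.
  have -> : \mxcol_(i < m.+1) adjmx (submxrow B i) = adjmx B.
    by apply/mxcolP => k; rewrite mxcolK; apply/matrixP => a b; rewrite !mxE.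
  by rewrite -BE; apply: eq_mxblock => k l; rewrite YE.
by move/eq_mxblockP => ->.
Qed.

End CompletelyPositive.

Lemma norm2E (R : realType) n (X : 'M[R[i]]_n) : norm2 X = (hnorm (frob_form R n n) X)%:C.
Proof.
rewrite /norm2; have -> : ntr (adjmx X *m X) = (hnorm (frob_form R n n) X)%:C ^+ 2.
  by rewrite -rmorphXn /= hnorm_sqr -hf_real.
by rewrite sqrCK // lecR hnorm_ge0.
Qed.

Lemma cvg0_eventually (R : realType) (v : nat -> R[i]^o) (e : R) :
  v @ \oo --> (0 : R[i]^o) -> 0 < e ->
  exists m, forall k, (m <= k)%N -> cabs (v k) <= e.
Proof.
move=> /cvgn_dist_le h e0; have [m hm] := h e%:C ltac:(by rewrite ltcR).
by exists m => k /hm; rewrite sub0r normrN cabsE lecR.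
Qed.

Section NoFactorization.
Variables (R : realType) (G : groupType) (I : finType) (s : I -> G).
Hypothesis gap : exists2 M : R, 0 < M &
  forall psi : G -> R, psi 1%g = 1 -> (forall g, psi g^-1%g = psi g) ->
  (forall (m : nat) (g : 'I_m -> G) (c : 'I_m -> R[i]),
    0 <= \sum_i \sum_j c i * conjc (c j) * (psi ((g j)^-1 * g i)%g)%:C) ->
  forall d, (forall i, 1 - psi (s i) <= d) -> forall g, 1 - psi g <= M * d.
Variables (x y : nat -> G) (z : G).
Hypothesis xy : forall j k, (j < k)%N -> (y k * x j = x j * y k)%g.
Hypothesis xyz : forall k, (x k * y k = y k * x k * z)%g.
Hypothesis z_neq1 : z <> 1%g.

(** For a late map of the sequence, 1 - psi is small on the generators, hence
    everywhere by the spectral gap, and [rtr_commutator] contradicts tr (phi z) -> 0. *)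
Theorem not_factorization : ~ factorization_property R G.
Proof.
move=> [_ fp]; have [M M0 hgap] := gap.
have mgc := @max_group_cstarP R G; have ctr := @canonical_traceP R G.
have [n [phi [h1 h2 h3]]] := fp _ _ _ mgc ctr.
pose u := @wemb R G; pose A := max_cstar R G.
have u1 : u 1%g = cone A := max_cstar1 mgc.
have uM : forall g h, u (g * h)%g = cmul A (u g) (u h) := max_cstarM mgc.
have uV : forall g, u g^-1%g = cstar A (u g) := max_cstarV mgc.
pose c : R := 1 / 100; have c0 : 0 < c by rewrite /c; lra.
have c1 : c <= 1 / 100 by [].
have cc : c ^+ 2 <= 1 / 100 by rewrite /c; lra.
move: c c0 c1 cc => c c0 c1 cc.
(* The gap turns d into c ^ 2, and the trace estimates involve its square root. *)
pose d : R := c ^+ 2 / M; have d0 : 0 < d by rewrite divr_gt0 // exprn_gt0.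
have /choice[N hN] i : exists m, forall k, (m <= k)%N ->
    hnorm (frob_form R _ _) (phi k (u (s i)) *m phi k (u (s i)^-1%g) - 1%:M) <= d.
  have [m hm] := cvg0_eventually (h2 (u (s i)) (u (s i)^-1%g)) d0.
  exists m => k /hm; rewrite norm2E cabs_real (ger0_norm (hnorm_ge0 _ _)).
  have -> : cmul A (u (s i)) (u (s i)^-1%g) = cone A by rewrite -uM mulgV u1.
  by have [_ -> _] := h1 k.
have [m hm] := cvg0_eventually (h3 (u z)) (ltac:(lra) : 0 < 1 / 2 :> R).
pose k := maxn m (\max_i N i); have [n0 phi1 cp] := h1 k.
pose Phi g := phi k (u g).
have Phi1 : Phi 1%g = 1%:M by rewrite /Phi u1.
have gram : gram_function Phi by exact: cp_gram.
have close i : 1 - psi Phi (s i) <= d.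
  have : (N i <= k)%N by apply: leq_trans (leq_maxr _ _); exact: leq_bigmax.
  move=> /hN; apply: le_trans; rewrite -/(Phi _) -/(Phi _) phiV //.
  set X := (Phi (s i) *m _ - 1%:M); have := hf_cauchy_schwarz (frob_form R _ _) X 1%:M.
  have -> : hnorm (frob_form R (n k) (n k)) 1%:M = 1.
    by rewrite /hnorm /rform /= /frob adjmx1 mul1mx ntr1 // sqrtr1.
  rewrite mulr1; apply: le_trans.
  have -> : frob_form R (n k) (n k) X 1%:M = (psi Phi (s i) - 1)%:C.
    by rewrite /= /frob adjmx1 mul1mx /X ntrB ntr1 // ntrC -psiE rmorphB.
  by rewrite cabs_real -normrN opprB ler_norm.
have unif := hgap (psi Phi) (psi1 n0 Phi1) (psiV gram) (psi_pd gram) d close.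
have Md : M * d = c ^+ 2 by rewrite /d mulrC divfK // gt_eqF.
rewrite Md in unif.
have sq : Num.sqrt (c ^+ 2) <= 1 / 100 by rewrite sqrtr_sqr gtr0_norm.
have := rtr_commutator n0 gram Phi1 unif cc sq xy xyz.
have := hm k (leq_maxl _ _); rewrite (can_traceE ctr).
have /eqP/negbTE -> := z_neq1; rewrite sub0r normrN.
rewrite cabsE cabs_real (ger0_norm (cabs_ge0 _)) => /(le_trans (Re_le_cabs _)).
rewrite ler_norml => /andP[_]; rewrite -/(rtr Phi z) => a b.
by have := le_lt_trans a b; rewrite ltxx.
Qed.

End NoFactorization.

(** * Elementary matrices over a matrix ring *)

Section Shears.
Variables (F : finFieldType) (N : nat).
Local Notation M := 'M[F]_N.+1.
Local Notation V := {ffun 'I_3 -> 'rV[F]_N.+1}.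
Implicit Types (i j k l : 'I_3) (r s : M) (x : V).

(** Right multiplication of a row of three blocks by 1 + r E_ij. *)
Definition shear i j r x : V := [ffun k => x k + (if k == j then x i *m r else 0)].

Lemma shearD i j r s : i != j -> shear i j r \o shear i j s =1 shear i j (s + r).
Proof.
move=> ij x; apply/ffunP => k; rewrite !ffunE (negbTE ij) addr0 -addrA.
by case: (k == j); rewrite ?addr0 // -mulmxDr.
Qed.

Lemma shear0 i j x : shear i j 0 x = x.
Proof. by apply/ffunP => k; rewrite ffunE mulmx0 if_same addr0. Qed.

Lemma shearK i j r : i != j -> cancel (shear i j r) (shear i j (- r)).
Proof. by move=> ij x; have /= -> := shearD (- r) r ij x; rewrite subrr shear0. Qed.

Definition elem i j (ij : i != j) r : {perm V} := perm (can_inj (shearK r ij)).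

Lemma elemE i j (ij : i != j) r x : elem ij r x = shear i j r x.
Proof. exact: permE. Qed.

Lemma elemD i j (ij : i != j) r s : (elem ij r * elem ij s)%g = elem ij (r + s).
Proof. by apply/permP => x; rewrite permM !elemE; exact: shearD. Qed.

Lemma elem0 i j (ij : i != j) : elem ij 0 = 1%g.
Proof. by apply/permP => x; rewrite elemE shear0 perm1. Qed.

Lemma elemX i j (ij : i != j) r n : (elem ij r ^+ n)%g = elem ij (r *+ n).
Proof.
elim: n => [|n IH]; first by rewrite expg0 elem0.
by rewrite expgS IH elemD mulrS.
Qed.

Lemma elem_eq1 i j (ij : i != j) r : elem ij r = 1%g -> r = 0.
Proof.
move=> /permP e; apply/row_matrixP => a.
have /ffunP/(_ j) := e [ffun k => if k == i then delta_mx 0 a else 0].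
rewrite elemE perm1 !ffunE eqxx eq_sym (negbTE ij) eqxx add0r row0.
by rewrite -rowE.
Qed.

Lemma elem_commute i j k l (ij : i != j) (kl : k != l) r s :
  j != k -> l != i -> commute (elem ij r) (elem kl s).
Proof.
move=> jk li; apply/permP => x; rewrite !permM !elemE; apply/ffunP => m.
rewrite !ffunE ![k == _]eq_sym ![i == _]eq_sym (negbTE jk) (negbTE li) !addr0.
by rewrite addrAC.
Qed.

Lemma elem_swap i j k (ij : i != j) (jk : j != k) (ik : i != k) r s :
  (elem ij r * elem jk s = elem jk s * elem ij r * elem ik (r *m s))%g.
Proof.
apply/permP => x; rewrite !permM !elemE; apply/ffunP => m.
rewrite !ffunE eqxx (negbTE ij) (negbTE ik) !addr0 mulmxDl.
case: (eqVneq m j) => [->|mj]; last first.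
  by rewrite !addr0; case: (m == k); rewrite ?addr0 // !addrA mulmxA.
by rewrite (negbTE jk) !addr0.
Qed.

Lemma elem_comm i j k (ij : i != j) (jk : j != k) (ik : i != k) r s :
  [~ elem ij r, elem jk s]%g = elem ik (r *m s).
Proof.
apply: (mulgI (elem jk s * elem ij r)%g).
by rewrite -commgC (elem_swap ij jk ik).
Qed.

(** The row unit E_0k, which vanishes when k is out of range. *)
Definition urow (k : nat) : M := \matrix_(a, b) ((a == 0 :> nat) && (b == k :> nat))%:R.
Definition shift_mx : M := \matrix_(a, b) (b == a.+1 :> nat)%:R.

Lemma urow_shift (k : nat) : urow k *m shift_mx = urow k.+1.
Proof.
apply/matrixP => a b; rewrite !mxE.
have [kN|Nk] := ltnP k N.+1; last first.
  rewrite big1 => [|c _]; last first.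
    by rewrite !mxE (ltn_eqF (leq_trans (ltn_ord c) Nk)) andbF mul0r.
  by rewrite (ltn_eqF (leq_trans (ltn_ord b) (leqW Nk))) andbF.
rewrite (bigD1 (Ordinal kN)) //= big1 ?addr0 => [|c ck].
  by rewrite !mxE eqxx andbT -natrM mulnb.
by rewrite !mxE -val_eqE /= in ck *; rewrite (negbTE ck) andbF mul0r.
Qed.

Lemma urow_mul (j k : nat) : urow j *m (urow k)^T =
  if (j == k) && (k < N.+1)%N then urow 0 else 0.
Proof.
apply/matrixP => a b; rewrite mxE.
have E (c : 'I_N.+1) : urow j a c * (urow k)^T c b =
    [&& a == 0 :> nat, b == 0 :> nat, c == j :> nat & c == k :> nat]%:R.
  by rewrite !mxE -natrM mulnb andbACA -andbA.
rewrite (eq_bigr _ (fun c _ => E c)).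
case: ifP => [/andP[/eqP <- jN]|jk]; last first.
  rewrite mxE big1 // => c _; case: eqP => //= _; case: eqP => //= _.
  case: eqP => //= cj; case: eqP => //= ck.
  by move: jk; rewrite -cj -ck eqxx ltn_ord.
rewrite (bigD1 (Ordinal jN)) //= big1 ?addr0 => [|c cj]; last first.
  by rewrite -val_eqE /= in cj; rewrite (negbTE cj) !andbF.
by rewrite !mxE eqxx !andbT.
Qed.

Lemma urow0_neq0 : urow 0 != 0.
Proof.
by apply/eqP => /matrixP/(_ 0 0); rewrite !mxE /= => /eqP; rewrite oner_eq0.
Qed.

End Shears.

(** * The group generated in an ultraproduct of finite groups *)

Section WordGroup.
Variables (I : finType) (K : nat -> finGroupType) (gen : forall m, I -> K m).
Variable U : set_system nat.
Hypothesis U_ultra : UltraFilter U.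

(** Letters are formal generators with a flag for the inverse. *)
Definition formal := seq (I * bool).
Implicit Types (w v : formal) (m : nat).

Definition weval m w : K m :=
  foldr (fun l g => (if l.2 then (gen m l.1)^-1 else gen m l.1) * g)%g 1%g w.

Lemma weval_cat m w v : weval m (w ++ v) = (weval m w * weval m v)%g.
Proof. by elim: w => [|l w IH] /=; rewrite ?mul1g // IH mulgA. Qed.

Definition winv w : formal := rev [seq (l.1, ~~ l.2) | l <- w].

Lemma weval_inv m w : weval m (winv w) = ((weval m w)^-1)%g.
Proof.
elim: w => [|[i b] w IH]; first by rewrite /= invg1.
rewrite /winv /= rev_cons -cats1 weval_cat IH invMg /= mulg1.
by case: b => //=; rewrite invgK.
Qed.

Definition wcomm w v : formal := winv w ++ winv v ++ w ++ v.

Lemma weval_comm m w v : weval m (wcomm w v) = [~ weval m w, weval m v]%g.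
Proof. by rewrite !weval_cat !weval_inv. Qed.

(** Equality in the ultraproduct of the groups K m. *)
Definition weq w v : bool := `[< U [set m | weval m w = weval m v] >].

Local Instance U_proper : ProperFilter U := @ultra_proper _ _ U_ultra.

Lemma weq_equiv_class : equiv_class_of weq.
Proof.
split=> [w|w v|v w x].
- by apply/asboolP; apply: filterS (filterT : U setT).
- by apply/asboolP/asboolP; apply: filterS => m /= ->.
- move=> /asboolP h1 /asboolP h2; apply/asboolP.
  by apply: filterS2 h1 h2 => m /= -> ->.
Qed.
Canonical weq_equiv := EquivRelPack weq_equiv_class.

Local Open Scope quotient_scope.
Definition word_group := {eq_quot weq_equiv}.
HB.instance Definition _ := Choice.on word_group.

Definition wcls w : word_group := \pi_word_group w.
Definition wrep (x : word_group) : formal := generic_quotient.repr x.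

Lemma wrepK x : wcls (wrep x) = x.
Proof. exact: reprK. Qed.

Lemma wclsP w v : wcls w = wcls v <-> U [set m | weval m w = weval m v].
Proof.
by split=> [/eqmodP/asboolP | h]; [| apply/eqmodP/asboolP].
Qed.

Lemma wclsT w v : (forall m, weval m w = weval m v) -> wcls w = wcls v.
Proof. by move=> h; apply/wclsP; apply: filterS (filterT : U setT) => m _; exact: h. Qed.

Lemma wrep_cls w : U [set m | weval m (wrep (wcls w)) = weval m w].
Proof. by apply/wclsP; rewrite wrepK. Qed.

Definition wg_mul (x y : word_group) : word_group := wcls (wrep x ++ wrep y).
Definition wg_inv (x : word_group) : word_group := wcls (winv (wrep x)).

Lemma wg_mulE w v : wg_mul (wcls w) (wcls v) = wcls (w ++ v).
Proof.
apply/wclsP; apply: filterS2 (wrep_cls w) (wrep_cls v) => m /= h1 h2.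
by rewrite !weval_cat h1 h2.
Qed.

Lemma wg_invE w : wg_inv (wcls w) = wcls (winv w).
Proof.
by apply/wclsP; apply: filterS (wrep_cls w) => m /= h; rewrite !weval_inv h.
Qed.

Fact wg_mulA : associative wg_mul.
Proof. by move=> x y z; rewrite -(wrepK x) -(wrepK y) -(wrepK z) !wg_mulE catA. Qed.
Fact wg_mul1 : left_id (wcls [::]) wg_mul.
Proof. by move=> x; rewrite -(wrepK x) wg_mulE. Qed.
Fact wg_mulr1 : right_id (wcls [::]) wg_mul.
Proof. by move=> x; rewrite -(wrepK x) wg_mulE cats0. Qed.
Fact wg_mulV : left_inverse (wcls [::]) wg_inv wg_mul.
Proof.
move=> x; rewrite -(wrepK x) wg_invE wg_mulE; apply: wclsT => m.
by rewrite weval_cat weval_inv mulVg.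
Qed.
Fact wg_mulrV : right_inverse (wcls [::]) wg_inv wg_mul.
Proof.
move=> x; rewrite -(wrepK x) wg_invE wg_mulE; apply: wclsT => m.
by rewrite weval_cat weval_inv mulgV.
Qed.

HB.instance Definition _ := isGroup.Build word_group
  wg_mulA wg_mul1 wg_mulr1 wg_mulV wg_mulrV.

Lemma wclsM w v : (wcls w * wcls v = wcls (w ++ v))%g.
Proof. exact: wg_mulE. Qed.
Lemma wcls1 : 1%g = wcls [::] :> word_group.
Proof. by []. Qed.
Lemma wclsV w : ((wcls w)^-1 = wcls (winv w))%g.
Proof. exact: wg_invE. Qed.

Definition wgen (i : I) : word_group := wcls [:: (i, false)].

Lemma weval_gen m i : weval m [:: (i, false)] = gen m i.
Proof. by rewrite /= mulg1. Qed.

Lemma wcls_expg w n : exists v, (wcls w ^+ n)%g = wcls v /\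
  forall m, weval m v = (weval m w ^+ n)%g.
Proof.
elim: n => [|n [v [vE hv]]]; first by exists [::]; split=> [|m]; rewrite expg0.
exists (w ++ v); split=> [|m]; first by rewrite expgS vE wclsM.
by rewrite weval_cat hv expgS.
Qed.

Lemma wgen_generated : finitely_generated word_group.
Proof.
exists [seq wgen i | i <- enum I] => x; rewrite -(wrepK x).
exists [seq (wgen l.1, l.2) | l <- wrep x].
  rewrite /word_on all_map; apply/allP => l _ /=.
  by apply: map_f; rewrite mem_enum.
elim: (wrep x) => [|[i b] w IH] //=; rewrite IH.
case: b => /=; first by rewrite /wgen wclsV wclsM; apply: wclsT.
by rewrite /wgen wclsM.
Qed.

(** Inverses of generators of finite order are positive powers. *)
Lemma wgen_ind p : (forall i, (wgen i ^+ p.+1 = 1)%g) ->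
  forall P : word_group -> Prop, P 1%g ->
  (forall i g, P g -> P (wgen i * g)%g) -> forall g, P g.
Proof.
move=> wp P P1 PS x; rewrite -(wrepK x); elim: (wrep x) => [|[i b] w IH] //.
have PX n g : P g -> P (wgen i ^+ n * g)%g.
  move=> Pg; elim: n => [|n IHn]; first by rewrite expg0 mul1g.
  by rewrite expgS -mulgA; exact: PS.
have wE : wcls ((i, b) :: w) = ((if b then (wgen i)^-1 else wgen i) * wcls w)%g.
  by case: b; rewrite /wgen ?wclsV wclsM; apply: wclsT.
rewrite wE; case: b {wE}; last exact: PS.
have -> : ((wgen i)^-1 = wgen i ^+ p)%g.
  by apply: (mulgI (wgen i)); rewrite mulgV -expgS wp.
exact: PX.
Qed.

Lemma wneq w v : wcls w <> wcls v -> U [set m | weval m w <> weval m v].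
Proof.
move=> ne; have [h|//] := in_ultra_setVsetC [set m | weval m w = weval m v] U_ultra.
by case: ne; exact/wclsP.
Qed.

Lemma filter_all (T : eqType) (s : seq T) (P : T -> nat -> Prop) :
  (forall x, x \in s -> U [set m | P x m]) -> U [set m | forall x, x \in s -> P x m].
Proof.
elim: s => [|x s IH] h; first by apply: filterS (filterT : U setT).
have h1 := h x (mem_head x s).
have h2 : U [set m | forall x, x \in s -> P x m].
  by apply: IH => y ys; apply: h; rewrite inE ys orbT.
apply: filterS2 h1 h2 => m /= px ps y; rewrite inE => /orP[/eqP -> //|]; exact: ps.
Qed.

(** The finitely many products and inequalities that hold in a finite piece of the
    group hold at once in almost all K m. *)
Lemma word_group_LEF : LEF word_group.
Proof.
move=> F F2; pose T := [seq (x, y) | x <- F ++ F2, y <- F ++ F2].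
have hinj : U [set m | forall t, t \in T ->
    t.1 <> t.2 -> weval m (wrep t.1) <> weval m (wrep t.2)].
  apply: filter_all => t _; have [->|ne] := EM (t.1 = t.2).
    by apply: filterS (filterT : U setT) => m _ /=; case.
  have /wneq : wcls (wrep t.1) <> wcls (wrep t.2) by rewrite !wrepK.
  by apply: filterS => m /= h _.
have hmul : U [set m | forall t, t \in [seq (x, y) | x <- F, y <- F] ->
    weval m (wrep (t.1 * t.2)%g) = (weval m (wrep t.1) * weval m (wrep t.2))%g].
  apply: filter_all => t _; have := wrep_cls (wrep t.1 ++ wrep t.2).
  rewrite -wclsM !wrepK; apply: filterS => m /= ->; exact: weval_cat.
have [m [/= inj mul]] := filter_ex (filterI hinj hmul).
exists (K m), (fun x => weval m (wrep x)); split=> [x y xF yF e | x y xF yF].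
  have [//|ne] := EM (x = y).
  by case: (inj (x, y) _ ne e); apply/allpairsP; exists (x, y).
by apply: (mul (x, y)); apply/allpairsP; exists (x, y).
Qed.

End WordGroup.

(** * Local embeddability into finite groups and its finitary consequences *)

Section RegularAction.
Variable K : finGroupType.

Fact reg_inj (k : K) :
  injective (fun i : 'I_#|K| => enum_rank (enum_val i * k)%g).
Proof. by move=> i j /enum_rank_inj/mulIg/enum_val_inj. Qed.

Definition reg_perm (k : K) : 'S_#|K| := perm (@reg_inj k).

Lemma reg_permM a b : reg_perm (a * b)%g = (reg_perm a * reg_perm b)%g.
Proof. by apply/permP => i; rewrite permM !permE enum_rankK mulgA. Qed.

Lemma reg_perm1 : reg_perm 1%g = 1%g.
Proof. by apply/permP => i; rewrite !permE mulg1 enum_valK. Qed.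

Lemma reg_permV a : reg_perm (a^-1)%g = ((reg_perm a)^-1)%g.
Proof. by apply: (mulgI (reg_perm a)); rewrite -reg_permM !mulgV reg_perm1. Qed.

Lemma reg_perm_fix k i : (reg_perm k i == i) = (k == 1%g).
Proof.
rewrite permE -{2}(enum_valK i) (inj_eq enum_rank_inj).
by rewrite -{2}(mulg1 (enum_val i)) (inj_eq (mulgI _)).
Qed.

Lemma card_fixpoints_reg k :
  #|fixpoints (reg_perm k)| = (if k == 1%g then #|K| else 0)%N.
Proof.
case: ifP => k1.
  by rewrite -[RHS]card_ord; apply: eq_card => i; rewrite inE reg_perm_fix k1.
by apply: eq_card0 => i; rewrite inE reg_perm_fix k1.
Qed.

Lemma finGroup_card_gt0 : (0 < #|K|)%N.
Proof. by apply/card_gt0P; exists 1%g. Qed.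

End RegularAction.

(** Enlarging the finite set by the unit makes the local embedding unital. *)
Lemma LEF_unital (G : groupType) (F : seq G) : LEF G ->
  exists (K : finGroupType) (phi : G -> K),
    [/\ phi 1%g = 1%g, {in F, forall g, phi g = 1%g -> g = 1%g}
      & {in F &, forall f g : G, phi (f * g)%g = (phi f * phi g)%g}].
Proof.
move=> lef; have [K [phi [inj mul]]] := lef (1%g :: F).
have in1 : 1%g \in 1%g :: F by rewrite inE eqxx.
have phi1 : phi 1%g = 1%g.
  by apply: (mulgI (phi 1%g)); rewrite mulg1 -mul // mulg1.
exists K, phi; split=> // [g gF e | f g fF gF].
  apply: inj; last by rewrite phi1.
    by rewrite mem_cat inE gF orbT.
  by rewrite mem_cat in1.
by rewrite mul // inE ?fF ?gF orbT.
Qed.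

(** The regular action of a finite group is free. *)
Lemma LEF_sofic (R : realType) (G : groupType) : LEF G -> sofic R G.
Proof.
move=> /LEF_unital lef eps F /andP[e0 e1].
have [K [phi [phi1 inj mul]]] := lef F.
exists #|K|, (fun g => reg_perm (phi g)); split; first exact: finGroup_card_gt0.
split=> [g h gF hF||g gF g1]; last 2 first.
- by rewrite phi1 reg_perm1.
- rewrite card_fixpoints_reg; case: eqP => [/(inj _ gF)//|_].
  by rewrite mulr_ge0 // ltW.
rewrite mul // reg_permM mulgV -reg_perm1 card_fixpoints_reg eqxx.
by rewrite ler_piMl // lerBlDr lerDl ltW.
Qed.

Fixpoint word_ball (G : groupType) (S : seq G) (n : nat) : seq G :=
  if n is n'.+1 then
    word_ball S n' ++
    [seq (l * g)%g | l <- S ++ [seq (s^-1)%g | s <- S], g <- word_ball S n']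
  else [:: 1%g].

Lemma mem_word_ball (G : groupType) (S : seq G) n (t : word G) :
  word_on S t -> (size t <= n)%N -> word_eval t \in word_ball S n.
Proof.
elim: n t => [|n IH] [|[s b] t] //=; first by rewrite mem_seq1.
  by move=> _ _; rewrite mem_cat (IH [::]).
move=> /andP[/= sS tS] tn; rewrite mem_cat; apply/orP; right.
apply/allpairsP; exists (if b then s^-1 else s, word_eval t)%g.
split=> //=; last exact: IH.
by case: b; rewrite mem_cat ?sS // map_f ?orbT.
Qed.

Lemma mxtrace_perm_mx (R : pzSemiRingType) n (s : 'S_n) :
  \tr (perm_mx s : 'M[R]_n) = #|fixpoints s|%:R.
Proof.
rewrite /mxtrace (eq_bigr (fun i => (s i == i)%:R)) => [|i _].
  rewrite -natr_sum -sum1_card [in RHS]big_mkcond; congr _%:R.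
  by apply: eq_bigr => i _; rewrite inE; case: eqP.
by rewrite !mxE eq_sym.
Qed.

Lemma adjmx_perm (R : realType) n (s : 'S_n) :
  adjmx (perm_mx s : 'M[R[i]]_n) = perm_mx (s^-1)%g.
Proof. by rewrite /adjmx tr_perm_mx map_perm_mx. Qed.

(** The permutation matrices of the regular action of K: the normalized trace of
    such a matrix is 0 or 1. The ball of radius n + 1 contains the letters also for
    n = 0. *)
Lemma LEF_hyperlinear (R : realType) (G : groupType) :
  finitely_generated G -> LEF G -> hyperlinear R G.
Proof.
move=> fg /LEF_unital lef; split=> // S _ n eps eps0.
have [K [phi [phi1 inj mul]]] := lef (word_ball S n.+1).
exists #|K|, (fun g => perm_mx (reg_perm (phi g))).
split=> [|t tS tn]; first exact: finGroup_card_gt0.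
have letterE s b : s \in S ->
    (if b then adjmx (perm_mx (reg_perm (phi s)) : 'M[R[i]]_#|K|)
     else perm_mx (reg_perm (phi s))) =
    perm_mx (reg_perm (phi (if b then s^-1 else s)%g)).
  move=> sS; case: b => //; rewrite adjmx_perm -reg_permV; congr (perm_mx (reg_perm _)).
  have sB b : (if b then s^-1 else s)%g \in word_ball S n.+1.
    have := @mem_word_ball _ S n.+1 [:: (s, b)]; rewrite /= mulg1; apply => //.
    by rewrite /word_on /= sS.
  apply: (mulgI (phi s)); rewrite mulgV -mul ?mulgV ?phi1 //; first exact: sB false.
  exact: sB true.
have evE : word_evalmx (fun g => perm_mx (reg_perm (phi g)) : 'M[R[i]]_#|K|) t =
    perm_mx (reg_perm (phi (word_eval t))).
  elim: t tS tn => [|[s b] t IH] /=; first by rewrite phi1 reg_perm1 perm_mx1.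
  move=> /andP[/= sS tS] tn; rewrite IH //; last exact: ltnW.
  rewrite letterE // mul ?reg_permM ?perm_mxM //; last first.
    by apply: mem_word_ball => //; exact: leqW (ltnW tn).
  have := @mem_word_ball _ S n.+1 [:: (s, b)]; rewrite /= mulg1; apply => //.
  by rewrite /word_on /= sS.
rewrite evE /ntr mxtrace_perm_mx card_fixpoints_reg.
have -> : (phi (word_eval t) == 1%g) = (word_eval t == 1%g).
  apply/eqP/eqP => [|->]; last exact: phi1.
  by apply: inj; apply: mem_word_ball => //; exact: leqW.
have K0 : #|K|%:R != 0 :> R[i] by rewrite pnatr_eq0 -lt0n finGroup_card_gt0.
by case: eqP => _; rewrite ?mul0r ?divff // subrr normr0 lecR ltW.
Qed.

(** * The group *)

Section TheGroup.
Local Notation F := 'F_17.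
Local Notation K := (fun m : nat => {perm {ffun 'I_3 -> 'rV[F]_m.+1}}).

Definition b1 : 'I_3 := @Ordinal 3 0 isT.
Definition b2 : 'I_3 := @Ordinal 3 1 isT.
Definition b3 : 'I_3 := @Ordinal 3 2 isT.

Local Notation e12 := (@elem F _ b1 b2 isT).
Local Notation e23 := (@elem F _ b2 b3 isT).
Local Notation e13 := (@elem F _ b1 b3 isT).
Local Notation e31 := (@elem F _ b3 b1 isT).

(** Five letters, listed with their values in [shear_gen]. *)
Definition letter : finType := option (option (option bool)).
Definition lA : letter := None.
Definition lB : letter := Some None.
Definition lE : letter := Some (Some None).
Definition lT : letter := Some (Some (Some true)).
Definition lT' : letter := Some (Some (Some false)).

Definition shear_gen (m : nat) (l : letter) : K m :=
  match l with
  | None => e12 1%:M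
  | Some None => e23 1%:M
  | Some (Some None) => e31 (urow F m 0)
  | Some (Some (Some true)) => e31 (shift_mx F m)
  | Some (Some (Some false)) => e31 (shift_mx F m)^T
  end.

Lemma commute_inv (H : groupType) (a b : H) : commute a b -> commute (a^-1)%g b.
Proof. by move=> ab; apply/commute_sym/commuteV/commute_sym. Qed.

Lemma elem_comm_central m (i j k : 'I_3) (ij : i != j) (jk : j != k) (ik : i != k)
    (r s : 'M[F]_m.+1) (z := [~ elem ij r, elem jk s]%g) :
  commute z (elem ij r) /\ commute z (elem jk s).
Proof.
rewrite /z (elem_comm ij jk ik).
by split; apply: elem_commute => //; rewrite eq_sym.
Qed.

Lemma comm_central_sym (H : groupType) (a b : H) :
  commute [~ a, b]%g a /\ commute [~ a, b]%g b ->
  commute [~ b, a]%g b /\ commute [~ b, a]%g a.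
Proof.
by move=> [za zb]; rewrite -invgR; split; apply: commute_inv.
Qed.

(** Two of the pairs (1,2), (2,3), (3,1) are equal or consecutive; in the latter
    case the shears belong to a Heisenberg group. *)
Lemma shear_gen_central m l l' (z := [~ shear_gen m l, shear_gen m l']%g) :
  commute z (shear_gen m l) /\ commute z (shear_gen m l').
Proof.
have same i j (ij : i != j) (r s : 'M[F]_m.+1) (y := [~ elem ij r, elem ij s]%g) :
    commute y (elem ij r) /\ commute y (elem ij s).
  have -> : y = 1%g; last by split; apply/commute_sym/commute1.
  apply: (mulgI (elem ij s * elem ij r)%g); rewrite mulg1 -commgC.
  by apply: elem_commute; rewrite // eq_sym.
have h12 r s := @elem_comm_central m b1 b2 b3 isT isT isT r s.
have h23 r s := @elem_comm_central m b2 b3 b1 isT isT isT r s.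
have h31 r s := @elem_comm_central m b3 b1 b2 isT isT isT r s.
have h12' r s := comm_central_sym (h12 r s).
have h23' r s := comm_central_sym (h23 r s).
have h31' r s := comm_central_sym (h31 r s).
by rewrite {}/z; case: l => [[[[]|]|]|]; case: l' => [[[[]|]|]|] /=.
Qed.

Local Notation W l := ([:: (l, false)] : formal letter).

(** Their values are e12(E_0k) and e23(E_k0): taking commutators with e23(1) and
    with e32(T) = [e31(T), e12(1)] turns e12(E_0k) into e13(E_0k) and then into
    e12(E_0k T) = e12(E_0,k+1); similarly for e23, with T^t and E_k0. *)
Fixpoint wX (k : nat) : formal letter :=
  if k is k'.+1 then wcomm (wcomm (wX k') (W lB)) (wcomm (W lT) (W lA))
  else wcomm (wcomm (W lA) (W lB)) (wcomm (W lE) (W lA)).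

Fixpoint wY (k : nat) : formal letter :=
  if k is k'.+1 then wcomm (wcomm (W lB) (W lT')) (wcomm (W lA) (wY k'))
  else wcomm (wcomm (W lB) (W lE)) (wcomm (W lA) (W lB)).

Lemma weval_X m k : weval shear_gen m (wX k) = e12 (urow F m k).
Proof.
elim: k => [|k IH]; rewrite !weval_comm ?IH !weval_gen /shear_gen.
- rewrite (@elem_comm _ _ b1 b2 b3 isT isT isT) (@elem_comm _ _ b3 b1 b2 isT isT isT).
  by rewrite (@elem_comm _ _ b1 b3 b2 isT isT isT) mul1mx mulmx1 mul1mx.
- rewrite (@elem_comm _ _ b1 b2 b3 isT isT isT) (@elem_comm _ _ b3 b1 b2 isT isT isT).
  by rewrite (@elem_comm _ _ b1 b3 b2 isT isT isT) !mulmx1 urow_shift.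
Qed.

Lemma weval_Y m k : weval shear_gen m (wY k) = e23 (urow F m k)^T.
Proof.
elim: k => [|k IH]; rewrite !weval_comm ?IH !weval_gen /shear_gen.
- rewrite (@elem_comm _ _ b2 b3 b1 isT isT isT) (@elem_comm _ _ b1 b2 b3 isT isT isT).
  rewrite (@elem_comm _ _ b2 b1 b3 isT isT isT) mul1mx !mulmx1; congr elem.
  by apply/matrixP => a b; rewrite !mxE andbC.
- rewrite (@elem_comm _ _ b2 b3 b1 isT isT isT) (@elem_comm _ _ b1 b2 b3 isT isT isT).
  by rewrite (@elem_comm _ _ b2 b1 b3 isT isT isT) !mul1mx -trmx_mul urow_shift.
Qed.

Variable U : set_system nat.
Hypothesis U_ultra : UltraFilter U.
Hypothesis U_free : \oo `<=` U.
Local Notation G := (word_group shear_gen U_ultra).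
Local Notation cls := (wcls shear_gen U_ultra).
Local Notation s := (wgen shear_gen U_ultra).

Lemma gen_exp l : (s l ^+ 17 = 1)%g.
Proof.
have [v [-> hv]] := wcls_expg shear_gen U_ultra (W l) 17.
rewrite wcls1; apply: wclsT => m; rewrite hv weval_gen.
have M0 (r : 'M[F]_m.+1) : r *+ 17 = 0.
  by rewrite -scaler_nat (_ : 17%:R = 0 :> F) ?scale0r //; exact/eqP.
by case: l {hv} => [[[[]|]|]|]; rewrite /shear_gen elemX M0 elem0.
Qed.

Lemma gen_central l l' : exists z,
  [/\ (s l' * s l = s l * s l' * z)%g, commute z (s l) & commute z (s l')].
Proof.
pose c := wcomm (W l') (W l); exists (cls c).
have hc m := shear_gen_central m l' l.
have cE m : weval shear_gen m c = [~ shear_gen m l', shear_gen m l]%g.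
  by rewrite weval_comm !weval_gen.
clearbody c.
split; rewrite /wgen /commute !wclsM; apply: wclsT => m;
  rewrite !weval_cat ?cE !weval_gen; have [h1 h2] := hc m.
- exact: commgC.
- exact: h2.
- exact: h1.
Qed.

Local Notation x k := (cls (wX k)).
Local Notation y k := (cls (wY k)).
Local Notation z := (cls (wcomm (wX 0) (wY 0))).

Lemma XY_commute j k : (j < k)%N -> (y k * x j = x j * y k)%g.
Proof.
move=> jk; rewrite !wclsM; apply: wclsT => m.
rewrite !weval_cat weval_X weval_Y (@elem_swap _ _ b1 b2 b3 isT isT isT).
by rewrite urow_mul (ltn_eqF jk) elem0 mulg1.
Qed.

Lemma weval_z m : weval shear_gen m (wcomm (wX 0) (wY 0)) = e13 (urow F m 0).
Proof.
by rewrite weval_comm weval_X weval_Y (@elem_comm _ _ b1 b2 b3 isT isT isT) urow_mul.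
Qed.

(** In K_m the identity holds as soon as the index k fits in the matrices, that is
    for k <= m. *)
Lemma XY_comm k : (x k * y k = y k * x k * z)%g.
Proof.
have := weval_z; move: (wcomm _ _) => c cE.
rewrite !wclsM; apply/wclsP; apply: U_free; exists k => //= m /= km.
rewrite !weval_cat weval_X weval_Y cE (@elem_swap _ _ b1 b2 b3 isT isT isT).
by rewrite urow_mul eqxx ltnS km.
Qed.

Lemma z_neq1 : z <> 1%g.
Proof.
rewrite wcls1 => /wclsP h; have [m hm] := filter_ex h.
by have := esym (weval_z m); rewrite hm => /elem_eq1/eqP; rewrite (negbTE (urow0_neq0 _ _)).
Qed.

Lemma word_group_properties (R : realType) :
  [/\ finitely_generated G, kazhdan R G, LEF G & ~ factorization_property R G].
Proof.
have p17 : prime 17 by [].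
have I0 : (0 < #|letter|)%N by rewrite !card_option card_bool.
(* 17 is the least prime above 4 ^ 2. *)
have pl : (#|letter|.-1 ^ 2 < 17)%N by rewrite !card_option card_bool.
have gi := @wgen_ind _ _ shear_gen _ U_ultra 16 gen_exp.
split; [exact: wgen_generated | | exact: word_group_LEF |].
- exact: (small_angle_kazhdan p17 gen_exp gen_central gi I0 pl).
- have gap := small_angle_spectral_gap R p17 gen_exp gen_central gi I0 pl.
  exact: (not_factorization gap XY_commute XY_comm z_neq1).
Qed.
End TheGroup.

Theorem theorem1p4 (R : realType) :
  exists G : groupType,
    finitely_generated G /\ kazhdan R G /\ LEF G /\ sofic R G /\
    hyperlinear R G /\ ~ factorization_property R G.
Proof.
have [U [U_ultra U_free]] := @ultraFilterLemma nat \oo _.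
have [fg T lef nfp] := word_group_properties U_ultra U_free R.
exists (word_group shear_gen U_ultra).
by have sf := @LEF_sofic R _ lef; have hl := @LEF_hyperlinear R _ fg lef.
Qed.
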